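(* Let $D$ be a Dirichlet–Ferguson process with parameter $\alpha$ on $(A,\mathcal{A})$, and let $\mathbf{X}=\{X_n:n\ge 1\}$ be the associated Pólya sequence with parameter $\alpha$. Then every $F\in L^2(D)$ admits a unique representation of the form $$F=\mathbb{E}(F)+\sum_{n\ge 1}\int_{A^n}h_{(F,n)}\,\mathrm{d}D^{\otimes n},$$ where the series converges in $L^2(\mathbb{P})$ and $h_{(F,n)}\in\Xi_n(\mathbf{X})$ for every $n\ge 1$.
   Context: $(A,\mathcal{A})$ is a Polish space with its Borel $\sigma$-field and $\alpha$ is a finite positive measure on it ($0<\alpha(A)<\infty$). On a probability space $(\Omega,\mathcal{F},\mathbb{P})$, the Pólya sequence $\mathbf{X}=\{X_n:n\ge1\}$ with parameter $\alpha$ is a sequence of $A$-valued random variables such that, for every $k\ge1$ and $1\le j_1<\cdots<j_k$, $$\mathbb{P}(X_{j_1}\in da_1,\ldots,X_{j_k}\in da_k)=\prod_{i=1}^k\frac{\alpha(da_i)+\sum_{l=1}^{i-1}\delta_{a_l}(da_i)}{\alpha(A)+i-1}.$$ Write $\mathbf{X}_n=(X_1,\ldots,X_n)$. A Dirichlet–Ferguson (DF) process with parameter $\alpha$ is a random probability measure $D$ on $(A,\mathcal{A})$ such that for every finite measurable partition $(C_1,\ldots,C_n)$ of $A$ the vector $(D(C_1),\ldots,D(C_n))$ has a Dirichlet distribution with parameters $(\alpha(C_1),\ldots,\alpha(C_n))$ ($\alpha(C_i)=0$ meaning $D(C_i)=0$ a.s.). Standing convention: $D$ is always the a.s. limit of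 the empirical measures $\frac1n\sum_{i=1}^n\mathbf{1}_C(X_i)$ of the Pólya sequence $\mathbf{X}$ (a.s. convergence for all $C\in\mathcal{A}$); then, conditionally on $D$, the $X_i$ are i.i.d. with law $D$. $L^2(D)$ is the Hilbert space of square-integrable random variables measurable with respect to $\sigma(D(C):C\in\mathcal{A})$. $D^{\otimes n}$ is the $n$-fold (random) product measure of $D$ on $A^n$. $\Xi_n(\mathbf{X})$, $n\ge1$, is the class of symmetric measurable functions $h:A^n\to\mathbb{R}$ such that $\mathbb{E}(h(\mathbf{X}_n)^2)<\infty$ and $\mathbb{E}(h(\mathbf{X}_n)\mid\mathbf{X}_{n-1})=0$ a.s. (for $n=1$: $\mathbb{E}(h(X_1))=0$). Elements of $\Xi_n(\mathbf{X})$ are identified when they agree a.e. with respect to the law of $\mathbf{X}_n$; uniqueness is in this sense. *)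

(* Defs.v *)
From HB Require Import structures.
From mathcomp Require Import all_boot all_order all_algebra.
From mathcomp Require Import perm.
From mathcomp Require Import all_classical all_reals all_analysis.
From mathcomp Require Import measurable_realfun.

Set Implicit Arguments.
Unset Strict Implicit.
Unset Printing Implicit Defensive.

Import Order.TTheory GRing.Theory Num.Theory.
Import numFieldNormedType.Exports.

Local Open Scope classical_set_scope.
Local Open Scope ring_scope.

Section polish.
Context (R : realType).

Definition separable (T : topologicalType) :=
  exists2 S : set T, countable S & dense S.

Definition completely_metrizable (T : topologicalType) :=
  exists (M : metricType R) (f : T -> M) (g : M -> T),
    [/\ cancel f g, cancel g f, continuous f, continuous g &
        forall F : set_system M, ProperFilter F -> cauchy F -> exists x : M, F --> x].

Definition polish (T : topologicalType) :=
  separable T /\ completely_metrizable T.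

End polish.

Definition borel (T : ptopologicalType) := g_sigma_algebraType (@open T).
HB.instance Definition _ (T : ptopologicalType) := Measurable.on (borel T).

Section product_probability.
Context d1 d2 (T1 : measurableType d1) (T2 : measurableType d2) (R : realType).
Variables (P1 : probability T1 R) (P2 : probability T2 R).

Definition pprod := (P1 \x P2)%E.

HB.instance Definition _ := Measure.on pprod.

Let pprodT : pprod setT = 1%E.
Proof.
rewrite /pprod -setXTT product_measure1E//.
apply: etrans (congr2 mule (probability_setT P1) (probability_setT P2)) _.
by rewrite mule1.
Qed.

HB.instance Definition _ := Measure_isProbability.Build _ _ _ pprod pprodT.

End product_probability.

Section tuple_product.
Context d (T : measurableType d) (R : realType).

Definition tcons n (x : T * n.-tuple T) : n.+1.-tuple T :=
  [tuple of x.1 :: x.2].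

Let measurable_tcons n : measurable_fun setT (@tcons n).
Proof. exact: measurable_cons. Qed.

HB.instance Definition _ n :=
  isMeasurableFun.Build _ _ _ _ (@tcons n) (@measurable_tcons n).

(* The product probability mu_0 (x) ... (x) mu_(n-1) on n-tuples. *)
Fixpoint tuple_prod n : ('I_n -> probability T R) ->
    probability (n.-tuple T) R :=
  match n with
  | 0 => fun=> \d_[tuple]
  | m.+1 => fun mu =>
      distribution (pprod (mu ord0) (tuple_prod (fun i => mu (lift ord0 i))))
        (@tcons m)
  end.

Lemma tuple_prodE n (mu : 'I_n -> probability T R) (B : 'I_n -> set T) :
  (forall i, measurable (B i)) ->
  tuple_prod mu [set x | forall i, B i (tnth x i)] =
  (\prod_(i < n) mu i (B i))%E.
Proof.
elim: n mu B => [|n IH] mu B mB.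
  by rewrite big_ord0 /= diracE mem_set// => -[].
rewrite big_ord_recl/= -IH; last by move=> i; exact: mB.
rewrite /distribution /pushforward/= -product_measure1E//; last first.
  rewrite (_ : mkset _ =
    \bigcap_(i in [set: 'I_n]) (fun x => tnth x i) @^-1` B (lift ord0 i)).
    apply: fin_bigcap_measurable => // i _; rewrite -[X in measurable X]setTI.
    exact: measurable_tnth.
  by apply/seteqP; split => x /= H i; [move=> _; exact: H|exact: H].
congr (pprod _ _ _); apply/seteqP; split => -[x y] /=.
  move=> H; split; first by have := H ord0.
  by move=> i; have := H (lift ord0 i); rewrite tnthS.
by move=> [H0 H] i; case: (unliftP ord0 i) => [j ->|->//]; rewrite tnthS.
Qed.

End tuple_product.

Section dirichlet.
Context (R : realType).
Local Notation mu := (@lebesgue_measure R).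
Local Notation RT := (measurableTypeR R).

Definition gamma_density (a x : R) : R := x `^ (a - 1) * expR (- x).

Lemma gamma_density_ge0 a x : 0 <= gamma_density a x.
Proof. by rewrite mulr_ge0 ?powR_ge0 ?expR_ge0. Qed.

Lemma measurable_gamma_density a : measurable_fun setT (gamma_density a).
Proof.
apply: measurable_funM; first exact: measurable_powR.
by apply: measurableT_comp => //; exact: measurable_funN.
Qed.

Definition gamma_measure (a : R) (B : set RT) : \bar R :=
  (\int[mu]_(x in B `&` `]0%R, +oo[) (gamma_density a x)%:E)%E.

Section gamma_measure.
Variable a : R.

Let gamma0 : gamma_measure a set0 = 0%E.
Proof. by rewrite /gamma_measure set0I integral_set0. Qed.

Let gamma_ge0 B : (0 <= gamma_measure a B)%E.
Proof.
by apply: integral_ge0 => x _; rewrite lee_fin gamma_density_ge0.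
Qed.

Let gamma_sigma_additive : semi_sigma_additive (gamma_measure a).
Proof.
move=> F mF tF mUF; rewrite /gamma_measure/= setI_bigcupl.
rewrite ge0_integral_bigcup//=.
- by apply: is_cvg_nneseries => n _ _; exact: gamma_ge0.
- by move=> n; apply: measurableI => //; exact: mF.
- apply/measurable_funTS/measurableT_comp => //.
  exact: measurable_gamma_density.
- by move=> x _; rewrite lee_fin gamma_density_ge0.
- by move=> i j _ _ [x [[Fi _] [Fj _]]]; apply: tF => //; exists x.
Qed.

HB.instance Definition _ := isMeasure.Build _ _ _ (gamma_measure a)
  gamma0 gamma_ge0 gamma_sigma_additive.

End gamma_measure.

(* The Gamma(a, 1) law.  For a > 0 the mass of gamma_measure a is the finite
   positive number Gamma(a), hence the fallback of mnormalize is not used;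
   Gamma(0, 1) is the point mass at 0. *)
Definition gamma_prob (a : R) : probability RT R :=
  if 0 < a then [the probability RT R of mnormalize (gamma_measure a) \d_(0 : RT)]
  else [the probability RT R of \d_(0 : RT)].

(* The Dirichlet law, for parameters a_i >= 0 that are not all zero, as the law
   of (Y_i / (Y_0 + ... + Y_(n-1)))_i with Y_i independent of law
   Gamma(a_i, 1); if a_i = 0, the i-th coordinate is a.s. 0. *)
Definition dirichlet n (a : 'I_n -> R) : set (n.-tuple RT) -> \bar R :=
  pushforward (tuple_prod (fun i => gamma_prob (a i)))
    (fun y : n.-tuple R => [tuple tnth y i / \sum_(j < n) tnth y j | i < n]).

End dirichlet.

Section polya.
Context d (A : measurableType d) (R : realType).
Variable alpha : {finite_measure set A -> \bar R}.

Lemma polya_weight_ge0 k : 0 <= (fine (alpha setT) + k%:R)^-1.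
Proof. by rewrite invr_ge0 addr_ge0 ?fine_ge0. Qed.

(* Law of X_(k+1) given (X_1, ..., X_k) = s:
   (alpha + \sum_(a <- s) \d_a) / (alpha(A) + k). *)
Definition polya_kernel (s : seq A) : {measure set A -> \bar R} :=
  mscale (NngNum (polya_weight_ge0 (size s)))
    (foldr (fun a (m : {measure set A -> \bar R}) => measure_add \d_a m)
       alpha s).

(* The iterated integral over a_i in B_i of the kernels above:
   \int_(B_1) ... \int_(B_k) K(s, a_1, ..., a_(k-1); da_k) ... K(s; da_1). *)
Fixpoint polya_rect (s : seq A) (Bs : seq (set A)) : \bar R :=
  match Bs with
  | [::] => 1%E
  | B :: Bs' => (\int[polya_kernel s]_(a in B) polya_rect (rcons s a) Bs')%E
  end.

End polya.

(* X i stands for the (i+1)-st variable of the sequence. *)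
Section random_sequence.
Context d dA (Omega : measurableType d) (A : measurableType dA) (R : realType).
Variables (P : probability Omega R) (X : nat -> {RV P >-> A}).

Definition sample n (w : Omega) : n.-tuple A := [tuple X i w | i < n].

Let measurable_sample n : measurable_fun setT (sample n).
Proof.
apply/measurable_fun_tnthP => i.
by rewrite (_ : _ \o _ = X i)//; apply/funext => w /=; rewrite tnth_mktuple.
Qed.

HB.instance Definition _ n :=
  isMeasurableFun.Build _ _ _ _ (sample n) (@measurable_sample n).

Definition polya_sequence (alpha : {finite_measure set A -> \bar R}) :=
  forall (k : nat) (j : 'I_k -> nat) (B : 'I_k -> set A),
    (forall i l : 'I_k, (i < l)%N -> (j i < j l)%N) ->
    (forall i, measurable (B i)) ->
    P (\bigcap_(i in [set: 'I_k]) X (j i) @^-1` B i) =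
    polya_rect alpha [::] [seq B i | i <- enum 'I_k].

(* Z is a version of the conditional expectation of Y given the
   sub-sigma-algebra G. *)
Definition cond_expectation (G : set (set Omega)) (Y Z : Omega -> R) :=
  [/\ P.-integrable setT (EFin \o Y),
      P.-integrable setT (EFin \o Z),
      forall B, measurable B -> G (Z @^-1` B) &
      forall E, G E ->
        (\int[P]_(w in E) (Y w)%:E = \int[P]_(w in E) (Z w)%:E)%E].

Definition symmetric_fun n (h : n.-tuple A -> R) :=
  forall (s : {perm 'I_n}) (x : n.-tuple A),
    h [tuple tnth x (s i) | i < n] = h x.

(* For n = 1 the sigma-algebra generated by sample 0 is trivial, hence the
   last condition says that h(X_1) is centred. *)
Definition Xi n (h : n.-tuple A -> R) :=
  [/\ symmetric_fun h,
      measurable_fun setT h,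
      ('E_P[fun w => (h (sample n w) ^+ 2)%R] < +oo)%E &
      cond_expectation (preimage_set_system setT (sample n.-1) measurable)
        (h \o sample n) (cst 0)].

End random_sequence.

Section dirichlet_ferguson.
Context d dA (Omega : measurableType d) (A : measurableType dA) (R : realType).
Variables (P : probability Omega R) (D : {RV P >-> pprobability A R}).

Definition dirichlet_ferguson (alpha : {finite_measure set A -> \bar R}) :=
  forall (n : nat) (C : 'I_n -> set A),
    (forall i, measurable (C i)) ->
    trivIset setT C ->
    \bigcup_(i in [set: 'I_n]) C i = setT ->
    forall B : set (n.-tuple (measurableTypeR R)), measurable B ->
      P [set w | B [tuple fine (D w (C i)) | i < n]] =
      dirichlet (fun i => fine (alpha (C i))) B.

Definition empirical_limit (X : nat -> {RV P >-> A}) :=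
  forall C : set A, measurable C ->
    {ae P, forall w,
      (n%:R^-1 * \sum_(i < n) \1_C (X i w)) @[n --> \oo] -->
        (fine (D w C) : R)}.

Definition sigma_D : set (set Omega) :=
  <<s \bigcup_(C in measurable)
        preimage_set_system setT (fun w => D w C) measurable >>.

Definition L2_D (F : Omega -> R) :=
  (forall B, measurable B -> sigma_D (F @^-1` B)) /\ F \in Lfun P 2%:E.

Definition D_integral n (h : n.-tuple A -> R) (w : Omega) : R :=
  \int[tuple_prod (fun _ : 'I_n => D w)]_x h x.

Definition chaos_representation (X : nat -> {RV P >-> A}) (F : Omega -> R)
    (h : forall n, n.-tuple A -> R) :=
  (forall n, (0 < n)%N -> Xi X (h n)) /\
  ('N[P]_2%:E[(fun w => (F w - (fine 'E_P[F] +
     \sum_(1 <= n < N.+1) D_integral (h n) w)%R)%:E)] @[N --> \oo] --> 0)%E.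

End dirichlet_ferguson.

(* Main.v *)
(* The Polya sequence is exchangeable with directing measure [D]: replacing coordinates
   one at a time by limits of empirical means turns [P(G, (X_1, ..., X_n) in B)], for
   [G] in [sigma(D)], into [E(1_G D^n(B))].  Hence, for [h] in [Xi_n], the conditional
   expectation of [int h dD^n] given [X_1, ..., X_n] is that of [h(X_{n+1}, ..., X_{2n})];
   by the predictive rule and the degeneracy of [h] it equals [c_n h(X_1, ..., X_n)] with
   [c_n = n! / prod_(i < n) (alpha(A) + n + i) > 0].  The kernels can therefore be defined
   recursively by [h_n = c_n^-1 E(F - F_{n-1} | X_1, ..., X_n)], where [F_{n-1}] is the
   partial sum up to [n - 1].  Then [F - F_N] is orthogonal to all functions of
   [X_1, ..., X_N] and to [F_N - E(F)]; as events of [sigma(D)] are approximated by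
   events of finite samples, [F - F_N] tends to [0].  Testing a representation against
   events of [X_1, ..., X_n] determines [h_n] from the kernels of lower order. *)
Require Import Defs.
From HB Require Import structures.
From mathcomp Require Import all_boot all_order all_algebra.
From mathcomp Require Import fingroup perm finmap.
From mathcomp Require Import all_classical all_reals all_analysis.
From mathcomp Require Import measurable_realfun.
From mathcomp Require Import ring lra zify.

Set Implicit Arguments.
Unset Strict Implicit.
Unset Printing Implicit Defensive.

Import Order.TTheory GRing.Theory Num.Theory.
Import numFieldNormedType.Exports.
Import HBNNSimple.
Local Open Scope classical_set_scope.
Local Open Scope ring_scope.

(** * Tuple spaces: rectangles as a generating pi-system *)

Section tuples.
Context d (T : measurableType d).

(** The almost sure limit that yields [D] is available only set by set, with an exceptional null set
    depending on the set. Identities are therefore proved on rectangles and extended by pi-systems.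
    Spreadability can be read off the Polya formula; full exchangeability is recovered afterwards
    from the product form of the conditional law. The constant c_n arises one argument at a time:
    given N draws, the next one has law (alpha + Dirac masses at the N draws) / (alpha(A) + N). The
    part alpha and the atoms at the other arguments of h together integrate h to zero, so only atoms
    at draws that the test function uses and h does not yet use survive. Convergence of the series
    uses neither completeness of L^2 nor a martingale limit theorem: with r_N = F - F_N,
    orthogonality gives E(r_N^2) = E(r_N (F - E(F))), so weak convergence against one fixed variable
    is enough, and a uniform bound on the norms reduces it to indicators of events of finite
    samples. *)

Definition subtuple m n (f : 'I_m -> 'I_n) (x : n.-tuple T) : m.-tuple T :=
  [tuple tnth x (f i) | i < m].

Lemma measurable_subtuple m n (f : 'I_m -> 'I_n) :
  measurable_fun setT (subtuple f).
Proof.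
apply/measurable_fun_tnthP => i.
rewrite (_ : _ \o _ = fun x => tnth x (f i)); last first.
  by apply/funext => x /=; rewrite tnth_mktuple.
exact: measurable_tnth.
Qed.

Definition rect n (B : 'I_n -> set T) : set (n.-tuple T) :=
  [set x | forall i, B i (tnth x i)].

Lemma rectE n (B : 'I_n -> set T) :
  rect B = \bigcap_(i in [set: 'I_n]) (fun x => tnth x i) @^-1` B i.
Proof. by apply/seteqP; split => x /= H i; [move=> _|]; exact: H. Qed.

Lemma measurable_rect n (B : 'I_n -> set T) :
  (forall i, measurable (B i)) -> measurable (rect B).
Proof.
move=> mB; rewrite rectE; apply: fin_bigcap_measurable => // i _.
by rewrite -[X in measurable X]setTI; exact: measurable_tnth.
Qed.

Definition rects n : set (set (n.-tuple T)) :=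
  [set S | exists2 B : 'I_n -> set T, (forall i, measurable (B i)) & S = rect B].

Lemma rects_setI n : setI_closed (@rects n).
Proof.
move=> _ _ [B mB ->] [C mC ->]; exists (fun i => B i `&` C i).
  by move=> i; exact: measurableI.
apply/seteqP; split => x /=; first by move=> [HB HC] i; split.
by move=> H; split => i; have [] := H i.
Qed.

Lemma rectT n : rect (fun _ : 'I_n => [set: T]) = setT.
Proof. by apply/seteqP; split. Qed.

Lemma measurable_tupleE n : @measurable _ (n.-tuple T) = <<s @rects n >>.
Proof.
apply/seteqP; split; last first.
  apply: smallest_sub; first exact: sigma_algebra_measurable.
  by move=> _ [B mB ->]; exact: measurable_rect.
apply: smallest_sub; first exact: smallest_sigma_algebra.
(* The generators are indexed by natural numbers below the length; with a positive length they
   convert to ordinals through [inord]. *)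
case: n => [|n]; first by rewrite big_ord0.
rewrite -bigcup_mkord_ord => S [i ltin [B mB <-]].
apply: sub_sigma_algebra.
exists (fun j => if j == inord i then B else setT).
  by move=> j; case: ifP.
rewrite setTI; apply/seteqP; split => x /=.
  by move=> Bx j; case: eqP => // ->.
by move=> /(_ (inord i)); rewrite eqxx.
Qed.

Lemma tuple_measure_unique (R : realType) n
    (m1 m2 : {measure set (n.-tuple T) -> \bar R}) :
  (m1 setT < +oo)%E ->
  (forall B, (forall i, measurable (B i)) -> m1 (rect B) = m2 (rect B)) ->
  forall S, measurable S -> m1 S = m2 S.
Proof.
move=> m1oo m12 S mS.
apply: (measure_unique (@rects n) (fun=> setT)) => //.
- exact: measurable_tupleE.
- exact: rects_setI.
- by move=> _; exists (fun=> setT) => //; rewrite rectT.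
- by rewrite bigcup_const//; exists 0%N.
- by move=> _ [B mB ->]; exact: m12.
Qed.

End tuples.

(** * Nonnegative functionals, kernels and test functions *)

Section monotone_cvg.
Context d (T : measurableType d) (R : realType) (mu : {measure set T -> \bar R}).
Local Open Scope ereal_scope.

Lemma monotone_cvg (D : set T) (f_ : (T -> \bar R)^nat) (f : T -> \bar R) :
  measurable D -> (forall n, measurable_fun D (f_ n)) ->
  (forall n x, D x -> 0 <= f_ n x) ->
  (forall x, D x -> nondecreasing_seq (f_ ^~ x)) ->
  (forall x, D x -> f_ n x @[n --> \oo] --> f x) ->
  \int[mu]_(x in D) f_ n x @[n --> \oo] --> \int[mu]_(x in D) f x.
Proof.
move=> mD mf f0 nd cf.
rewrite (_ : \int[mu]_(x in D) f x = \int[mu]_(x in D) limn (f_ ^~ x)).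
  exact: cvg_monotone_convergence.
by apply: eq_integral => x /set_mem Dx; apply/esym/cvg_lim => //; exact: cf.
Qed.

End monotone_cvg.

Section nonneg_functional.
Context d (T : measurableType d) (R : realType).
Local Open Scope ereal_scope.

(** Isolates what the passage from indicators to nonnegative measurable functions uses, so that the
    passage is made once for weighted integrals and for iterated kernel integrals. *)
Definition ge0_functional (L : (T -> \bar R) -> \bar R) :=
  [/\ forall f g : T -> \bar R, measurable_fun setT f -> measurable_fun setT g ->
        (forall x, 0 <= f x) -> (forall x, 0 <= g x) ->
        L (fun x => f x + g x) = L f + L g,
      forall (r : R) (f : T -> \bar R), (0 <= r)%R -> measurable_fun setT f ->
        (forall x, 0 <= f x) -> L (fun x => r%:E * f x) = r%:E * L f &
      forall (f_ : (T -> \bar R)^nat) (f : T -> \bar R),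
        (forall n, measurable_fun setT (f_ n)) ->
        (forall n x, 0 <= f_ n x) ->
        (forall x, nondecreasing_seq (f_ ^~ x)) ->
        (forall x, f_ n x @[n --> \oo] --> f x) ->
        L (f_ n) @[n --> \oo] --> L f].

(** Simple functions are sums of scaled indicators, and every nonnegative measurable function is an
    increasing limit of simple ones. *)
Lemma ge0_functional_ext (L1 L2 : (T -> \bar R) -> \bar R) :
  ge0_functional L1 -> ge0_functional L2 ->
  (forall B, measurable B -> L1 (fun x => (\1_B x)%:E) = L2 (fun x => (\1_B x)%:E)) ->
  forall f, measurable_fun setT f -> (forall x, 0 <= f x) -> L1 f = L2 f.
Proof.
move=> [A1 Z1 C1] [A2 Z2 C2] H f mf f0.
(* Homogeneity with factor 0 gives the value at the zero function, even if [L] takes infinite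
   values. *)
have L0 L : (forall (r : R) (f : T -> \bar R), (0 <= r)%R -> measurable_fun setT f ->
        (forall x, 0 <= f x) -> L (fun x => r%:E * f x) = r%:E * L f) -> L (fun=> 0) = 0.
  move=> ZL; have := ZL 0%R (fun=> 0) (lexx _) (measurable_cst _) (fun=> lexx _).
  by rewrite (_ : (fun x => _) = fun=> 0) ?mul0e//; apply/funext => x; rewrite mul0e.
have simple (s : {nnsfun T >-> R}) : L1 (EFin \o s) = L2 (EFin \o s).
  have -> : EFin \o s = (fun x => \sum_(r <- fset_set (range s))
      (r * \1_(s @^-1` [set r]) x)%:E).
    apply/funext => x /=; rewrite [in LHS]fimfunE fsbig_finite//=.
    by rewrite sumEFin.
  have rge0 r : r \in (fset_set (range s) : seq R) -> (0 <= r)%R.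
    move=> rs; have := rs; rewrite -[_ \in _]/(r \in fset_set (range s)).
    by rewrite in_fset_set// => /set_mem[x _ <-].
  elim: (fset_set _ : seq R) rge0 => [|r rs IH] rge0.
    by under eq_fun do rewrite big_nil; rewrite !L0.
  under eq_fun do rewrite big_cons.
  have mr : measurable (s @^-1` [set r]) by [].
  have r0 : (0 <= r)%R by apply: rge0; rewrite mem_head.
  have IH' := IH (fun q Hq => rge0 q (@mem_behead _ (r :: rs) q Hq)).
  have m1 : measurable_fun setT (fun x => (r * \1_(s @^-1` [set r]) x)%:E).
    by apply/measurable_EFinP; apply: measurable_funM.
  have m2 : measurable_fun setT (fun x => \sum_(r <- rs) (r * \1_(s @^-1` [set r]) x)%:E).
    apply: emeasurable_sum => r'; apply/measurable_EFinP; exact: measurable_funM.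
  have p1 x : 0 <= (r * \1_(s @^-1` [set r]) x)%:E by rewrite lee_fin mulr_ge0.
  have p2 x : 0 <= \sum_(r <- rs) (r * \1_(s @^-1` [set r]) x)%:E.
    rewrite big_seq; apply: sume_ge0 => r' r'rs; rewrite lee_fin mulr_ge0//.
    by apply: rge0; rewrite inE r'rs orbT.
  rewrite A1// A2// IH'; congr (_ + _).
  under eq_fun do rewrite EFinM.
  rewrite Z1// ?Z2// ?H//; exact/measurable_EFinP.
have cf := cvg_nnsfun_approx measurableT mf (fun x _ => f0 x).
pose f_ n := EFin \o nnsfun_approx measurableT mf n.
have nd x : nondecreasing_seq (f_ ^~ x).
  by move=> m n mn; rewrite lee_fin; exact/lefP/nd_nnsfun_approx.
have m_ n : measurable_fun setT (f_ n) by exact/measurable_EFinP.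
have p_ n x : 0 <= f_ n x by rewrite lee_fin.
have c1 := C1 f_ f m_ p_ nd (fun x => cf x I).
have c2 := C2 f_ f m_ p_ nd (fun x => cf x I).
have E : (fun n => L1 (f_ n)) = (fun n => L2 (f_ n)).
  by apply/funext => n; exact: simple.
by rewrite E in c1; exact: cvg_unique c1 c2.
Qed.

End nonneg_functional.

Section probability_kernel.
Context d1 d2 (U : measurableType d1) (T : measurableType d2) (R : realType).
Variable k : U -> probability T R.
Local Open Scope ereal_scope.

Lemma measurable_kernel_gen (G : set (set T)) :
  @measurable _ T = <<s G >> -> setI_closed G ->
  (forall B, G B -> measurable_fun setT (fun u => k u B)) ->
  forall B, measurable B -> measurable_fun setT (fun u => k u B).
Proof.
move=> mG GI mk B mB.
apply: (@dynkin_induction _ T G (fun B => measurable_fun setT (fun u => k u B)) mG GI) => //.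
- by under eq_fun do rewrite probability_setT; exact: measurable_cst.
- move=> S mS IH; under eq_fun do rewrite probability_setC//.
  by apply: emeasurable_funB => //; exact: measurable_cst.
- move=> F mF tF IH.
  under eq_fun do rewrite measure_bigcup//=.
  apply: ge0_emeasurable_sum => // n _; exact: IH.
- by rewrite -mG.
Qed.

Hypothesis mk : forall B, measurable B -> measurable_fun setT (fun u => k u B).

Lemma measurable_ge0_kernel_integral (f : T -> \bar R) : measurable_fun setT f ->
  (forall x, 0 <= f x) -> measurable_fun setT (fun u => \int[k u]_x f x).
Proof. by move=> mf f0; exact: (measurable_fun_integral_kernel mk). Qed.

Lemma measurable_kernel_Rintegral (f : T -> R) : measurable_fun setT f ->
  measurable_fun setT (fun u => (\int[k u]_x f x)%R).
Proof.
move=> mf; rewrite /Rintegral.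
apply: (measurableT_comp (f := fine)) => //.
under eq_fun do rewrite integralE.
apply: emeasurable_funB; apply: measurable_ge0_kernel_integral => //.
  by apply: measurable_funepos; exact/measurable_EFinP.
by apply: measurable_funeneg; exact/measurable_EFinP.
Qed.

Section weighted_functional.
Context d3 (O : measurableType d3) (mu : {measure set O -> \bar R}).

Lemma ge0_functional_weight (D : set O) (Z : O -> R) (W : O -> T) :
  measurable D -> measurable_fun setT Z -> (forall w, 0 <= Z w)%R ->
  measurable_fun setT W ->
  ge0_functional (fun f : T -> \bar R => \int[mu]_(w in D) ((Z w)%:E * f (W w))).
Proof.
move=> mD mZ Z0 mW.
have mZf f : measurable_fun setT f -> measurable_fun D (fun w => (Z w)%:E * f (W w)).
  move=> mf; apply: measurable_funTS; apply: emeasurable_funM; first exact/measurable_EFinP.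
  exact: measurableT_comp.
split.
- move=> f g mf mg f0 g0.
  under eq_integral do rewrite ge0_muleDr//.
  apply: ge0_integralD => //; [|exact: mZf| |exact: mZf];
    by move=> w _; rewrite mule_ge0 ?lee_fin.
- move=> r f r0 mf f0.
  under eq_integral do rewrite muleCA.
  apply: ge0_integralZl => //; first exact: mZf.
  by move=> w _; rewrite mule_ge0 ?lee_fin.
- move=> f_ f mf f0 ndf cf.
  apply: monotone_cvg => //.
  + by move=> n; exact: mZf.
  + by move=> n w _; rewrite mule_ge0 ?lee_fin.
  + by move=> w _ m n mn; apply: lee_wpmul2l; rewrite ?lee_fin//; exact: ndf.
  + by move=> w _; apply: cvgeZl => //.
Qed.

Lemma ge0_functional_kernel (D : set O) (V : O -> U) :
  measurable D -> measurable_fun setT V ->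
  ge0_functional (fun f : T -> \bar R => \int[mu]_(w in D) \int[k (V w)]_x f x).
Proof.
move=> mD mV.
have mi f : measurable_fun setT f -> (forall x, 0 <= f x) ->
    measurable_fun D (fun w => \int[k (V w)]_x f x).
  move=> mf f0; apply: measurable_funTS.
  by apply: (measurableT_comp (measurable_ge0_kernel_integral mf f0)).
split.
- move=> f g mf mg f0 g0.
  under eq_integral do rewrite ge0_integralD//.
  apply: ge0_integralD => //; [|exact: mi| |exact: mi];
    by move=> w _; apply: integral_ge0.
- move=> r f r0 mf f0.
  under eq_integral do rewrite ge0_integralZl//.
  apply: ge0_integralZl => //; first exact: mi.
  by move=> w _; apply: integral_ge0.
- move=> f_ f mf f0 ndf cf.
  have f_0 x : 0 <= f x.
    rewrite -(cvg_lim _ (cf x))//; apply: lime_ge; last exact: nearW.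
    by apply/cvg_ex; exists (f x); exact: cf.
  apply: monotone_cvg => //.
  + by move=> n; exact: mi.
  + by move=> n w _; apply: integral_ge0.
  + by move=> w _ m n mn; apply: ge0_le_integral => // x _; exact: ndf.
  + move=> w _; apply: monotone_cvg => //.
Qed.

End weighted_functional.
End probability_kernel.

Section Rintegrable.
Context d (O : measurableType d) (R : realType) (P : {measure set O -> \bar R}).
Implicit Types (f g : O -> R) (D : set O).

Definition Rintegrable f := P.-integrable setT (EFin \o f).

Lemma Rintegrable_measurable f : Rintegrable f -> measurable_fun setT f.
Proof. by move=> /integrableP[/measurable_EFinP]. Qed.

Lemma RintegrableD f g : Rintegrable f -> Rintegrable g ->
  Rintegrable (fun w => f w + g w).
Proof. by move=> If Ig; exact: (integrableD measurableT If Ig). Qed.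

Lemma RintegrableB f g : Rintegrable f -> Rintegrable g ->
  Rintegrable (fun w => f w - g w).
Proof. by move=> If Ig; exact: (integrableB measurableT If Ig). Qed.

Lemma RintegrableZ r f : Rintegrable f -> Rintegrable (fun w => r * f w).
Proof. by move=> If; exact: (integrableZl measurableT r If). Qed.

Lemma le_Rintegrable f g : measurable_fun setT f ->
  (forall w, `|f w| <= `|g w|) -> Rintegrable g -> Rintegrable f.
Proof.
move=> mf fg; apply: le_integrable => //; first exact/measurable_EFinP.
by move=> w _; rewrite lee_fin.
Qed.

Lemma Rintegrable_sum I (s : seq I) (p : pred I) (F : I -> O -> R) :
  (forall i, p i -> Rintegrable (F i)) ->
  Rintegrable (fun w => \sum_(i <- s | p i) F i w).
Proof.
move=> IF; apply: eq_integrable (integrable_sum measurableT _ IF) => //.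
by move=> w _ /=; rewrite sumEFin.
Qed.

Lemma RintegrableMb M f g : measurable_fun setT g -> (forall w, `|g w| <= M) ->
  Rintegrable f -> Rintegrable (fun w => g w * f w).
Proof.
move=> mg gM If; have mf := Rintegrable_measurable If.
apply: (@le_Rintegrable _ (fun w => M * f w)); last exact: RintegrableZ.
  exact: measurable_funM.
by move=> w; rewrite !normrM ler_wpM2r// (le_trans (gM w))// ler_norm.
Qed.

Lemma Rintegrable_indic D f : measurable D -> Rintegrable f ->
  Rintegrable (fun w => \1_D w * f w).
Proof.
move=> mD; apply: (@RintegrableMb 1) => // w.
by rewrite indicE; case: (_ \in _); rewrite ?normr1 ?normr0.
Qed.

Lemma Rintegral_indic D f : measurable D ->
  \int[P]_w (\1_D w * f w) = \int[P]_(w in D) f w.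
Proof.
move=> mD; rewrite [RHS]Rintegral_mkcond; apply: eq_Rintegral => w _.
by rewrite patchE indicE; case: (_ \in _); rewrite ?mul1r ?mul0r.
Qed.

Lemma Rintegral_sum I (s : seq I) (p : pred I) (F : I -> O -> R) :
  (forall i, p i -> Rintegrable (F i)) ->
  \int[P]_w (\sum_(i <- s | p i) F i w) = \sum_(i <- s | p i) \int[P]_w F i w.
Proof.
move=> IF; elim: s => [|i s IH].
  by under eq_Rintegral do rewrite big_nil; rewrite big_nil Rintegral_cst// mul0r.
under eq_Rintegral do rewrite big_cons; rewrite big_cons; case: ifPn => pi//.
by rewrite RintegralD// ?IH//; [exact: IF|exact: Rintegrable_sum].
Qed.

Lemma Rintegrable_on D f : measurable D -> Rintegrable f -> P.-integrable D (EFin \o f).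
Proof. by move=> mD; exact: integrableS. Qed.

Lemma EFin_Rintegral D f : measurable D -> Rintegrable f ->
  (\int[P]_(w in D) (f w)%:E)%E = (\int[P]_(w in D) f w)%:E.
Proof.
move=> mD If; rewrite /Rintegral fineK//; apply: integrable_fin_num => //.
exact: Rintegrable_on.
Qed.

Lemma RintegrableE f : measurable_fun setT f ->
  Rintegrable f <-> (\int[P]_w `|f w|%:E < +oo)%E.
Proof.
move=> mf; split => [/integrableP[]//|Hf].
by apply/integrableP; split => //; exact/measurable_EFinP.
Qed.

End Rintegrable.

Lemma funrposnegE (T : Type) (R : realType) (f : T -> R) x : f x = f^\+ x - f^\- x.
Proof. by rewrite -[in LHS](funrposBneg f). Qed.

Section testing.
Context d1 d2 (O : measurableType d1) (T : measurableType d2) (R : realType).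
Variables (P : {measure set O -> \bar R}) (W : O -> T).
Hypothesis mW : measurable_fun setT W.

Let mpre B : measurable B -> measurable (W @^-1` B).
Proof. by move=> mB; rewrite -[X in measurable X]setTI; exact: mW. Qed.

Lemma ge0_integral_test (Z Z' : O -> R) :
  measurable_fun setT Z -> measurable_fun setT Z' ->
  (forall w, 0 <= Z w) -> (forall w, 0 <= Z' w) ->
  (forall B, measurable B ->
    \int[P]_(w in W @^-1` B) (Z w)%:E = \int[P]_(w in W @^-1` B) (Z' w)%:E)%E ->
  forall f : T -> \bar R, measurable_fun setT f -> (forall x, 0 <= f x)%E ->
  (\int[P]_w ((Z w)%:E * f (W w)) = \int[P]_w ((Z' w)%:E * f (W w)))%E.
Proof.
move=> mZ mZ' Z0 Z'0 H f mf f0.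
apply: (@ge0_functional_ext _ _ _ (fun f => \int[P]_w ((Z w)%:E * f (W w)))%E
  (fun f => \int[P]_w ((Z' w)%:E * f (W w)))%E) => //; last first.
- move=> B mB; have E (Y : O -> R) : (\int[P]_w ((Y w)%:E * (\1_B (W w))%:E) =
      \int[P]_(w in W @^-1` B) (Y w)%:E)%E.
    rewrite [RHS]integral_mkcond; apply: eq_integral => w _.
    by rewrite patchE indicE -[W w \in B]/(w \in W @^-1` B); case: (_ \in _); rewrite ?mule1 ?mule0.
  by rewrite !E H.
- exact: ge0_functional_weight.
- exact: ge0_functional_weight.
Qed.

(** Only the product [N * f (W)] has to be integrable besides [N]: each of the four products of
    positive and negative parts is dominated by it, and each nonnegative part of [f] is tested
    separately against the two parts of [N]. *)
Lemma Rintegral_test0 (N : O -> R) (f : T -> R) :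
  Rintegrable P N -> measurable_fun setT f -> Rintegrable P (fun w => N w * f (W w)) ->
  (forall B, measurable B -> \int[P]_(w in W @^-1` B) N w = 0) ->
  \int[P]_w (N w * f (W w)) = 0.
Proof.
move=> IN mf INf H.
have mN := Rintegrable_measurable IN.
have mNp : measurable_fun setT N^\+ by exact: measurable_funrpos.
have mNn : measurable_fun setT N^\- by exact: measurable_funrneg.
have INp : Rintegrable P N^\+ by exact: integrable_funrpos.
have INn : Rintegrable P N^\- by exact: integrable_funrneg.
have HB B : measurable B -> (\int[P]_(w in W @^-1` B) (N^\+ w)%:E =
    \int[P]_(w in W @^-1` B) (N^\- w)%:E)%E.
  move=> mB; rewrite !EFin_Rintegral//; try exact: mpre.
  congr EFin; apply/eqP; rewrite -subr_eq0 -RintegralB//; try exact: mpre.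
  - rewrite -(H B mB); apply/eqP; apply: eq_Rintegral => w _.
    by rewrite [in RHS](funrposnegE N).
  - by apply: Rintegrable_on => //; exact: mpre.
  - by apply: Rintegrable_on => //; exact: mpre.
have key (g : T -> R) : measurable_fun setT g -> (forall x, 0 <= g x) ->
    \int[P]_w (N^\+ w * g (W w)) = \int[P]_w (N^\- w * g (W w)).
  move=> mg g0; rewrite /Rintegral.
  have := ge0_integral_test mNp mNn (fun w => funrpos_ge0 N w) (fun w => funrneg_ge0 N w)
    HB (f := EFin \o g).
  move=> -> //; first exact/measurable_EFinP.
have le1 (a : O -> R) (c : T -> R) : measurable_fun setT a -> measurable_fun setT c ->
   (forall w, `|a w| <= `|N w|) -> (forall x, `|c x| <= `|f x|) ->
   Rintegrable P (fun w => a w * c (W w)).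
  move=> ma mc aN cf; apply: le_Rintegrable INf.
    by apply: measurable_funM => //; exact: measurableT_comp.
  by move=> w; rewrite !normrM ler_pM.
have posle (U : Type) (a : U -> R) x : `|a^\+ x| <= `|a x|.
  rewrite ger0_norm ?funrpos_ge0// /funrpos ge_max ler_norm normr_ge0//.
have negle (U : Type) (a : U -> R) x : `|a^\- x| <= `|a x|.
  rewrite ger0_norm ?funrneg_ge0// /funrneg ge_max normr_ge0 -normrN ler_norm//.
have mfp : measurable_fun setT f^\+ by exact: measurable_funrpos.
have mfn : measurable_fun setT f^\- by exact: measurable_funrneg.
have -> : \int[P]_w (N w * f (W w)) =
  \int[P]_w ((N^\+ w * f^\+ (W w) + N^\- w * f^\- (W w)) -
    (N^\- w * f^\+ (W w) + N^\+ w * f^\- (W w))).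
  apply: eq_Rintegral => w _.
  rewrite [in LHS](funrposnegE N) [in LHS](funrposnegE f).
  by ring.
rewrite RintegralB//; try by apply: RintegrableD; apply: le1.
rewrite !RintegralD//; try by apply: le1.
rewrite (key f^\+)// (key f^\-)//.
by rewrite subrr.
Qed.

Lemma Rintegral_test (Z Z' : O -> R) (f : T -> R) :
  Rintegrable P Z -> Rintegrable P Z' -> measurable_fun setT f ->
  Rintegrable P (fun w => Z w * f (W w)) -> Rintegrable P (fun w => Z' w * f (W w)) ->
  (forall B, measurable B ->
    \int[P]_(w in W @^-1` B) Z w = \int[P]_(w in W @^-1` B) Z' w) ->
  \int[P]_w (Z w * f (W w)) = \int[P]_w (Z' w * f (W w)).
Proof.
move=> IZ IZ' mf IZf IZ'f H; apply/eqP; rewrite -subr_eq0 -RintegralB//.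
have E w : Z w * f (W w) - Z' w * f (W w) = (Z w - Z' w) * f (W w) by rewrite mulrBl.
under eq_Rintegral do rewrite E.
rewrite (@Rintegral_test0 (fun w => Z w - Z' w))//; first exact: RintegrableB.
- by under [X in Rintegrable _ X]eq_fun do rewrite -E; exact: RintegrableB.
- move=> B mB; rewrite RintegralB ?H ?subrr//; try exact: mpre;
    by apply: Rintegrable_on => //; exact: mpre.
Qed.

End testing.

(** Valid without finiteness because [fine] sends infinite values to 0. It bounds an [Rintegral] by
    the integrals of the two parts even at points where these are infinite. *)
Lemma abse_fine_subr (R : realType) (x y : \bar R) : (0 <= x -> 0 <= y ->
  `|(fine (x - y))%:E| <= x + y)%E.
Proof.
case: x y => [r| |] [s| |] //=; rewrite ?lee_fin ?normr0 ?leey// => r0 s0.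
by rewrite (le_trans (ler_normB _ _))// !ger0_norm.
Qed.

Lemma measure_bigcupT d (T : measurableType d) (R : realType)
    (mu : {measure set T -> \bar R}) (F : (set T)^nat) :
  (forall n, measurable (F n)) -> trivIset setT F ->
  mu (\bigcup_n F n) = (\sum_(0 <= n <oo) mu (F n))%E.
Proof.
by move=> mF tF; rewrite measure_bigcup//; apply: eq_eseriesl => n; rewrite in_setT.
Qed.

(** * Conditional laws given by a kernel *)

Section disintegration.
Context d1 d2 d3 d4 (O : measurableType d1) (T1 : measurableType d2)
  (T : measurableType d3) (U : measurableType d4) (R : realType).
Variables (P : probability O R) (W : O -> T1) (V : O -> U) (Y : O -> T).
Variable k : U -> probability T R.
Hypotheses (mW : measurable_fun setT W) (mV : measurable_fun setT V)
  (mY : measurable_fun setT Y).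
Hypothesis mk : forall B, measurable B -> measurable_fun setT (fun u => k u B).

Let mpre d' d'' (O' : measurableType d') (T' : measurableType d'') (F : O' -> T') B :
  measurable_fun setT F -> measurable B -> measurable (F @^-1` B).
Proof. by move=> mF mB; rewrite -[X in measurable X]setTI; exact: mF. Qed.

Local Open Scope ereal_scope.

(** [W] supplies the conditioning events, [V] the parameter of the kernel and [Y] the variable. [V]
    need not be a function of [W]: below, [V] carries sigma(D) while [W] is either the same map or
    the first draws. *)
Lemma disintegration_gen (G : set (set T)) :
  @measurable _ T = <<s G >> -> setI_closed G ->
  forall S, measurable S ->
  (forall B, G B -> P (W @^-1` S `&` Y @^-1` B) = \int[P]_(w in W @^-1` S) k (V w) B) ->
  forall B, measurable B ->
    P (W @^-1` S `&` Y @^-1` B) = \int[P]_(w in W @^-1` S) k (V w) B.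
Proof.
move=> mG GI S mS GH B mB.
have mWS := mpre mW mS.
have mkV C : measurable C -> measurable_fun (W @^-1` S) (fun w => k (V w) C).
  by move=> mC; apply: measurable_funTS; apply: (measurableT_comp (mk mC)).
apply: (@dynkin_induction _ T G (fun B =>
  P (W @^-1` S `&` Y @^-1` B) = \int[P]_(w in W @^-1` S) k (V w) B) mG GI) => //.
- rewrite preimage_setT setIT.
  by under eq_integral do rewrite probability_setT; rewrite integral_cst// mul1e.
- move=> C mC IH; under eq_integral do rewrite probability_setC//.
  rewrite preimage_setC -setDE measureD//; [|exact: mpre|]; last first.
    by rewrite ltey_eq fin_num_measure.
  rewrite [X in _ - P (_ `&` X)](_ : _ = Y @^-1` C)// IH integralB//;
    first by rewrite integral_cst// mul1e.
    exact: finite_measure_integrable_cst.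
  apply: (@le_integrable _ _ _ _ _ _ _ (EFin \o cst 1%R)) => //; first exact: mkV.
    by move=> w _ /=; rewrite gee0_abs// normr1 probability_le1.
  exact: finite_measure_integrable_cst.
- move=> F mF tF IH.
  under eq_integral do rewrite measure_bigcupT//.
  rewrite integral_nneseries//; last by move=> n; exact: mkV.
  rewrite preimage_bigcup setI_bigcupr measure_bigcupT//=.
  + by apply: eq_eseriesr => n _; exact: IH.
  + by move=> n; apply: measurableI => //; exact: mpre.
  + by move=> i j _ _ [x [[_ Fi] [_ Fj]]]; apply: tF => //; exists (Y x).
- by rewrite -mG.
Qed.

Hypothesis H : forall S, measurable S -> forall B, measurable B ->
  P (W @^-1` S `&` Y @^-1` B) = \int[P]_(w in W @^-1` S) k (V w) B.

Lemma ge0_disintegration S (h : T -> \bar R) : measurable S ->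
  measurable_fun setT h -> (forall x, 0 <= h x) ->
  \int[P]_(w in W @^-1` S) h (Y w) = \int[P]_(w in W @^-1` S) \int[k (V w)]_x h x.
Proof.
move=> mS mh h0; have mWS := mpre mW mS.
have [A1 Z1 C1] := ge0_functional_weight (T := T) (Z := fun=> 1%R) P mWS (measurable_cst _)
  (fun w => ler01) mY.
apply: (@ge0_functional_ext _ _ _ (fun h => \int[P]_(w in W @^-1` S) h (Y w))
  (fun h => \int[P]_(w in W @^-1` S) \int[k (V w)]_x h x)) => //.
- have E : (fun h => \int[P]_(w in W @^-1` S) h (Y w)) =
     (fun h : T -> \bar R => \int[P]_(w in W @^-1` S) (1%:E * h (Y w))).
    by apply/funext => f; apply: eq_integral => w _; rewrite mul1e.
  by rewrite E; split.
- exact: ge0_functional_kernel.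
- move=> B mB; under [RHS]eq_integral do rewrite integral_indic// setIT.
  rewrite -H//.
  rewrite (_ : (fun _ => _) = EFin \o \1_(Y @^-1` B))//.
  by rewrite integral_indic//; [rewrite setIC|exact: mpre].
Qed.

Let mI (h : T -> R) : measurable_fun setT h ->
  measurable_fun setT (fun w => (\int[k (V w)]_x h x)%R).
Proof.
move=> mh; exact: (measurableT_comp (measurable_kernel_Rintegral mk mh)).
Qed.

(** The positive and negative parts of [h] have integrable kernel integrals, so the points where the
    real-valued kernel integral falls back on its default value form a null set. *)
Lemma Rintegral_disintegration (h : T -> R) : measurable_fun setT h ->
  Rintegrable P (fun w => h (Y w)) ->
  Rintegrable P (fun w => (\int[k (V w)]_x h x)%R) /\
  forall S, measurable S ->
    (\int[P]_(w in W @^-1` S) h (Y w) =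
     \int[P]_(w in W @^-1` S) \int[k (V w)]_x h x)%R.
Proof.
move=> mh Ih.
pose hp := fun x => (h^\+ x)%:E; pose hn := fun x => (h^\- x)%:E.
pose a w := \int[k (V w)]_x hp x; pose b w := \int[k (V w)]_x hn x.
have mhp : measurable_fun setT hp by apply/measurable_EFinP; exact: measurable_funrpos.
have mhn : measurable_fun setT hn by apply/measurable_EFinP; exact: measurable_funrneg.
have hp0 x : 0 <= hp x by rewrite lee_fin funrpos_ge0.
have hn0 x : 0 <= hn x by rewrite lee_fin funrneg_ge0.
have a0 w : 0 <= a w by apply: integral_ge0.
have b0 w : 0 <= b w by apply: integral_ge0.
have ma : measurable_fun setT a.
  exact: (measurableT_comp (measurable_ge0_kernel_integral mk mhp hp0)).
have mb : measurable_fun setT b.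
  exact: (measurableT_comp (measurable_ge0_kernel_integral mk mhn hn0)).
have IhYp : Rintegrable P (fun w => (h^\+ (Y w))%R).
  exact: (integrable_funrpos measurableT Ih).
have IhYn : Rintegrable P (fun w => (h^\- (Y w))%R).
  exact: (integrable_funrneg measurableT Ih).
have Ea S : measurable S -> \int[P]_(w in W @^-1` S) a w =
    \int[P]_(w in W @^-1` S) (h^\+ (Y w))%:E.
  by move=> mS; rewrite -(ge0_disintegration mS mhp hp0).
have Eb S : measurable S -> \int[P]_(w in W @^-1` S) b w =
    \int[P]_(w in W @^-1` S) (h^\- (Y w))%:E.
  by move=> mS; rewrite -(ge0_disintegration mS mhn hn0).
have Ia : P.-integrable setT a.
  apply/integrableP; split => //; under eq_integral do rewrite gee0_abs//.
  by have := Ea _ measurableT; rewrite preimage_setT => ->; exact: integrable_lty.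
have Ib : P.-integrable setT b.
  apply/integrableP; split => //; under eq_integral do rewrite gee0_abs//.
  by have := Eb _ measurableT; rewrite preimage_setT => ->; exact: integrable_lty.
have IE w : (\int[k (V w)]_x h x)%R = fine (a w - b w).
  rewrite /Rintegral integralE /a /b; congr (fine (_ - _)).
    by apply: eq_integral => x _; rewrite -/(EFin \o h) funerpos.
  by apply: eq_integral => x _; rewrite -/(EFin \o h) funerneg.
have II : Rintegrable P (fun w => (\int[k (V w)]_x h x)%R).
  have Iab := integrableD measurableT Ia Ib.
  apply: le_integrable Iab => //; first by apply/measurable_EFinP; exact: mI.
  move=> w _ /=; rewrite IE.
  rewrite [leRHS]gee0_abs; last by rewrite adde_ge0; [|exact: a0|exact: b0].
  exact: (abse_fine_subr (a0 w) (b0 w)).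
split; [exact: II|move=> S mS]; have mWS := mpre mW mS.
apply: EFin_inj; rewrite -!EFin_Rintegral//.
have -> : \int[P]_(w in W @^-1` S) (h (Y w))%:E =
    \int[P]_(w in W @^-1` S) (a w - b w).
  rewrite integralB//; try by apply: (integrableS measurableT).
  rewrite Ea// Eb// -integralB//; try by apply: (integrableS measurableT).
  by apply: eq_integral => w _; rewrite [in LHS](funrposnegE h).
apply: ae_eq_integral => //.
- by apply: measurable_funTS; apply: emeasurable_funB.
- by apply: measurable_funTS; apply/measurable_EFinP; exact: mI.
- have fa := integrable_ae measurableT Ia.
  have fb := integrable_ae measurableT Ib.
  apply: filterS2 fa fb => w fa fb _; rewrite IE fineK// fin_numB.
  by rewrite fa// fb.
Qed.

(** Conditional Jensen inequality, proved pointwise: either the kernel integral of [h ^+ 2] is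
    infinite, or [h] is integrable since |h| <= h^2 + 1, and its variance under the kernel is
    nonnegative. No integrability of [h (Y w)] is needed. *)
Lemma sqr_Rintegral_disintegration (h : T -> R) : measurable_fun setT h ->
  \int[P]_w ((\int[k (V w)]_x h x) ^+ 2)%R%:E <= \int[P]_w ((h (Y w)) ^+ 2)%:E.
Proof.
move=> mh.
have mh2 : measurable_fun setT (fun x => (h x ^+ 2)%:E).
  by apply/measurable_EFinP; exact: measurable_funX.
have := @ge0_disintegration setT (fun x => (h x ^+ 2)%:E) measurableT mh2
  (fun x => sqr_ge0 (h x)).
rewrite preimage_setT => ->.
apply: ge0_le_integral => //.
- by move=> w _; rewrite lee_fin sqr_ge0.
- by apply/measurable_EFinP; apply: measurable_funX; exact: mI.
- apply: (measurableT_comp (measurable_ge0_kernel_integral mk mh2 _)) => //.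
  by move=> x; rewrite lee_fin sqr_ge0.
move=> w _; set Q := k (V w).
have [->|finh2] := eqVneq (\int[Q]_x (h x ^+ 2)%:E) +oo; first by rewrite leey.
have Ih2 : Rintegrable Q (fun x => (h x ^+ 2)%R).
  apply/RintegrableE; first exact: measurable_funX.
  under eq_integral do rewrite ger0_norm ?sqr_ge0//.
  by rewrite ltey.
have Ih : Rintegrable Q h.
  apply: (@le_Rintegrable _ _ _ _ _ (fun x => (h x ^+ 2 + 1)%R)) => //.
    move=> x; rewrite [X in (_ <= X)%R]ger0_norm; last by rewrite addr_ge0 ?sqr_ge0.
    rewrite -[X in (_ <= X + _)%R]real_normK ?num_real//; nra.
  by apply: RintegrableD => //; exact: finite_measure_integrable_cst.
set c := (\int[Q]_x h x)%R.
have : (0 <= \int[Q]_x ((h x ^+ 2 - 2 * c * h x) + c ^+ 2))%R.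
  apply: Rintegral_ge0 => x _; have := sqr_ge0 (h x - c)%R; rewrite sqrrB; lra.
have Ic : Rintegrable Q (fun=> (c ^+ 2)%R) by exact: finite_measure_integrable_cst.
rewrite RintegralD//; last first.
  by apply: RintegrableB => //; exact: RintegrableZ.
rewrite RintegralB//; last exact: RintegrableZ.
rewrite RintegralZl// -/c Rintegral_cst//.
have Q1 : fine (Q setT) = 1%R by rewrite probability_setT.
rewrite -[fine _]/(fine (Q setT)) Q1 mulr1 => Hc.
rewrite (EFin_Rintegral measurableT Ih2) lee_fin; nra.
Qed.

End disintegration.

Lemma measurable_rcons d (T : measurableType d) n :
  measurable_fun setT (fun p : n.-tuple T * T => [tuple of rcons p.1 p.2]).
Proof.
apply/measurable_fun_tnthP => i.
have [ltin|] := ltnP i n.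
  rewrite (_ : _ \o _ = (fun x : n.-tuple T => tnth x (Ordinal ltin)) \o fst).
    by apply: measurableT_comp => //; exact: measurable_tnth.
  apply/funext => -[x y] /=; rewrite !(tnth_nth y) /= nth_rcons size_tuple ltin//.
move=> lein; rewrite (_ : _ \o _ = snd)//; apply/funext => -[x y] /=.
rewrite (tnth_nth y) /= nth_rcons size_tuple ltnNge lein/=.
by rewrite eqn_leq lein -ltnS ltn_ord.
Qed.

(** * Iterated Polya kernels and the effect of one more draw *)

Section polya_rect.
Context d (A : measurableType d) (R : realType).
Variable alpha : {finite_measure set A -> \bar R}.
Hypothesis alpha_gt0 : (0 < alpha setT)%E.
Local Open Scope ereal_scope.
Local Notation a := (fine (alpha setT)).
Local Notation polya_rect := (polya_rect alpha).

Lemma fine_alpha_gt0 : (0 < a)%R.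
Proof. by rewrite fine_gt0// alpha_gt0 ltey_eq fin_num_measure. Qed.

Lemma polya_den_gt0 k : (0 < a + k%:R)%R.
Proof. by rewrite ltr_wpDr// fine_alpha_gt0. Qed.

Lemma polya_kernel_integral (s : seq A) (B : set A) (f : A -> \bar R) :
  measurable B -> measurable_fun setT f -> (forall x, 0 <= f x) ->
  \int[polya_kernel alpha s]_(x in B) f x =
  ((a + (size s)%:R)^-1)%:E *
    (\int[alpha]_(x in B) f x + \sum_(x <- s) ((\1_B x)%:E * f x)).
Proof.
move=> mB mf f0.
have mfB : measurable_fun B f by exact: measurable_funTS.
rewrite /polya_kernel ge0_integral_mscale//=; congr (_ * _).
elim: s => [|x s IH] /=; first by rewrite big_nil adde0.
rewrite ge0_integral_measure_add// IH big_cons integral_dirac// diracE indicE.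
rewrite addeCA; congr (_ + _); rewrite addeC//.
Qed.

Lemma polya_rect_ge0 (s : seq A) Bs : 0 <= polya_rect s Bs.
Proof.
elim: Bs s => [s|B Bs IH s] /=; first by rewrite lee01.
by apply: integral_ge0 => x _; exact: IH.
Qed.

Lemma measurable_polya_rect n Bs : (forall B, List.In B Bs -> measurable B) ->
  measurable_fun setT (fun x : n.-tuple A => polya_rect x Bs).
Proof.
elim: Bs n => [n _|B Bs IH n mBs] /=; first exact: measurable_cst.
have mB : measurable B by apply: mBs; left.
have mBs' C : List.In C Bs -> measurable C by move=> ?; apply: mBs; right.
pose g (p : n.-tuple A * A) := polya_rect (rcons p.1 p.2) Bs.
have mg : measurable_fun setT g.
  exact: (measurableT_comp (IH n.+1 mBs') (@measurable_rcons _ A n)).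
have g0 p : 0 <= g p by exact: polya_rect_ge0.
rewrite (_ : (fun _ => _) = fun x : n.-tuple A => ((a + n%:R)^-1)%:E *
    (\int[alpha]_(y in B) g (x, y) + \sum_(i < n) ((\1_B (tnth x i))%:E * g (x, tnth x i)))).
  apply: measurable_funeM; apply: emeasurable_funD.
    rewrite (_ : (fun x => _) = fun x => \int[alpha]_y ((\1_B y)%:E * g (x, y))).
      apply: (@measurable_fun_fubini_tonelli_F _ _ _ _ R alpha (fun p => (\1_B p.2)%:E * g p)).
        apply: emeasurable_funM => //; apply/measurable_EFinP.
        exact: measurableT_comp.
      by move=> p; rewrite mule_ge0// lee_fin.
    apply/funext => x; rewrite [LHS]integral_mkcond; apply: eq_integral => y _.
    by rewrite patchE indicE; case: (_ \in _); rewrite ?mul1e ?mul0e.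
  apply: emeasurable_sum => i; apply: emeasurable_funM.
    apply/measurable_EFinP; apply: measurableT_comp => //; exact: measurable_tnth.
  apply: (measurableT_comp mg); apply: measurable_fun_pair => //; exact: measurable_tnth.
apply/funext => x; rewrite polya_kernel_integral//; last first.
- by move=> y; exact: polya_rect_ge0.
- rewrite -[X in measurable_fun _ X]/(g \o pair x).
  by apply: (measurableT_comp mg); exact: measurable_pair1.
by rewrite size_tuple big_tuple.
Qed.

Lemma measurable_polya_rect_rcons (s : seq A) Bs :
  (forall B, List.In B Bs -> measurable B) ->
  measurable_fun setT (fun y => polya_rect (rcons s y) Bs).
Proof.
move=> mBs; rewrite (_ : (fun _ => _) =
    (fun x : (size s).+1.-tuple A => polya_rect x Bs) \o
    (fun p : (size s).-tuple A * A => [tuple of rcons p.1 p.2]) \o (fun y => (in_tuple s, y)))//.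
apply: measurableT_comp; last exact: measurable_pair1.
by apply: measurableT_comp; [exact: measurable_polya_rect|exact: measurable_rcons].
Qed.

Definition inter_nth (C : set A) Bs i := set_nth set0 Bs i (nth set0 Bs i `&` C).

Lemma inter_nth_measurable C Bs i : (i < size Bs)%N ->
  measurable C -> (forall B, List.In B Bs -> measurable B) ->
  (forall B, List.In B (inter_nth C Bs i) -> measurable B).
Proof.
rewrite /inter_nth => + mC; elim: Bs i => [//|B Bs IH] [_ mBs /= D [<-|DBs]|i] /=.
- by apply: measurableI => //; apply: mBs; left.
- by apply: mBs; right.
rewrite ltnS => isz mBs D [<-|DBs]; first by apply: mBs; left.
by apply: IH DBs => // E EBs; apply: mBs; right.
Qed.

(* One more draw gives either a fresh colour from [alpha], a repeat of a colour of
   [s], or a repeat of one of the colours already required to lie in [Bs]. *)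
Lemma polya_rect_rcons (s : seq A) Bs C : measurable C ->
  (forall B, List.In B Bs -> measurable B) ->
  (a + (size s + size Bs)%:R)%:E * polya_rect s (rcons Bs C) =
  (alpha C + \sum_(x <- s) (\1_C x)%:E) * polya_rect s Bs +
  \sum_(i < size Bs) polya_rect s (inter_nth C Bs i).
Proof.
move=> mC; have S0 t : 0 <= \sum_(x <- t) (\1_C x)%:E :> \bar R.
  by apply: sume_ge0 => x _; rewrite lee_fin.
elim: Bs s => [s _|B Bs IH s mBs].
  rewrite /= big_ord0 adde0 mule1 addn0 polya_kernel_integral//.
  rewrite integral_cst// mul1e muleA -EFinM divff ?gt_eqF ?polya_den_gt0// mul1e.
  by congr (_ + _); apply: eq_bigr => x _; rewrite mule1.
have mB : measurable B by apply: mBs; left.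
have mBs' D : List.In D Bs -> measurable D by move=> ?; apply: mBs; right.
have mBsC D : List.In D (rcons Bs C) -> measurable D.
  by rewrite -cats1 => /(@List.in_app_or _ Bs [:: C])[/mBs'//|[<-//|[]]].
have mr Es : (forall D, List.In D Es -> measurable D) ->
    measurable_fun B (fun y => polya_rect (rcons s y) Es).
  by move=> mEs; apply: measurable_funTS; exact: measurable_polya_rect_rcons.
rewrite /= -ge0_integralZl//; last 3 first.
- exact: mr.
- by move=> *; exact: polya_rect_ge0.
- by rewrite lee_fin ltW// polya_den_gt0.
(* Moving the first drawn colour [y] from the list of sets into the past leaves the denominator
   unchanged. Its own atom, [\1_C y], later becomes the term i = 0 of the sum, where the first set
   is cut with [C]. *)
have E y : (a + (size s + (size Bs).+1)%:R)%:E * polya_rect (rcons s y) (rcons Bs C) =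
  ((alpha C + \sum_(x <- s) (\1_C x)%:E) * polya_rect (rcons s y) Bs +
   (\1_C y)%:E * polya_rect (rcons s y) Bs) +
  \sum_(i < size Bs) polya_rect (rcons s y) (inter_nth C Bs i).
  have := IH (rcons s y) mBs'; rewrite size_rcons addSnnS => ->.
  congr (_ + _); rewrite -ge0_muleDl ?adde_ge0 ?lee_fin//; congr (_ * _).
  by rewrite -addeA -cats1 big_cat big_seq1.
under eq_integral do rewrite E.
have mI : measurable_fun B (fun y => (\1_C y)%:E * polya_rect (rcons s y) Bs).
  by apply: emeasurable_funM; [exact/measurable_EFinP|exact: mr].
have mN i : (i < size Bs)%N -> measurable_fun B (fun y =>
    polya_rect (rcons s y) (inter_nth C Bs i)).
  by move=> isz; apply: mr; exact: inter_nth_measurable.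
have r0 t Es := polya_rect_ge0 t Es.
rewrite ge0_integralD//; last 4 first.
- by move=> y _; rewrite adde_ge0// mule_ge0// ?adde_ge0// lee_fin.
- by apply: emeasurable_funD => //; apply: measurable_funeM; exact: mr.
- by move=> y _; apply: sume_ge0.
- by apply: emeasurable_sum => i; exact: mN.
rewrite ge0_integralD//; last 3 first.
- by move=> y _; rewrite mule_ge0// adde_ge0.
- by apply: measurable_funeM; exact: mr.
- by move=> y _; rewrite mule_ge0// lee_fin.
rewrite ge0_integralZl//; last 2 first.
- exact: mr.
- by rewrite adde_ge0.
rewrite -addeA big_ord_recl /=; congr (_ + (_ + _)).
  rewrite [LHS]integral_mkcond [RHS]integral_mkcond; apply: eq_integral => y _.
  rewrite !patchE indicE in_setI; case: (y \in B) => //=.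
  by case: (y \in C); rewrite ?mul1e ?mul0e.
by rewrite ge0_integral_sum// => i; exact: mN.
Qed.

End polya_rect.

(** * Spreadability and the predictive rule *)

Section predictive.
Context d dA (Omega : measurableType d) (A : measurableType dA) (R : realType).
Variables (P : probability Omega R) (X : nat -> {RV P >-> A}).

(** For the identity family this is convertible to [sample k], which is used tacitly below. *)
Definition sample_at k (j : 'I_k -> nat) (w : Omega) : k.-tuple A :=
  [tuple X (j i) w | i < k].

Lemma measurable_sample_at k (j : 'I_k -> nat) : measurable_fun setT (sample_at j).
Proof.
apply/measurable_fun_tnthP => i.
by rewrite (_ : _ \o _ = X (j i))//; apply/funext => w /=; rewrite tnth_mktuple.
Qed.

HB.instance Definition _ k (j : 'I_k -> nat) :=
  isMeasurableFun.Build _ _ _ _ (sample_at j) (@measurable_sample_at k j).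

Lemma sample_at_rect k (j : 'I_k -> nat) (B : 'I_k -> set A) :
  sample_at j @^-1` rect B = \bigcap_(i in [set: 'I_k]) X (j i) @^-1` B i.
Proof.
apply/seteqP; split => w /= H i; first by move=> _; have := H i; rewrite tnth_mktuple.
by rewrite tnth_mktuple; exact: H.
Qed.

Lemma subtuple_sample_at m k (f : 'I_m -> 'I_k) (j : 'I_k -> nat) w :
  subtuple f (sample_at j w) = sample_at (fun i => j (f i)) w.
Proof. by apply: eq_from_tnth => i; rewrite !tnth_mktuple. Qed.

Variable alpha : {finite_measure set A -> \bar R}.
Hypothesis polyaX : polya_sequence X alpha.

Local Open Scope ereal_scope.

Lemma polya_rect_sample_at k (j : 'I_k -> nat) (B : 'I_k -> set A) :
  (forall i l : 'I_k, (i < l)%N -> (j i < j l)%N) -> (forall i, measurable (B i)) ->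
  P (sample_at j @^-1` rect B) = polya_rect alpha [::] [seq B i | i <- enum 'I_k].
Proof. by move=> ij mB; rewrite sample_at_rect polyaX. Qed.

(** The defining formula does not contain the indices. It speaks of increasing families only;
    arbitrary injective families have to wait for the conditional law given [D]. *)
Lemma spreadable k (j j' : 'I_k -> nat) (S : set (k.-tuple A)) :
  (forall i l : 'I_k, (i < l)%N -> (j i < j l)%N) ->
  (forall i l : 'I_k, (i < l)%N -> (j' i < j' l)%N) ->
  measurable S -> P (sample_at j @^-1` S) = P (sample_at j' @^-1` S).
Proof.
move=> ij ij' mS.
apply: (@tuple_measure_unique _ _ _ _ (distribution P (sample_at j))
  (distribution P (sample_at j'))) => //.
  by rewrite ltey_eq fin_num_measure.
move=> B mB.
exact: etrans (polya_rect_sample_at ij mB) (esym (polya_rect_sample_at ij' mB)).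
Qed.

Hypothesis alpha_gt0 : 0 < alpha setT.
Local Notation a := (fine (alpha setT)).
Local Notation sample := (sample X).

(** With i < k an earlier draw is repeated, which expresses an atom of the predictive law; with i =
    k the result is the next sample. *)
Definition sample_rcons k (i : nat) (w : Omega) : k.+1.-tuple A :=
  [tuple of rcons (sample k w) (X i w)].

Lemma sample_rconsE k i :
  sample_rcons k i = sample_at (fun l : 'I_k.+1 => if (l < k)%N then val l else i).
Proof.
apply/funext => w; apply: eq_from_tnth => l.
rewrite tnth_mktuple (tnth_nth (X i w)) /= nth_rcons size_map size_enum_ord.
case: ltnP => [lk|kl].
  by rewrite (nth_map (Ordinal lk)) ?size_enum_ord// nth_enum_ord.
by rewrite eqn_leq kl -ltnS ltn_ord.
Qed.

HB.instance Definition _ k i := isMeasurableFun.Build _ _ _ _ (sample_rcons k i)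
  (eq_ind_r (measurable_fun setT) (measurable_sample_at _) (sample_rconsE k i)).

Lemma predictive_rect k (B : 'I_k.+1 -> set A) : (forall i, measurable (B i)) ->
  (a + k%:R)%:E * P (sample k.+1 @^-1` rect B) =
  alpha (B ord_max) * P (sample k @^-1` rect (fun i => B (widen_ord (leqnSn k) i))) +
  \sum_(i < k) P (sample_rcons k i @^-1` rect B).
Proof.
move=> mB; set B' := fun i => B _.
have mB' i : measurable (B' i) by exact: mB.
rewrite (polya_rect_sample_at (j := fun i : 'I_k.+1 => i))//.
rewrite (polya_rect_sample_at (j := fun i : 'I_k => i))//.
set Bs := [seq B' i | i <- enum 'I_k].
have mBs C : List.In C Bs -> measurable C.
  by rewrite /Bs; elim: (enum _) => //= i s IH [<-|].
have szBs : size Bs = k by rewrite size_map size_enum_ord.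
have -> : [seq B i | i <- enum 'I_k.+1] = rcons Bs (B ord_max).
  by rewrite enum_ordSr map_rcons -map_comp.
have := @polya_rect_rcons _ _ _ alpha alpha_gt0 [::] Bs (B ord_max) (mB _) mBs.
rewrite szBs big_nil adde0 add0n => ->; congr (_ + _).
apply: eq_bigr => i _.
(* A repeated draw [X i] must meet both its own constraint and the last one, so only the i-th set
   shrinks. *)
pose C j := if j == i then B' j `&` B ord_max else B' j.
have mC j : measurable (C j) by rewrite /C; case: ifP => // _; exact: measurableI.
have -> : inter_nth (B ord_max) Bs i = [seq C j | j <- enum 'I_k].
  apply: (@eq_from_nth _ set0).
    by rewrite size_set_nth szBs size_map size_enum_ord; apply/maxn_idPr.
  move=> l; rewrite size_set_nth szBs (maxn_idPr _)// => lk.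
  have Bl l' (lk' : (l' < k)%N) : nth set0 Bs l' = B' (Ordinal lk').
    rewrite (nth_map i) ?size_enum_ord//; congr B'.
    by apply: val_inj; rewrite /= nth_enum_ord.
  rewrite nth_set_nth /= [RHS](nth_map i) ?size_enum_ord//.
  rewrite [nth i _ l](_ : _ = Ordinal lk); last by apply: val_inj; rewrite /= nth_enum_ord.
  rewrite /C -val_eqE /=; case: eqP => [li|_]; last exact: Bl.
  by rewrite -li (Bl _ lk).
rewrite -(polya_rect_sample_at (j := fun i : 'I_k => i))//.
congr (P _); apply/seteqP; split => w /=.
  move=> H l; have [lk|kl] := ltnP l k.
    have := H (Ordinal lk); rewrite sample_rconsE !tnth_mktuple /C lk/=.
    have -> : B' (Ordinal lk) = B l by congr B; exact: val_inj.
    by case: eqP => // _ [].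
  have -> : l = ord_max by apply/val_inj/eqP; rewrite eqn_leq kl -ltnS ltn_ord.
  have := H i; rewrite sample_rconsE !tnth_mktuple /C eqxx /= ltnn.
  by case.
move=> H l; rewrite tnth_mktuple.
have Hl := H (widen_ord (leqnSn k) l).
rewrite sample_rconsE !tnth_mktuple /= ltn_ord in Hl.
rewrite /C; case: eqP => [li|//]; split => //.
have := H ord_max; rewrite sample_rconsE !tnth_mktuple /= ltnn li//.
Qed.

(** Both sides are integrals against finite measures on (k+1)-tuples: a multiple of the law of the
    sample, and the image of [law \x alpha] under appending plus the laws with a repeated draw. They
    agree on rectangles by [predictive_rect]. *)
Lemma ge0_predictive k (f : k.+1.-tuple A -> \bar R) :
  measurable_fun setT f -> (forall x, 0 <= f x) ->
  (a + k%:R)%:E * \int[P]_w f (sample k.+1 w) =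
  \int[P]_w \int[alpha]_y f [tuple of rcons (sample k w) y] +
  \sum_(i < k) \int[P]_w f (sample_rcons k i w).
Proof.
move=> mf f0.
pose law := distribution P (sample k).
pose rc := fun p : k.-tuple A * A => [tuple of rcons p.1 p.2] : k.+1.-tuple A.
have mrc : measurable_fun setT rc by exact: measurable_rcons.
pose m1 : {measure set _ -> \bar R} :=
  mscale (NngNum (ltW (polya_den_gt0 alpha_gt0 k))) (distribution P (sample k.+1)).
pose m2' : {measure set _ -> \bar R} := measure_add
  (pushforward (law \x alpha) rc)
  (msum (fun i => distribution P (sample_rcons k i)) k).
pose m2 := m2' mrc.
have m12 S : measurable S -> m1 S = m2 S.
  move=> mS; apply: tuple_measure_unique => //.
    rewrite /m1 /= /mscale/= ; apply: lte_mul_pinfty => //.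
      by rewrite lee_fin ltW// polya_den_gt0.
    by rewrite ltey_eq fin_num_measure.
  move=> B mB; rewrite [RHS]measure_addE /m1 /= /mscale /msum /=.
  rewrite /distribution /pushforward /= predictive_rect//; congr (_ + _).
  have E : [set x | rect B (rc x)] =
      rect (fun i => B (widen_ord (leqnSn k) i)) `*` B ord_max.
    apply/seteqP; split => -[x y] /=.
      move=> H; split => [i|].
        have := H (widen_ord (leqnSn k) i).
        by rewrite !(tnth_nth y) /= nth_rcons size_tuple ltn_ord.
      by have := H ord_max; rewrite !(tnth_nth y) /= nth_rcons size_tuple ltnn eqxx.
    move=> [H1 H2] i; have [ik|ki] := ltnP i k.
      have := H1 (Ordinal ik).
      rewrite !(tnth_nth y) /= nth_rcons size_tuple ik.
      by rewrite (_ : widen_ord _ _ = i)//; exact: val_inj.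
    have -> : i = ord_max by apply/val_inj/eqP; rewrite eqn_leq ki -ltnS ltn_ord.
    by rewrite (tnth_nth y) /= nth_rcons size_tuple ltnn eqxx.
  transitivity ((law \x alpha) (rect (fun i => B (widen_ord (leqnSn k) i)) `*` B ord_max));
    last by rewrite -E.
  rewrite product_measure1E//; last exact: measurable_rect.
  by rewrite muleC.
have : \int[m1]_x f x = \int[m2]_x f x.
  by apply: eq_measure_integral => S mS _; exact: m12.
rewrite /m1 /m2 /m2' ge0_integral_mscale//= ge0_integral_distribution// => ->.
rewrite ge0_integral_measure_add//; congr (_ + _).
  rewrite ge0_integral_pushforward// preimage_setT.
  rewrite fubini_tonelli1//=; last exact: measurableT_comp.
  rewrite /fubini_F /law ge0_integral_distribution//.
    apply: (@measurable_fun_fubini_tonelli_F _ _ _ _ R alpha (f \o rc)) => //.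
    exact: measurableT_comp.
    by move=> x; exact: f0.
  by move=> x; apply: integral_ge0 => y _; exact: f0.
rewrite ge0_integral_measure_sum//; apply: eq_bigr => i _.
by rewrite ge0_integral_distribution.
Qed.

End predictive.

(** * Approximation of events by an algebra of events *)

Section set_approximation.
Context d (O : measurableType d) (R : realType) (P : probability O R).
Variable F : set (set O).
Local Open Scope ereal_scope.

Definition symdiff (G E : set O) := (G `\` E) `|` (E `\` G).

Lemma measurable_symdiff G E : measurable G -> measurable E -> measurable (symdiff G E).
Proof. by move=> mG mE; apply: measurableU; exact: measurableD. Qed.

(** Approximation is up to probability, so all measurable null sets qualify; this absorbs the
    exceptional sets of almost sure limits. *)
Definition approximable : set (set O) := [set G | measurable G /\
  forall e : R, (0 < e)%R -> exists2 E, F E & P (symdiff G E) <= e%:E].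

Hypotheses (FT : F setT) (FC : setC_closed F) (FU : setU_closed F)
  (Fm : F `<=` measurable).

Lemma sub_approximable : F `<=` approximable.
Proof.
move=> G FG; split; first exact: Fm.
move=> e e0; exists G => //; rewrite /symdiff setDv setU0 measure0 lee_fin ltW//.
Qed.

Lemma null_approximable G : measurable G -> P G = 0 -> approximable G.
Proof.
move=> mG G0; split => // e e0; exists set0; first by rewrite -setCT; exact: FC.
by rewrite /symdiff setD0 set0D setU0 G0 lee_fin ltW.
Qed.

Lemma approximableU : setU_closed approximable.
Proof.
move=> G G' [mG HG] [mG' HG']; split; first exact: measurableU.
move=> e e0; have e20 : (0 < e / 2)%R by rewrite divr_gt0.
have [E FE GE] := HG _ e20; have [E' FE' GE'] := HG' _ e20.
exists (E `|` E'); first exact: FU.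
have mE := Fm FE; have mE' := Fm FE'.
rewrite [e in leRHS](splitr e) EFinD.
apply: le_trans (leeD GE GE').
apply: (le_trans _ (measureU2 _ _ _)) => //; try exact: measurable_symdiff.
apply: le_measure; rewrite ?inE.
- by apply: measurable_symdiff; exact: measurableU.
- by apply: measurableU; exact: measurable_symdiff.
by rewrite /symdiff => x /=; tauto.
Qed.

(** For a countable union, half of [e] pays for cutting it to a finite union, since the remainders
    decrease to the empty set, and half for approximating that finite union. *)
Lemma approximable_sigma_algebra : sigma_algebra setT approximable.
Proof.
have A0 : approximable set0 by apply: null_approximable => //; rewrite measure0.
split => // [G [mG HG]|G HG].
  split; first by rewrite setTD; exact: measurableC.
  move=> e e0; have [E FE GE] := HG e e0; exists (~` E); first exact: FC.
  rewrite (_ : symdiff _ _ = symdiff G E)// /symdiff.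
  apply/seteqP; split => x /=; have [|] := pselect (E x); have [|] := pselect (G x); tauto.
have mG n : measurable (G n) by have [] := HG n.
split; first exact: bigcup_measurable.
move=> e e0; have e20 : (0 < e / 2)%R by rewrite divr_gt0.
pose U n := \big[setU/set0]_(i < n) G i.
have AU n : approximable (U n).
  rewrite /U; elim: n => [|n IH]; first by rewrite big_ord0.
  by rewrite big_ord_recr/=; apply: approximableU.
have mU n : measurable (U n) by have [] := AU n.
pose V n := (\bigcup_i G i) `\` U n.
have mGG : measurable (\bigcup_i G i) by exact: bigcup_measurable.
have mV n : measurable (V n) by exact: measurableD.
have V0 : \bigcap_n V n = set0.
  rewrite -subset0 => x Vx; have [[i _ Gix] _] := Vx 0%N I.
  have [_] := Vx i.+1 I; apply; rewrite /U -bigcup_mkord; exists i => //=.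
have cV : P \o V @ \oo --> P (\bigcap_n V n).
  apply: nonincreasing_cvg_mu => //.
  - by rewrite ltey_eq fin_num_measure.
  - by rewrite V0.
  - move=> m n mn; apply/subsetPset; apply: setDS.
    rewrite /U -!bigcup_mkord; apply: bigcup_sub => i /= im.
    by apply: bigcup_sup => /=; exact: leq_trans im mn.
rewrite V0 measure0 in cV.
have [n Vn] : exists n, P (V n) <= (e / 2)%:E.
  move/fine_cvgP : cV => [_ /cvgrPdist_le/(_ _ e20)[n _ Hn]].
  exists n; have := Hn n (leqnn n); rewrite /= sub0r normrN ger0_norm ?fine_ge0//.
  by rewrite -lee_fin fineK ?fin_num_measure.
have [_ /(_ _ e20)[E FE UE]] := AU n.
exists E => //; rewrite [e in leRHS](splitr e) EFinD.
apply: le_trans (leeD Vn UE).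
have mE := Fm FE.
apply: (le_trans _ (measureU2 _ _ _)) => //; try exact: measurable_symdiff.
apply: le_measure; rewrite ?inE.
- exact: measurable_symdiff.
- by apply: measurableU => //; exact: measurable_symdiff.
have UG : U n `<=` \bigcup_i G i.
  by rewrite /U -bigcup_mkord; apply: bigcup_sub => i _; exact: bigcup_sup.
rewrite /symdiff /V => x /=; have [|] := pselect (U n x); have := UG x; tauto.
Qed.

Lemma approximable_dist (G E B : set O) : measurable G -> measurable E -> measurable B ->
  (`|fine (P (G `&` B)) - fine (P (E `&` B))| <= fine (P (symdiff G E)))%R.
Proof.
have key (G' E' : set O) : measurable G' -> measurable E' -> measurable B ->
    (fine (P (G' `&` B)) - fine (P (E' `&` B)) <= fine (P (symdiff G' E')))%R.
  move=> mG mE mB; rewrite lerBlDl -fineD ?fin_num_measure//; try exact: measurableI;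
    try exact: measurable_symdiff.
  apply: fine_le; rewrite ?fin_numD ?fin_num_measure//; try exact: measurableI;
    try exact: measurable_symdiff.
  have mI1 : measurable (G' `&` B) by exact: measurableI.
  have mI2 : measurable (E' `&` B) by exact: measurableI.
  have mS := measurable_symdiff mG mE.
  apply: (le_trans _ (measureU2 P mI2 mS)).
  apply: le_measure; rewrite ?inE.
  - exact: measurableI.
  - by apply: measurableU; [exact: measurableI|exact: measurable_symdiff].
  by rewrite /symdiff => x /=; have [|] := pselect (E' x); tauto.
move=> mG mE mB; rewrite ler_norml lerNl opprB; apply/andP; split; last exact: key.
by rewrite (_ : symdiff G E = symdiff E G) ?key// /symdiff setUC.
Qed.

End set_approximation.

(** * Index families continued by a distant block, and events of [D] as tail events *)

Section concatenation.
Implicit Types (k m M : nat).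

(** If all values of [j] lie below [M], the continued family is still increasing, as spreadability
    requires. *)
Definition cat_index k (j : 'I_k -> nat) M m (i : 'I_(k + m)) : nat :=
  match fintype.split i with inl i => j i | inr l => (M + l)%N end.

Lemma cat_index_lshift k (j : 'I_k -> nat) M m i :
  cat_index j M (lshift m i) = j i.
Proof. by rewrite /cat_index (unsplitK (inl i)). Qed.

Lemma cat_index_rshift k (j : 'I_k -> nat) M m (i : 'I_m) :
  cat_index j M (rshift k i) = (M + i)%N.
Proof. by rewrite /cat_index (unsplitK (inr i)). Qed.

Lemma cat_index_incr k (j : 'I_k -> nat) M m :
  (forall i l : 'I_k, (i < l)%N -> (j i < j l)%N) -> (forall i, (j i < M)%N) ->
  forall i l : 'I_(k + m), (i < l)%N -> (cat_index j M i < cat_index j M l)%N.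
Proof.
move=> ij jM i l; rewrite -{1}(splitK i) -{1}(splitK l) /cat_index.
case: (fintype.split i) => x; case: (fintype.split l) => y /=.
- exact: ij.
- by move=> _; rewrite (leq_trans (jM x))// leq_addr.
- by have := ltn_ord y; lia.
- lia.
Qed.

Lemma cat_index_lt k (j : 'I_k -> nat) M m N :
  (forall i, (j i < N)%N) -> (M + m <= N)%N ->
  forall i : 'I_(k + m), (cat_index j M i < N)%N.
Proof.
move=> jN MN i; rewrite /cat_index; case: (fintype.split i) => x; first exact: jN.
by have := ltn_ord x; lia.
Qed.

End concatenation.

Section directing_measure.
Context d dA (Omega : measurableType d) (A : measurableType dA) (R : realType).
Variables (P : probability Omega R) (X : nat -> {RV P >-> A}).
Variable alpha : {finite_measure set A -> \bar R}.
Hypothesis polyaX : polya_sequence X alpha.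
Variable D : {RV P >-> pprobability A R}.
Hypothesis limD : empirical_limit D X.

Local Notation sample := (sample X).
Local Notation sample_at := (sample_at X).

Let mpre d' (T' : measurableType d') (F : Omega -> T') B :
  measurable_fun setT F -> measurable B -> measurable (F @^-1` B).
Proof. by move=> mF mB; rewrite -[X in measurable X]setTI; exact: mF. Qed.

Definition tail_index M m (i : 'I_m) : nat := (M + i)%N.

(** Each event uses finitely many draws, but their number is free, so these events form an algebra.
    For M = 0 they are the events of finite samples. *)
Definition tail_events M : set (set Omega) :=
  [set E | exists m (S : set (m.-tuple A)),
    measurable S /\ E = sample_at (@tail_index M m) @^-1` S].

Lemma tail_index_widen M m m' (mm' : (m <= m')%N) (S : set (m.-tuple A)) :
  sample_at (@tail_index M m) @^-1` S =
  sample_at (@tail_index M m') @^-1` (subtuple (widen_ord mm') @^-1` S).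
Proof. by apply/seteqP; split => w /=; rewrite subtuple_sample_at. Qed.

Lemma measurable_subtuple_preimage m n (f : 'I_m -> 'I_n) (S : set (m.-tuple A)) :
  measurable S -> measurable (subtuple f @^-1` S).
Proof. by move=> mS; rewrite -[X in measurable X]setTI; exact: measurable_subtuple. Qed.

Lemma tail_eventsT M : tail_events M setT.
Proof. by exists 0%N, setT; split. Qed.

Lemma tail_eventsC M : setC_closed (tail_events M).
Proof.
move=> _ [m [S [mS ->]]]; exists m, (~` S); split; first exact: measurableC.
by rewrite preimage_setC.
Qed.

Lemma tail_eventsU M : setU_closed (tail_events M).
Proof.
move=> _ _ [m [S [mS ->]]] [m' [S' [mS' ->]]].
rewrite (tail_index_widen M (leq_maxl m m')) (tail_index_widen M (leq_maxr m m')).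
rewrite -preimage_setU; do 2 eexists; split; last by [].
by apply: measurableU; exact: measurable_subtuple_preimage.
Qed.

Lemma tail_events_measurable M : tail_events M `<=` measurable.
Proof. by move=> _ [m [S [mS ->]]]; apply: mpre. Qed.

Local Notation tail_approx M := (approximable P (tail_events M)).

(** Averages over [n.+1] terms, so that the denominator never vanishes. *)
Definition empirical M (C : set A) n (w : Omega) : R :=
  n.+1%:R^-1 * \sum_(i < n.+1) \1_C (X (M + i) w).

Lemma measurable_empirical M C n : measurable C ->
  measurable_fun setT (empirical M C n).
Proof.
move=> mC; apply: measurable_funM => //; apply: measurable_sum => i.
exact: measurableT_comp.
Qed.

Lemma cvg_empirical M (C : set A) : measurable C ->
  {ae P, forall w, empirical M C n w @[n --> \oo] --> fine (D w C)}.
Proof.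
move=> /limD; apply: filterS => w cw.
(* The shifted mean is the ordinary mean of M + n + 1 terms, rescaled by (M + n + 1) / (n + 1),
   minus the first M terms divided by n + 1; the scale tends to 1 and the subtracted part to 0. *)
have E n : empirical M C n w = (1 + M%:R * (n.+1)%:R^-1) *
    ((n + M.+1)%N%:R^-1 * \sum_(i < n + M.+1) \1_C (X i w)) -
    (n.+1)%:R^-1 * \sum_(i < M) \1_C (X i w).
  rewrite /empirical addnS -addSn addnC.
  have -> : \sum_(i < M + n.+1) (\1_C (X i w) : R) =
      \sum_(i < M) \1_C (X i w) + \sum_(i < n.+1) \1_C (X (M + i)%N w).
    by rewrite big_split_ord.
  have n0 : n.+1%:R != 0 :> R by rewrite pnatr_eq0.
  have nM0 : (M + n.+1)%N%:R != 0 :> R by rewrite pnatr_eq0 addnS.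
  rewrite (_ : 1 + M%:R * n.+1%:R^-1 = n.+1%:R^-1 * (M + n.+1)%:R); last first.
    by rewrite natrD; field.
  by rewrite -mulrA (mulrA _%:R) divff// mul1r mulrDr addrAC subrr add0r.
under eq_fun do rewrite E.
have h0 : (n.+1%:R^-1 : R) @[n --> \oo] --> 0 by exact: cvg_harmonic.
have -> : fine (D w C) = (1 + M%:R * 0) * fine (D w C) - 0 * \sum_(i < M) \1_C (X i w).
  by rewrite mulr0 addr0 mul1r mul0r subr0.
apply: cvgB; last by apply: cvgM => //; exact: cvg_cst.
apply: cvgM; last exact: (cvg_comp _ _ (cvg_addnr M.+1) cw).
apply: cvgD; first exact: cvg_cst.
by apply: cvgM => //; exact: cvg_cst.
Qed.

Lemma measurable_D C : measurable C -> measurable_fun setT (fun w => D w C).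
Proof.
move=> mC; exact: (measurable_kernel (kprobability (measurable_funPT D)) C mC).
Qed.

Lemma measurable_fineD C : measurable C -> measurable_fun setT (fun w => fine (D w C)).
Proof. by move=> mC; apply: measurableT_comp => //; exact: measurable_D. Qed.

Lemma sub_sigma_D (H : set (set Omega)) : sigma_algebra setT H ->
  (forall C, measurable C -> forall B : set (\bar R), measurable B ->
     H ((fun w => D w C) @^-1` B)) -> sigma_D D `<=` H.
Proof.
move=> sH HD; apply: smallest_sub => // _ [C mC [B mB <-]].
by rewrite setTI; exact: HD.
Qed.

Lemma sigma_D_measurable : sigma_D D `<=` measurable.
Proof.
apply: sub_sigma_D; first exact: sigma_algebra_measurable.
by move=> C mC B mB; apply: mpre => //; exact: measurable_D.
Qed.

(* The empirical means of a shifted sample have the same limit, so that events of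
   [sigma_D D] are close to events that depend only on [X_i] with [i >= M]. *)
Lemma sigma_D_approximable M : sigma_D D `<=` tail_approx M.
Proof.
have sa := approximable_sigma_algebra P (@tail_eventsT M) (@tail_eventsC M)
  (@tail_eventsU M) (@tail_events_measurable M).
apply: sub_sigma_D => // C mC.
(* With the approximable events as sigma-algebra on [Omega], the claim becomes measurability of
   [D w C] and can be obtained from a limit of measurable functions. *)
pose OM := g_sigma_algebraType (tail_approx M).
have OME : @measurable _ OM = tail_approx M.
  by rewrite [LHS](sigma_algebra_id sa).
suff mDC : measurable_fun (setT : set OM) (fun w : OM => fine (D w C) : R).
  move=> B mB; rewrite -OME -[X in measurable X]setTI.
  have mD : measurable_fun (setT : set OM) (fun w : OM => D w C).
    have -> : (fun w : OM => D w C) = EFin \o (fun w : OM => fine (D w C)).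
      by apply/funext => w /=; rewrite fineK// fin_num_measure.
    exact/measurable_EFinP.
  exact: mD.
have [N [mN N0 Nsub]] := cvg_empirical M mC.
have AN S : measurable S -> (S `<=` N) -> @measurable _ OM S.
  move=> mS SN; rewrite OME; apply: null_approximable => //.
  - exact: tail_eventsT.
  - exact: tail_eventsC.
  by apply/eqP; rewrite -measure_le0 -[leRHS]N0 le_measure ?inE.
(* On the exceptional null set the limit itself is used, which makes the convergence hold
   everywhere; measurable subsets of that set are approximable. *)
pose h n (w : OM) : R := if w \in N then fine (D w C) else empirical M C n w.
apply: (@measurable_fun_cvg _ _ _ _ h); last first.
  move=> w _; rewrite /h; have [_|] := boolP (w \in N); first exact: cvg_cst.
  by rewrite notin_setE => Nw; apply: contrapT => Hw; apply: Nw; exact: Nsub.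
move=> n _ B mB; rewrite setTI.
have -> : h n @^-1` B = (N `&` (fun w => fine (D w C)) @^-1` B) `|`
    (~` N `&` empirical M C n @^-1` B).
  apply/seteqP; split => w; rewrite /h /=.
    by case: ifPn => [/set_mem Nw Bw|/negP Nw Bw]; [left|right; split => // /mem_set].
  by case: ifPn => [/set_mem Nw [[]//|[]//]|/negP Nw [[/mem_set//]|[]//]].
apply: measurableU.
  apply: AN => //; apply: measurableI => //; apply: mpre => //; exact: measurable_fineD.
apply: measurableI; first by apply: measurableC; apply: AN.
rewrite OME; apply: sub_approximable; first exact: tail_events_measurable.
pose g (x : n.+1.-tuple A) : R := n.+1%:R^-1 * \sum_(i < n.+1) \1_C (tnth x i).
have mg : measurable_fun setT g.
  apply: measurable_funM => //; apply: measurable_sum => i.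
  by apply: measurableT_comp => //; exact: measurable_tnth.
exists n.+1, (g @^-1` B); split; first by rewrite -[X in measurable X]setTI; exact: mg.
have gE w : g (sample_at (@tail_index M n.+1) w) = empirical M C n w.
  by rewrite /g /empirical; congr (_ * _); apply: eq_bigr => i _; rewrite tnth_mktuple.
by apply/seteqP; split => w /=; rewrite gE.
Qed.

(* Replace [G] by a nearby tail event lying beyond all the indices of [j] and [j'],
   and apply spreadability to the concatenated index families. *)
Lemma spreadable_sigma_D G k (j j' : 'I_k -> nat) (S : set (k.-tuple A)) :
  sigma_D D G ->
  (forall i l : 'I_k, (i < l)%N -> (j i < j l)%N) ->
  (forall i l : 'I_k, (i < l)%N -> (j' i < j' l)%N) ->
  measurable S ->
  P (G `&` sample_at j @^-1` S) = P (G `&` sample_at j' @^-1` S).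
Proof.
move=> sG ij ij' mS; have mG := sigma_D_measurable sG.
pose M := (\max_(i < k) (maxn (j i) (j' i)).+1)%N.
have jM i : (j i < M)%N.
  by rewrite (leq_trans _ (leq_bigmax i))// ltnS leq_maxl.
have j'M i : (j' i < M)%N.
  by rewrite (leq_trans _ (leq_bigmax i))// ltnS leq_maxr.
have mJ (i : 'I_k -> nat) : measurable (sample_at i @^-1` S) by exact: mpre.
suff : fine (P (G `&` sample_at j @^-1` S)) = fine (P (G `&` sample_at j' @^-1` S)).
  have fJ i : P (G `&` sample_at i @^-1` S) \is a fin_num.
    by rewrite fin_num_measure//; exact: measurableI.
  by move=> H; rewrite -(fineK (fJ j)) -(fineK (fJ j')) H.
apply/eqP; rewrite -subr_eq0 -normr_le0; apply/ler_addgt0Pr => e e0; rewrite add0r.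
have [_ /(_ (e / 2))] := sigma_D_approximable M sG.
rewrite divr_gt0// => /(_ isT)[E [m [S' [mS' EE]]] GE].
have mE : measurable E by rewrite EE; exact: mpre.
have eqE : P (E `&` sample_at j @^-1` S) = P (E `&` sample_at j' @^-1` S).
  have cE (i : 'I_k -> nat) : E `&` sample_at i @^-1` S =
     sample_at (cat_index i M (m := m)) @^-1`
       ((subtuple (@rshift k m) @^-1` S') `&` (subtuple (@lshift k m) @^-1` S)).
    have El w : subtuple (@lshift k m) (sample_at (cat_index i M (m := m)) w) = sample_at i w.
      rewrite subtuple_sample_at; congr (sample_at _ w); apply/funext => l.
      exact: cat_index_lshift.
    have Er w : subtuple (@rshift k m) (sample_at (cat_index i M (m := m)) w) =
        sample_at (@tail_index M m) w.
      rewrite subtuple_sample_at; congr (sample_at _ w); apply/funext => l.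
      exact: cat_index_rshift.
    by rewrite EE; apply/seteqP; split => w /=; rewrite El Er.
  rewrite !cE; apply: (spreadable polyaX).
  - exact: cat_index_incr.
  - exact: cat_index_incr.
  by apply: measurableI; exact: measurable_subtuple_preimage.
have H i := @approximable_dist _ _ _ P G E (sample_at i @^-1` S) mG mE (mJ i).
have fGE : fine (P (symdiff G E)) <= e / 2.
  by rewrite -lee_fin fineK ?fin_num_measure//; exact: measurable_symdiff.
have := H j; have := H j'; rewrite eqE; set x := fine _; set y := fine _; set z := fine _.
move=> H1 H2; have := le_trans H1 fGE; have := le_trans H2 fGE.
rewrite !ler_norml; lra.
Qed.

End directing_measure.

Lemma Rintegral_dominated d (O : measurableType d) (R : realType)
    (mu : {measure set O -> \bar R}) (E : set O) (f_ : (O -> R)^nat) (f g : O -> R) :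
  measurable E -> (forall n, measurable_fun setT (f_ n)) -> measurable_fun setT f ->
  {ae mu, forall w, f_ n w @[n --> \oo] --> f w} ->
  Rintegrable mu g -> (forall n w, `|f_ n w| <= g w) ->
  \int[mu]_(w in E) f_ n w @[n --> \oo] --> \int[mu]_(w in E) f w.
Proof.
move=> mE mf_ mf cf Ig fg.
have [||||| If _ cvgI] := @dominated_convergence _ _ _ mu E mE
    (fun n => EFin \o f_ n) (EFin \o f) (EFin \o g).
- by move=> n; apply: measurable_funTS; exact/measurable_EFinP.
- by apply: measurable_funTS; exact/measurable_EFinP.
- apply: filterS cf => w cw _; apply: cvg_EFin => //.
  exact: nearW.
- exact: Rintegrable_on.
- by apply: aeW => w n _; rewrite lee_fin; exact: fg.
apply: fine_cvg; rewrite fineK; last exact: integrable_fin_num.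
exact: cvgI.
Qed.

(** * De Finetti representation: the conditional law of fresh draws is a power of [D] *)

Section mixture.
Context d dA (Omega : measurableType d) (A : measurableType dA) (R : realType).
Variables (P : probability Omega R) (X : nat -> {RV P >-> A}).
Variable alpha : {finite_measure set A -> \bar R}.
Hypothesis polyaX : polya_sequence X alpha.
Variable D : {RV P >-> pprobability A R}.
Hypothesis limD : empirical_limit D X.

Local Notation sample := (sample X).
Local Notation sample_at := (sample_at X).

Let mpre d' (T' : measurableType d') (F : Omega -> T') B :
  measurable_fun setT F -> measurable B -> measurable (F @^-1` B).
Proof. by move=> mF mB; rewrite -[X in measurable X]setTI; exact: mF. Qed.

Definition tail_rect n M (C : 'I_n -> set A) : set Omega :=
  [set w | forall l, C l (X (M + l)%N w)].

Lemma cat_index_event k (j : 'I_k -> nat) n M (S : set (k.-tuple A)) (C : 'I_n -> set A) :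
  sample_at (cat_index j M (m := n)) @^-1`
    (subtuple (@lshift k n) @^-1` S `&` subtuple (@rshift k n) @^-1` rect C) =
  sample_at j @^-1` S `&` tail_rect M C.
Proof.
have El w : subtuple (@lshift k n) (sample_at (cat_index j M (m := n)) w) = sample_at j w.
  rewrite subtuple_sample_at; congr (sample_at _ w); apply/funext => l.
  exact: cat_index_lshift.
have Er w l : tnth (subtuple (@rshift k n) (sample_at (cat_index j M (m := n)) w)) l =
    X (M + l)%N w.
  by rewrite subtuple_sample_at tnth_mktuple cat_index_rshift.
apply/seteqP; split => w /=; rewrite El => -[HS HC]; split => // l.
  by have := HC l; rewrite Er.
by rewrite Er.
Qed.

Lemma measurable_cat_set k n (S : set (k.-tuple A)) (C : 'I_n -> set A) :
  measurable S -> (forall l, measurable (C l)) ->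
  measurable (subtuple (@lshift k n) @^-1` S `&` subtuple (@rshift k n) @^-1` rect C).
Proof.
move=> mS mC; apply: measurableI; apply: measurable_subtuple_preimage => //.
exact: measurable_rect.
Qed.

Definition Dprod n (C : 'I_n -> set A) w : R := \prod_(l < n) fine (D w (C l)).

Lemma measurable_Dprod n (C : 'I_n -> set A) : (forall l, measurable (C l)) ->
  measurable_fun setT (Dprod C).
Proof.
by move=> mC; apply: measurable_prod => l _; exact: (measurable_fineD D).
Qed.

Lemma Dprod_ge0 n (C : 'I_n -> set A) w : 0 <= Dprod C w.
Proof. by apply: prodr_ge0 => l _; rewrite fine_ge0. Qed.

Lemma Dprod_le1 n (C : 'I_n -> set A) w : (forall l, measurable (C l)) -> Dprod C w <= 1.
Proof.
move=> mC; suff /andP[] : 0 <= Dprod C w <= 1 by [].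
rewrite /Dprod; elim/big_ind : _ => [|x y /andP[x0 x1] /andP[y0 y1]|l _].
- by rewrite ler01 lexx.
- by rewrite mulr_ge0//= mulr_ile1.
by rewrite fine_ge0//= -lee_fin fineK ?fin_num_measure// probability_le1.
Qed.

Lemma empirical_norm_le1 M (C : set A) n w : `|empirical X M C n w| <= 1.
Proof.
have S0 : 0 <= \sum_(i < n.+1) (\1_C (X (M + i)%N w) : R) by apply: sumr_ge0.
rewrite ger0_norm /empirical; last by rewrite mulr_ge0.
rewrite mulrC ler_pdivrMr// mul1r.
apply: (@le_trans _ _ (\sum_(i < n.+1) 1)); last by rewrite sumr_const card_ord.
by apply: ler_sum => i _; rewrite indicE; case: (_ \in _).
Qed.

(* By spreadability each coordinate of the sample can be averaged over far-away
   indices; the averages tend to the factors of [Dprod C]. *)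
Lemma Rintegral_Dprod n (C : 'I_n -> set A) G : sigma_D D G ->
  (forall l, measurable (C l)) ->
  forall k (j : 'I_k -> nat) (S : set (k.-tuple A)) M,
  (forall i l : 'I_k, (i < l)%N -> (j i < j l)%N) -> (forall i, (j i < M)%N) ->
  measurable S ->
  \int[P]_(w in G `&` sample_at j @^-1` S) Dprod C w =
  fine (P (G `&` (sample_at j @^-1` S `&` tail_rect M C))).
Proof.
move=> sG; have mG := sigma_D_measurable sG.
elim: n C => [|n IH] C mC k j S M ij jM mS.
  rewrite (@eq_Rintegral _ _ _ _ _ (fun=> 1)); last by move=> w _; rewrite /Dprod big_ord0.
  rewrite Rintegral_cst ?mul1r//; last by apply: measurableI => //; exact: mpre.
  congr (fine (P (_ `&` _))); apply/seteqP; split => w /=; last by case.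
  by move=> HS; split => // -[].
pose C0 := C ord0; pose C' l := C (lift ord0 l).
have mC' l : measurable (C' l) by exact: mC.
have mC0 : measurable C0 by exact: mC.
set c := RHS.
set B0 := G `&` _; have mB0 : measurable B0 by apply: measurableI => //; exact: mpre.
have mZ := measurable_Dprod mC'.
have Z1 w : `|Dprod C' w| <= 1 by rewrite ger0_norm ?Dprod_ge0// Dprod_le1.
have I1 : Rintegrable P (fun=> 1 : R) by exact: finite_measure_integrable_cst.
have IZ : Rintegrable P (Dprod C').
  by apply: (le_Rintegrable _ _ I1) => // w; rewrite normr1.
(* The induction hypothesis is applied with [M + i] appended to the family [j], hence the
   quantification over families and events. Spreadability given sigma(D) then makes the value
   independent of i. *)
have each i : \int[P]_(w in B0 `&` X (M + i)%N @^-1` C0) Dprod C' w = c.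
  pose j' q := cat_index j (M + q) (m := 1).
  pose S' := (subtuple (@lshift k 1) @^-1` S `&`
    subtuple (@rshift k 1) @^-1` rect (fun _ : 'I_1 => C0)).
  have mS' : measurable S' by exact: measurable_cat_set.
  have ij' q : forall i l : 'I_(k + 1), (i < l)%N -> (j' q i < j' q l)%N.
    by apply: cat_index_incr => // l; rewrite (leq_trans (jM l))// leq_addr.
  have j'M q l : (j' q l < (M + q).+1)%N.
    by apply: cat_index_lt => [l'|]; [rewrite ltnS ltnW// (leq_trans (jM l'))// leq_addr|
      rewrite addn1].
  have EB q : sample_at (j' q) @^-1` S' = sample_at j @^-1` S `&` X (M + q)%N @^-1` C0.
    rewrite /j' /S' cat_index_event; congr (_ `&` _); apply/seteqP; split => w /=.
      by move=> /(_ ord0); rewrite addn0.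
    by move=> HC l; rewrite ord1 addn0.
  rewrite /B0 -setIA -EB (IH C' mC' _ (j' i) S' (M + i).+1 (ij' i) (j'M i) mS').
  rewrite /c; congr fine.
  have -> : sample_at j @^-1` S `&` tail_rect M C =
      sample_at (j' 0%N) @^-1` S' `&` tail_rect (M + 0).+1 C'.
    rewrite EB -setIA; congr (_ `&` _); rewrite addn0; apply/seteqP; split => w /=.
      move=> H; split; first by have := H ord0; rewrite addn0.
      by move=> l; have := H (lift ord0 l); rewrite /= /bump /= add1n addnS addSn.
    move=> [H0 H] l; case: (unliftP ord0 l) => [l' ->|->]; last by rewrite addn0.
    by have := H l'; rewrite /= /bump /= add1n addnS addSn.
  rewrite -!cat_index_event; apply: (spreadable_sigma_D polyaX limD sG).
  - by apply: cat_index_incr; [exact: ij'|exact: j'M].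
  - by apply: cat_index_incr; [exact: ij'|exact: j'M].
  - exact: measurable_cat_set.
have const N : \int[P]_(w in B0) (empirical X M C0 N w * Dprod C' w) = c.
  rewrite -Rintegral_indic//.
  have E w : \1_B0 w * (empirical X M C0 N w * Dprod C' w) =
      N.+1%:R^-1 * \sum_(i < N.+1) (\1_(B0 `&` X (M + i)%N @^-1` C0) w * Dprod C' w).
    rewrite -mulr_suml.
    have -> : \sum_(i < N.+1) (\1_(B0 `&` X (M + i)%N @^-1` C0) w : R) =
        \1_B0 w * \sum_(i < N.+1) \1_C0 (X (M + i)%N w).
      rewrite mulr_sumr; apply: eq_bigr => q _; rewrite !indicE in_setI.
      rewrite -[X (M + q)%N w \in C0]/(w \in X (M + q)%N @^-1` C0).
      by case: (w \in B0); rewrite ?mul0r ?mul1r.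
    by rewrite /empirical; ring.
  have Ii q : Rintegrable P (fun w => \1_(B0 `&` X (M + q)%N @^-1` C0) w * Dprod C' w).
    by apply: Rintegrable_indic => //; apply: measurableI => //; exact: mpre.
  under eq_Rintegral do rewrite E.
  rewrite RintegralZl//; last exact: Rintegrable_sum.
  rewrite Rintegral_sum//.
  have -> : \sum_(i < N.+1) \int[P]_w (\1_(B0 `&` X (M + i)%N @^-1` C0) w * Dprod C' w) =
      \sum_(i < N.+1) c.
    apply: eq_bigr => q _.
    have mBX : measurable (B0 `&` X (M + q)%N @^-1` C0).
      by apply: measurableI => //; exact: mpre.
    by rewrite (Rintegral_indic _ _ mBX) each.
  by rewrite sumr_const card_ord -[c *+ _]mulr_natl mulrA mulVf ?mul1r ?pnatr_eq0.
have lim : \int[P]_(w in B0) (empirical X M C0 N w * Dprod C' w) @[N --> \oo] -->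
    \int[P]_(w in B0) (fine (D w C0) * Dprod C' w).
  apply: (Rintegral_dominated mB0 _ _ _ I1).
  - by move=> N; apply: measurable_funM => //; exact: measurable_empirical.
  - by apply: measurable_funM => //; exact: (measurable_fineD D).
  - apply: filterS (cvg_empirical limD M mC0) => w cw.
    by apply: cvgM => //; exact: cvg_cst.
  - by move=> N w; rewrite normrM mulr_ile1// empirical_norm_le1.
have -> : \int[P]_(w in B0) Dprod C w = \int[P]_(w in B0) (fine (D w C0) * Dprod C' w).
  by apply: eq_Rintegral => w _; rewrite /Dprod big_ord_recl.
apply/esym; move: lim; under eq_fun do rewrite const.
by move=> lim; apply: (cvg_unique _ _ lim) => //; exact: cvg_cst.
Qed.

Definition sigma_D_gen : set (set Omega) := \bigcup_(C in @measurable _ A)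
  preimage_set_system setT (fun w => D w C) measurable.
(* [Omega] equipped with the sigma-algebra generated by [D]. *)
Definition sigma_D_type := g_sigma_algebraType sigma_D_gen.

Lemma measurable_to_sigma_D : measurable_fun (setT : set Omega) (fun w => w : sigma_D_type).
Proof. by move=> _ B mB; rewrite setTI; exact: (sigma_D_measurable mB). Qed.

(** Its argument is a point of [sigma_D_type], so that measurability of this kernel means
    measurability with respect to sigma(D). *)
Definition Dtuple n (w : sigma_D_type) : probability (n.-tuple A) R :=
  tuple_prod (fun _ : 'I_n => D w : probability A R).

Lemma Dtuple_rect n (C : 'I_n -> set A) w : (forall l, measurable (C l)) ->
  Dtuple n w (rect C) = (Dprod C w)%:E.
Proof.
move=> mC; rewrite /Dtuple tuple_prodE// /Dprod.
elim/big_rec2 : _ => // l x y _ ->.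
by rewrite EFinM fineK// fin_num_measure.
Qed.

Lemma measurable_Dtuple n (B : set (n.-tuple A)) : measurable B ->
  measurable_fun (setT : set sigma_D_type) (fun w => Dtuple n w B).
Proof.
move: B; apply: (measurable_kernel_gen (@measurable_tupleE _ _ n)); first exact: rects_setI.
move=> _ [C mC ->].
rewrite (_ : (fun _ => _) = EFin \o (fun w : sigma_D_type => Dprod C w)); last first.
  by apply/funext => w; exact: Dtuple_rect.
apply/measurable_EFinP; apply: (@measurable_prod _ sigma_D_type) => l _.
apply: (measurableT_comp (f := fine)) => //.
move=> _ B mB; rewrite setTI; apply: sub_sigma_algebra; exists (C l) => //.
by exists B => //; rewrite setTI.
Qed.

(** [Rintegral_Dprod] settles rectangles and the pi-system argument the rest. Keeping both [G] and
    [S] in the conditioning event serves two purposes: m = 0 gives the law of the sample given [D],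
    and G = [setT] gives conditioning on the first m draws. *)
Lemma Dtuple_mixture G m n (S : set (m.-tuple A)) (B : set (n.-tuple A)) :
  sigma_D D G -> measurable S -> measurable B ->
  P ((G `&` sample m @^-1` S) `&` sample_at (@tail_index m n) @^-1` B) =
  (\int[P]_(w in G `&` sample m @^-1` S) Dtuple n w B)%E.
Proof.
move=> sG mS mB; have mG := sigma_D_measurable sG.
have mGS : measurable (G `&` sample m @^-1` S) by apply: measurableI => //; exact: mpre.
have := @disintegration_gen _ _ _ _ Omega Omega (n.-tuple A) sigma_D_type R P idfun
  (fun w => w : sigma_D_type) (sample_at (@tail_index m n)) (Dtuple n) _ measurable_to_sigma_D
  _ (@measurable_Dtuple n) _ (@measurable_tupleE _ _ n) (@rects_setI _ _ n)
  (G `&` sample m @^-1` S) mGS.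
rewrite preimage_id; apply => //.
  exact: measurable_id.
move=> _ [C mC ->].
under eq_integral do rewrite Dtuple_rect//.
have IZ : Rintegrable P (Dprod C).
  have I1 : Rintegrable P (fun=> 1 : R) by exact: finite_measure_integrable_cst.
  apply: (le_Rintegrable _ _ I1); first exact: measurable_Dprod.
  by move=> w; rewrite normr1 ger0_norm ?Dprod_ge0// Dprod_le1.
rewrite EFin_Rintegral//.
rewrite (@Rintegral_Dprod n C G sG mC m (fun i : 'I_m => i) S m)// fineK; last first.
  rewrite fin_num_measure//; apply: measurableI => //.
  by rewrite -cat_index_event; apply: mpre => //; exact: measurable_cat_set.
rewrite -setIA; congr (P (_ `&` (_ `&` _))); apply/seteqP; split => w /= H l.
  by have := H l; rewrite tnth_mktuple.
by rewrite tnth_mktuple; exact: H.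
Qed.

End mixture.

Lemma normr_funrposneg (T : Type) (R : realType) (f : T -> R) x :
  `|f x| = f^\+ x + f^\- x.
Proof. by rewrite -[RHS]/((f^\+ + f^\-) x) funrposDneg. Qed.

Section iterated.
Context d1 d2 (O : measurableType d1) (T : measurableType d2) (R : realType).
Variables (P : {measure set O -> \bar R}) (m : {measure set T -> \bar R}).
Local Open Scope ereal_scope.

(** Finite iterated integrals of the two parts make the inner integrals finite almost everywhere.
    The parts may then be subtracted outside, which carries identities for nonnegative functions
    over to signed ones. *)
Lemma Rintegral_iterated (f : O -> T -> R) :
  (forall w, measurable_fun setT (f w)) ->
  measurable_fun setT (fun w => \int[m]_y ((f w)^\+ y)%R%:E) ->
  measurable_fun setT (fun w => \int[m]_y ((f w)^\- y)%R%:E) ->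
  \int[P]_w \int[m]_y ((f w)^\+ y)%R%:E < +oo ->
  \int[P]_w \int[m]_y ((f w)^\- y)%R%:E < +oo ->
  [/\ {ae P, forall w, Rintegrable m (f w)},
      Rintegrable P (fun w => \int[m]_y f w y)%R &
      (\int[P]_w \int[m]_y f w y =
       fine (\int[P]_w \int[m]_y ((f w)^\+ y)%:E) -
       fine (\int[P]_w \int[m]_y ((f w)^\- y)%:E))%R].
Proof.
move=> mf; set a := fun w => \int[m]_y ((f w)^\+ y)%R%:E.
set b := fun w => \int[m]_y ((f w)^\- y)%R%:E => ma mb fa fb.
have a0 w : 0 <= a w by apply: integral_ge0 => y _; rewrite lee_fin.
have b0 w : 0 <= b w by apply: integral_ge0 => y _; rewrite lee_fin.
have Ia : P.-integrable setT a.
  by apply/integrableP; split => //; under eq_integral do rewrite gee0_abs//.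
have Ib : P.-integrable setT b.
  by apply/integrableP; split => //; under eq_integral do rewrite gee0_abs//.
have IE w : (\int[m]_y f w y)%R = fine (a w - b w).
  rewrite /Rintegral integralE /a /b; congr (fine (_ - _)).
    by apply: eq_integral => x _; rewrite -/(EFin \o f w) funerpos.
  by apply: eq_integral => x _; rewrite -/(EFin \o f w) funerneg.
have II : Rintegrable P (fun w => (\int[m]_y f w y)%R).
  under [X in Rintegrable _ X]eq_fun do rewrite IE.
  have Iab := integrableD measurableT Ia Ib.
  apply: le_integrable Iab => //.
    apply/measurable_EFinP; apply: measurableT_comp => //; exact: emeasurable_funB.
  move=> w _ /=; rewrite [leRHS]gee0_abs; last by rewrite adde_ge0; [|exact: a0|exact: b0].
  exact: (abse_fine_subr (a0 w) (b0 w)).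
have aea := integrable_ae measurableT Ia.
have aeb := integrable_ae measurableT Ib.
split => //.
  apply: filterS2 aea aeb => w /(_ I) wa /(_ I) wb.
  apply/RintegrableE => //.
  have -> : \int[m]_y `|f w y|%:E = a w + b w.
    rewrite /a /b -ge0_integralD//.
    - by apply: eq_integral => y _; rewrite -EFinD normr_funrposneg.
    - by move=> y _; rewrite lee_fin.
    - by apply/measurable_EFinP; exact: measurable_funrpos.
    - by move=> y _; rewrite lee_fin.
    - by apply/measurable_EFinP; exact: measurable_funrneg.
  by rewrite ltey_eq fin_numD wa wb.
rewrite -fineB; [|exact: integrable_fin_num|exact: integrable_fin_num].
rewrite -integralB// /Rintegral; congr fine.
apply: ae_eq_integral => //.
- by case/integrableP : II.
- exact: emeasurable_funB.
- apply: filterS2 aea aeb => w fa' fb' _ /=.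
  by rewrite -/(Rintegral _ _ _) IE fineK// fin_numB fa'// fb'.
Qed.

Lemma ae_eq_Rintegral (f g : O -> R) : measurable_fun setT f -> measurable_fun setT g ->
  {ae P, forall w, f w = g w} -> (\int[P]_w f w = \int[P]_w g w)%R.
Proof.
move=> mf mg fg; rewrite /Rintegral; congr fine.
apply: ae_eq_integral => //; [exact/measurable_EFinP|exact/measurable_EFinP|].
by apply: filterS fg => w -> .
Qed.

Lemma RintegrableP_fin (f : O -> R) : Rintegrable P f ->
  \int[P]_w (f^\+ w)%R%:E < +oo /\ \int[P]_w (f^\- w)%R%:E < +oo.
Proof.
move=> If; split; apply: integrable_lty => //.
  exact: integrable_funrpos.
exact: integrable_funrneg.
Qed.

Lemma RintegralE (f : O -> R) : Rintegrable P f ->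
  (\int[P]_w f w = fine (\int[P]_w (f^\+ w)%:E) - fine (\int[P]_w (f^\- w)%:E))%R.
Proof.
move=> If; rewrite -RintegralB//.
- by apply: eq_Rintegral => w _; rewrite [LHS](funrposnegE f).
- exact: integrable_funrpos.
- exact: integrable_funrneg.
Qed.

End iterated.

(** * Exchangeability, random integrals as conditional expectations, signed predictive rule *)

Section exchangeability.
Context d dA (Omega : measurableType d) (A : measurableType dA) (R : realType).
Variables (P : probability Omega R) (X : nat -> {RV P >-> A}).
Variable alpha : {finite_measure set A -> \bar R}.
Hypothesis polyaX : polya_sequence X alpha.
Variable D : {RV P >-> pprobability A R}.
Hypothesis limD : empirical_limit D X.

Local Notation sample := (sample X).
Local Notation sample_at := (sample_at X).
Local Notation tail m n := (sample_at (@tail_index m n)).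
Local Notation OD := (sigma_D_type D).
Local Notation Dtuple n := (@Dtuple _ _ Omega A R P D n).

Lemma sigma_DT : sigma_D D setT.
Proof. exact: (@measurableT _ OD). Qed.

Lemma Dtuple_mixture_sample G n (B : set (n.-tuple A)) :
  sigma_D D G -> measurable B ->
  P (G `&` sample n @^-1` B) = (\int[P]_(w in G) Dtuple n w B)%E.
Proof.
move=> sG mB; have := Dtuple_mixture polyaX limD (m := 0) sG measurableT mB.
by rewrite preimage_setT setIT.
Qed.

Lemma Dtuple_mixture_tail m n (S : set (m.-tuple A)) (B : set (n.-tuple A)) :
  measurable S -> measurable B ->
  P (sample m @^-1` S `&` tail m n @^-1` B) =
  (\int[P]_(w in sample m @^-1` S) Dtuple n w B)%E.
Proof.
move=> mS mB; have := Dtuple_mixture polyaX limD (m := m) sigma_DT mS mB.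
by rewrite setTI.
Qed.

(** Constraints on the coordinates picked by [f] become constraints on the whole tuple; the
    remaining coordinates are free and contribute the factor D(A) = 1. *)
Definition extend_rect k N (f : 'I_k -> 'I_N) (B : 'I_k -> set A) (i : 'I_N) : set A :=
  if [pick l | f l == i] is Some l then B l else setT.

Lemma extend_rectE k N (f : 'I_k -> 'I_N) B l : injective f -> extend_rect f B (f l) = B l.
Proof.
move=> injf; rewrite /extend_rect; case: pickP => [l' /eqP/injf ->//|/(_ l)].
by rewrite eqxx.
Qed.

Lemma measurable_extend_rect k N (f : 'I_k -> 'I_N) B i :
  (forall l, measurable (B l)) -> measurable (extend_rect f B i).
Proof. by move=> mB; rewrite /extend_rect; case: pickP. Qed.

Lemma subtuple_rect k N (f : 'I_k -> 'I_N) B : injective f ->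
  subtuple f @^-1` rect B = rect (extend_rect f B).
Proof.
move=> injf; apply/seteqP; split => x /= H i.
  rewrite /extend_rect; case: pickP => [l /eqP <-|//].
  by have := H l; rewrite tnth_mktuple.
by rewrite tnth_mktuple -(extend_rectE B i injf); exact: H.
Qed.

Lemma Dprod_extend_rect k N (f : 'I_k -> 'I_N) (B : 'I_k -> set A) w : injective f ->
  Dprod D (extend_rect f B) w = Dprod D B w.
Proof.
move=> injf; rewrite /Dprod (bigID (fun i => i \in codom f)) /= [X in _ * X]big1; last first.
  move=> i; rewrite /extend_rect; case: pickP => [l /eqP <-|_ _]; first by rewrite codom_f.
  by rewrite probability_setT.
have uc : uniq (codom f) by rewrite map_inj_uniq ?enum_uniq.
rewrite mulr1 -big_uniq//= big_image /=.
by apply: eq_bigr => l _; rewrite extend_rectE.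
Qed.

Lemma Dtuple_subtuple k N (f : 'I_k -> 'I_N) w (S : set (k.-tuple A)) : injective f ->
  measurable S -> Dtuple N w (subtuple f @^-1` S) = Dtuple k w S.
Proof.
move=> injf mS.
have mf := @measurable_subtuple _ A _ _ f.
pose m1 : {measure set _ -> \bar R} := pushforward (Dtuple N w) (subtuple f).
apply: (@tuple_measure_unique _ _ _ _ (m1 mf) (Dtuple k w)) => //.
  by rewrite -[X in (X < _)%E]/(Dtuple N w setT) probability_setT ltry.
move=> B mB; rewrite -[LHS]/(Dtuple N w (subtuple f @^-1` rect B)) subtuple_rect//.
have mE i : measurable (extend_rect f B i) by exact: measurable_extend_rect.
rewrite (Dtuple_rect w mE) Dprod_extend_rect//.
exact: esym (Dtuple_rect w mB).
Qed.

(** Given sigma(D) the first N draws have law D^N, and the marginal of D^N along any injection is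
    D^k. The order of the indices is thus irrelevant, even jointly with events of [D]. *)
Lemma exchangeable_sigma_D G k (j : 'I_k -> nat) (S : set (k.-tuple A)) :
  sigma_D D G -> injective j -> measurable S ->
  P (G `&` sample_at j @^-1` S) = P (G `&` sample k @^-1` S).
Proof.
move=> sG injj mS.
pose N := (\max_(i < k) (j i).+1)%N.
have jN i : (j i < N)%N by exact: (leq_bigmax i).
pose f i := Ordinal (jN i).
have injf : injective f by move=> x y /(congr1 val) /= /injj.
have -> : sample_at j @^-1` S = sample N @^-1` (subtuple f @^-1` S).
  by apply/seteqP; split => w /=; rewrite (@subtuple_sample_at _ _ _ _ _ _ X _ _ f (fun i => i)).
rewrite !Dtuple_mixture_sample//; last exact: measurable_subtuple_preimage.
by apply: eq_integral => w _; rewrite Dtuple_subtuple.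
Qed.

Lemma exchangeable k (j : 'I_k -> nat) (S : set (k.-tuple A)) : injective j ->
  measurable S -> P (sample_at j @^-1` S) = P (sample k @^-1` S).
Proof.
by move=> injj mS; have := exchangeable_sigma_D sigma_DT injj mS; rewrite !setTI.
Qed.

Lemma ge0_exchangeable_integral k (j : 'I_k -> nat) (f : k.-tuple A -> \bar R) :
  injective j -> measurable_fun setT f -> (forall x, 0 <= f x)%E ->
  (\int[P]_w f (sample_at j w) = \int[P]_w f (sample k w))%E.
Proof.
move=> injj mf f0.
rewrite -(ge0_integral_distribution (sample_at j))// -(ge0_integral_distribution (sample k))//.
by apply: eq_measure_integral => S mS _; exact: exchangeable.
Qed.

Lemma exchangeable_Rintegrable k (j : 'I_k -> nat) (f : k.-tuple A -> R) :
  injective j -> measurable_fun setT f ->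
  Rintegrable P (fun w => f (sample k w)) -> Rintegrable P (fun w => f (sample_at j w)).
Proof.
move=> injj mf /RintegrableE If; apply/RintegrableE.
  exact: measurableT_comp.
rewrite (ge0_exchangeable_integral injj (f := fun x => `|f x|%:E))//.
  by apply: If; exact: measurableT_comp.
by apply/measurable_EFinP; exact: measurableT_comp.
Qed.

Lemma exchangeable_Rintegral k (j : 'I_k -> nat) (f : k.-tuple A -> R) :
  injective j -> measurable_fun setT f ->
  Rintegrable P (fun w => f (sample k w)) ->
  \int[P]_w f (sample_at j w) = \int[P]_w f (sample k w).
Proof.
move=> injj mf If; have If' := exchangeable_Rintegrable injj mf If.
have E (j' : 'I_k -> nat) : Rintegrable P (fun w => f (sample_at j' w)) ->
    \int[P]_w f (sample_at j' w) = fine (\int[distribution P (sample_at j')]_x (f x)%:E)%E.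
  move=> If''; rewrite integral_distribution//; exact/measurable_EFinP.
rewrite E// [RHS](E (fun i => i))//; congr fine.
apply: eq_measure_integral => S mS _; exact: exchangeable.
Qed.

Lemma measurable_D_integral n (h : n.-tuple A -> R) : measurable_fun setT h ->
  measurable_fun (setT : set OD) (D_integral D h).
Proof.
by move=> mh; exact: (measurable_kernel_Rintegral (@measurable_Dtuple _ _ _ _ _ _ D n) mh).
Qed.

Lemma D_integral_sigma_D n (h : n.-tuple A -> R) : measurable_fun setT h ->
  Rintegrable P (fun w => h (sample n w)) ->
  Rintegrable P (D_integral D h) /\
  forall G, sigma_D D G ->
    \int[P]_(w in G) h (sample n w) = \int[P]_(w in G) D_integral D h w.
Proof.
move=> mh Ih.
have := @Rintegral_disintegration _ _ _ _ Omega OD (n.-tuple A) OD R P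
  (fun w => w) (fun w => w) (sample n) (Dtuple n) (@measurable_to_sigma_D _ _ _ _ _ _ D)
  (@measurable_to_sigma_D _ _ _ _ _ _ D) _ (@measurable_Dtuple _ _ _ _ _ _ D n) _ h mh Ih.
case=> //.
by move=> G sG B mB; exact: Dtuple_mixture_sample.
Qed.

(** Trades the random integral for a statistic of fresh draws, on which the predictive rule can
    act. *)
Lemma D_integral_tail m n (h : n.-tuple A -> R) : measurable_fun setT h ->
  Rintegrable P (fun w => h (sample n w)) -> forall S, measurable S ->
  \int[P]_(w in sample m @^-1` S) h (tail m n w) =
  \int[P]_(w in sample m @^-1` S) D_integral D h w.
Proof.
move=> mh Ih.
have It : Rintegrable P (fun w => h (tail m n w)).
  apply: exchangeable_Rintegrable => // x y /eqP; rewrite eqn_add2l => /eqP; exact: val_inj.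
have := @Rintegral_disintegration _ _ _ _ Omega (m.-tuple A) (n.-tuple A) OD R P
  (sample m) (fun w => w) (tail m n) (Dtuple n) _
  (@measurable_to_sigma_D _ _ _ _ _ _ D) _ (@measurable_Dtuple _ _ _ _ _ _ D n) _ h mh It.
case=> //.
by move=> S mS B mB; exact: Dtuple_mixture_tail.
Qed.

Lemma sqr_D_integral n (h : n.-tuple A -> R) : measurable_fun setT h ->
  (\int[P]_w ((D_integral D h w) ^+ 2)%:E <= \int[P]_w ((h (sample n w)) ^+ 2)%:E)%E.
Proof.
move=> mh.
apply: (@sqr_Rintegral_disintegration _ _ _ _ Omega OD (n.-tuple A) OD R P
  (fun w => w) (fun w => w) (sample n) (Dtuple n) (@measurable_to_sigma_D _ _ _ _ _ _ D)
  (@measurable_to_sigma_D _ _ _ _ _ _ D) _ (@measurable_Dtuple _ _ _ _ _ _ D n) _ h mh) => //.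
by move=> G sG B mB; exact: Dtuple_mixture_sample.
Qed.

Hypothesis alpha_gt0 : (0 < alpha setT)%E.
Local Notation a := (fine (alpha setT)).

(** Applied to the two parts of [f], the nonnegative rule has a finite left side, so every
    nonnegative term on the right is finite too. The inner integral over [alpha] exists only for
    almost every past, hence the first conclusion. *)
Lemma Rpredictive k (f : k.+1.-tuple A -> R) : measurable_fun setT f ->
  Rintegrable P (fun w => f (sample k.+1 w)) ->
  [/\ {ae P, forall w, Rintegrable alpha (fun y => f [tuple of rcons (sample k w) y])},
      Rintegrable P (fun w => \int[alpha]_y f [tuple of rcons (sample k w) y]),
      forall i, (i < k)%N -> Rintegrable P (fun w => f (sample_rcons X k i w)) &
      (a + k%:R) * \int[P]_w f (sample k.+1 w) =
      \int[P]_w \int[alpha]_y f [tuple of rcons (sample k w) y] +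
      \sum_(i < k) \int[P]_w f (sample_rcons X k i w)].
Proof.
move=> mf If.
have mfp : measurable_fun setT (fun x => (f^\+ x)%:E).
  by apply/measurable_EFinP; exact: measurable_funrpos.
have mfn : measurable_fun setT (fun x => (f^\- x)%:E).
  by apply/measurable_EFinP; exact: measurable_funrneg.
have mr (w : Omega) :
    measurable_fun setT (fun y => [tuple of rcons (sample k w) y] : k.+1.-tuple A).
  rewrite -[X in measurable_fun _ X]/((fun p : k.-tuple A * A => [tuple of rcons p.1 p.2]) \o
    pair (sample k w)).
  by apply: measurableT_comp; [exact: measurable_rcons|exact: measurable_pair1].
have mint (g : k.+1.-tuple A -> \bar R) : measurable_fun setT g -> (forall x, 0 <= g x)%E ->
    measurable_fun setT (fun w => \int[alpha]_y g [tuple of rcons (sample k w) y])%E.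
  move=> mg g0.
  have mg2 : measurable_fun setT (g \o (fun p : k.-tuple A * A => [tuple of rcons p.1 p.2])).
    by apply: measurableT_comp => //; exact: measurable_rcons.
  have := @measurable_fun_fubini_tonelli_F _ _ _ _ R alpha _ mg2 (fun p => g0 _).
  by move=> H; exact: (measurableT_comp H (measurable_funPT (sample k))).
have Ep := ge0_predictive polyaX alpha_gt0 mfp (fun x => funrpos_ge0 f x).
have En := ge0_predictive polyaX alpha_gt0 mfn (fun x => funrneg_ge0 f x).
have [Ip In] := RintegrableP_fin If.
have fin (g : k.+1.-tuple A -> \bar R) : (forall x, 0 <= g x)%E ->
   (\int[P]_w g (sample k.+1 w) < +oo)%E ->
   ((a + k%:R)%:E * \int[P]_w g (sample k.+1 w) =
    \int[P]_w \int[alpha]_y g [tuple of rcons (sample k w) y] +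
      \sum_(i < k) \int[P]_w g (sample_rcons X k i w) ->
    \int[P]_w \int[alpha]_y g [tuple of rcons (sample k w) y] < +oo /\
    forall i, (i < k)%N -> \int[P]_w g (sample_rcons X k i w) < +oo)%E.
  move=> g0 gfin E.
  have S0 (i : 'I_k) : (0 <= \int[P]_w g (sample_rcons X k i w))%E.
    by apply: integral_ge0.
  have T0 : (0 <= \int[P]_w \int[alpha]_y g [tuple of rcons (sample k w) y])%E.
    by apply: integral_ge0 => w _; apply: integral_ge0.
  have L : (\int[P]_w \int[alpha]_y g [tuple of rcons (sample k w) y] +
      \sum_(i < k) \int[P]_w g (sample_rcons X k i w) < +oo)%E.
    by rewrite -E; apply: lte_mul_pinfty => //; rewrite lee_fin ltW// polya_den_gt0.
  split; first by apply: le_lt_trans L; rewrite leeDl// sume_ge0.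
  move=> i ik; apply: le_lt_trans L.
  rewrite (bigD1 (Ordinal ik))//= addeCA leeDl// adde_ge0// sume_ge0//.
have [Tp Sp] := fin (fun x => (f^\+ x)%:E) (fun x => funrpos_ge0 f x) Ip Ep.
have [Tn Sn] := fin (fun x => (f^\- x)%:E) (fun x => funrneg_ge0 f x) In En.
have Ii i : (i < k)%N -> Rintegrable P (fun w => f (sample_rcons X k i w)).
  move=> ik; have mfi : measurable_fun setT (fun w => f (sample_rcons X k i w)).
    exact: measurableT_comp.
  apply/RintegrableE => //.
  have -> : (\int[P]_w `|f (sample_rcons X k i w)|%:E =
     \int[P]_w ((f^\+ (sample_rcons X k i w))%:E + (f^\- (sample_rcons X k i w))%:E))%E.
    by apply: eq_integral => w _; rewrite -EFinD normr_funrposneg.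
  rewrite ge0_integralD//; first by rewrite lte_add_pinfty// ?Sp ?Sn.
  - by move=> w _; rewrite lee_fin.
  - exact: (measurableT_comp mfp (measurable_funPT (sample_rcons X k i))).
  - by move=> w _; rewrite lee_fin.
  - exact: (measurableT_comp mfn (measurable_funPT (sample_rcons X k i))).
have := @Rintegral_iterated _ _ Omega A R P alpha
  (fun w y => f [tuple of rcons (sample k w) y]) _ _ _ Tp Tn.
case.
- by move=> w; exact: (measurableT_comp mf (mr w)).
- exact: (mint (fun x => (f^\+ x)%:E) mfp (fun x => funrpos_ge0 f x)).
- exact: (mint (fun x => (f^\- x)%:E) mfn (fun x => funrneg_ge0 f x)).
move=> H1 H2 H3; split => //.
rewrite H3 (RintegralE If) mulrBr.
have Si (i : 'I_k) : \int[P]_w f (sample_rcons X k i w) =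
    fine (\int[P]_w (f^\+ (sample_rcons X k i w))%:E) -
    fine (\int[P]_w (f^\- (sample_rcons X k i w))%:E).
  by rewrite (RintegralE (Ii i (ltn_ord i))).
under eq_bigr do rewrite Si.
have conv (g : k.+1.-tuple A -> \bar R) : (forall x, 0 <= g x)%E ->
   (\int[P]_w g (sample k.+1 w) < +oo)%E ->
   (\int[P]_w \int[alpha]_y g [tuple of rcons (sample k w) y] < +oo)%E ->
   (forall i, (i < k)%N -> \int[P]_w g (sample_rcons X k i w) < +oo)%E ->
   ((a + k%:R)%:E * \int[P]_w g (sample k.+1 w) =
    \int[P]_w \int[alpha]_y g [tuple of rcons (sample k w) y] +
      \sum_(i < k) \int[P]_w g (sample_rcons X k i w))%E ->
   (a + k%:R) * fine (\int[P]_w g (sample k.+1 w)) =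
   fine (\int[P]_w \int[alpha]_y g [tuple of rcons (sample k w) y]) +
      \sum_(i < k) fine (\int[P]_w g (sample_rcons X k i w)).
  move=> g0 f1 f2 f3 E.
  have F1 : (\int[P]_w g (sample k.+1 w))%E \is a fin_num.
    by rewrite ge0_fin_numE// integral_ge0.
  have F2 : (\int[P]_w \int[alpha]_y g [tuple of rcons (sample k w) y])%E \is a fin_num.
    by rewrite ge0_fin_numE// integral_ge0// => w _; apply: integral_ge0.
  have F3 (i : 'I_k) : (\int[P]_w g (sample_rcons X k i w))%E \is a fin_num.
    by rewrite ge0_fin_numE ?f3// integral_ge0.
  apply: EFin_inj; rewrite EFinM [RHS]EFinD -sumEFin !fineK// E; congr (_ + _)%E.
  by apply: eq_bigr => i _; rewrite fineK.
have Cp := conv (fun x => (f^\+ x)%:E) (fun x => funrpos_ge0 f x) Ip Tp Sp Ep.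
have Cn := conv (fun x => (f^\- x)%:E) (fun x => funrneg_ge0 f x) In Tn Sn En.
rewrite -[X in _ * X - _]/(fine (\int[P]_w (f^\+ (sample k.+1 w))%:E)%E).
rewrite -[X in _ - _ * X]/(fine (\int[P]_w (f^\- (sample k.+1 w))%:E)%E).
rewrite Cp Cn sumrB; ring.
Qed.

End exchangeability.

Lemma ae_distribution_eq0 d1 d2 (O : measurableType d1) (T : measurableType d2)
    (R : realType) (P : probability O R) (Y : {mfun O >-> T}) (g : T -> R) :
  measurable_fun setT g -> Rintegrable P (fun w => g (Y w)) ->
  (forall S, measurable S -> \int[P]_(w in Y @^-1` S) g (Y w) = 0) ->
  {ae distribution P Y, forall x, g x = 0}.
Proof.
move=> mg Ig H.
have mpre S : measurable S -> measurable (Y @^-1` S).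
  by move=> mS; rewrite -[X in measurable X]setTI; exact: measurable_funPT.
have I0 : (distribution P Y).-integrable setT (cst 0%E) by exact: integrable0.
suff H' : ae_eq (distribution P Y) setT (cst 0%E) (EFin \o g).
  by apply: filterS H' => x /(_ I) [<-].
apply: integral_ae_eq => //; first exact/measurable_EFinP.
move=> S _ mS; rewrite integral0 /distribution integral_pushforward//.
- by apply/esym; rewrite EFin_Rintegral ?H//; exact: mpre.
- exact/measurable_EFinP.
- by apply: Rintegrable_on => //; exact: mpre.
Qed.

Section fubini_Rintegral.
Context d1 d2 (T1 : measurableType d1) (T2 : measurableType d2) (R : realType).
Variable m : {finite_measure set T2 -> \bar R}.

Lemma measurable_fun_Rintegral (f : T1 * T2 -> R) : measurable_fun setT f ->
  measurable_fun setT (fun x => \int[m]_y f (x, y)).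
Proof.
move=> mf; apply: (measurableT_comp (f := fine)) => //.
under eq_fun do rewrite integralE.
apply: emeasurable_funB.
  have mfp : measurable_fun setT (fun p => (f^\+ p)%:E).
    by apply/measurable_EFinP; exact: measurable_funrpos.
  have := @measurable_fun_fubini_tonelli_F _ _ _ _ R m _ mfp
    (fun p => funrpos_ge0 f p).
  rewrite /fubini_F; congr (measurable_fun _ _); apply/funext => x.
  by apply: eq_integral => y _; rewrite -/(EFin \o (fun y => f (x, y))) funerpos.
have mfn : measurable_fun setT (fun p => (f^\- p)%:E).
  by apply/measurable_EFinP; exact: measurable_funrneg.
have := @measurable_fun_fubini_tonelli_F _ _ _ _ R m _ mfn
  (fun p => funrneg_ge0 f p).
rewrite /fubini_F; congr (measurable_fun _ _); apply/funext => x.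
by apply: eq_integral => y _; rewrite -/(EFin \o (fun y => f (x, y))) funerneg.
Qed.

End fubini_Rintegral.

(** * Degenerate kernels under the predictive rule *)

Section degenerate.
Context d dA (Omega : measurableType d) (A : measurableType dA) (R : realType).
Variables (P : probability Omega R) (X : nat -> {RV P >-> A}).
Variable alpha : {finite_measure set A -> \bar R}.
Hypothesis polyaX : polya_sequence X alpha.
Variable D : {RV P >-> pprobability A R}.
Hypothesis limD : empirical_limit D X.
Hypothesis alpha_gt0 : (0 < alpha setT)%E.

Local Notation a := (fine (alpha setT)).
Local Notation sample := (sample X).
Local Notation sample_at := (sample_at X).
Local Notation snoc x y := [tuple of rcons x y].

Let mpre d' (T' : measurableType d') (F : Omega -> T') B :
  measurable_fun setT F -> measurable B -> measurable (F @^-1` B).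
Proof. by move=> mF mB; rewrite -[X in measurable X]setTI; exact: mF. Qed.

Lemma tnth_snoc_lt (T : Type) k (x : k.-tuple T) y (i : 'I_k.+1) (ik : (i < k)%N) :
  tnth (snoc x y) i = tnth x (Ordinal ik).
Proof. by rewrite !(tnth_nth y) /= nth_rcons size_tuple ik. Qed.

Lemma tnth_snoc_max (T : Type) k (x : k.-tuple T) y (i : 'I_k.+1) :
  (k <= i)%N -> tnth (snoc x y) i = y.
Proof.
move=> ki; rewrite (tnth_nth y) /= nth_rcons size_tuple ltnNge ki /=.
by rewrite eqn_leq ki -ltnS ltn_ord.
Qed.

Lemma snoc_sample_at k (j : 'I_k -> nat) i w :
  snoc (sample_at j w) (X i w) =
  sample_at (fun l : 'I_k.+1 => if insub (val l) is Some l' then j l' else i) w.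
Proof.
apply: eq_from_tnth => l; rewrite [RHS]tnth_mktuple.
case: insubP => [l' lk ll'|].
  rewrite tnth_snoc_lt tnth_mktuple; congr (X (j _) w); exact: val_inj.
by rewrite -leqNgt => kl; rewrite tnth_snoc_max.
Qed.

Variables (p : nat) (h : p.+1.-tuple A -> R).
Hypotheses (mh : measurable_fun setT h)
  (Ih : Rintegrable P (fun w => h (sample p.+1 w)))
  (h0 : forall S, measurable S -> \int[P]_(w in sample p @^-1` S) h (sample p.+1 w) = 0).

Let mh2 : measurable_fun setT (fun z : p.-tuple A * A => h (snoc z.1 z.2)).
Proof. by apply: measurableT_comp => //; exact: measurable_rcons. Qed.

(** By the predictive rule this is alpha(A) + p times the conditional expectation of [h] at
    [sample p.+1] given that [sample p] equals x. *)
Let q (x : p.-tuple A) : R :=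
  \int[alpha]_y h (snoc x y) + \sum_(i < p) h (snoc x (tnth x i)).

Let mdiag (i : 'I_p) : measurable_fun setT (fun x : p.-tuple A => h (snoc x (tnth x i))).
Proof.
rewrite -[X in measurable_fun _ X]/((fun z : p.-tuple A * A => h (snoc z.1 z.2)) \o
  (fun x : p.-tuple A => (x, tnth x i))).
apply: measurableT_comp mh2 _; apply: measurable_fun_pair => //; exact: measurable_tnth.
Qed.

Let mq : measurable_fun setT q.
Proof.
apply: measurable_funD; first exact: (measurable_fun_Rintegral alpha mh2).
by apply: measurable_sum => i; exact: mdiag.
Qed.

Let sample_diag (i : 'I_p) w :
  sample_rcons X p i w = snoc (sample p w) (tnth (sample p w) i).
Proof. by rewrite /sample_rcons tnth_mktuple. Qed.

Let q_sample : {ae distribution P (sample p), forall x, q x = 0}.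
Proof.
have [_ II Ii E] := Rpredictive polyaX alpha_gt0 mh Ih.
have Iq : Rintegrable P (fun w => q (sample p w)).
  apply: RintegrableD => //; apply: Rintegrable_sum => i _.
  have := Ii i (ltn_ord i); congr Rintegrable.
  by apply/funext => w; rewrite sample_diag.
apply: ae_distribution_eq0 => // S mS.
(* The predictive rule applied to [h] times an event of the first p draws yields the integral of [q]
   over that event. *)
pose f (z : p.+1.-tuple A) := \1_S (subtuple (widen_ord (leqnSn p)) z) * h z.
have mw := @measurable_subtuple _ A _ _ (widen_ord (leqnSn p)).
have mf : measurable_fun setT f.
  by apply: measurable_funM => //; exact: measurableT_comp.
have fs (x : p.-tuple A) y : f (snoc x y) = \1_S x * h (snoc x y).
  rewrite /f; congr (\1_S _ * _); apply: eq_from_tnth => i.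
  rewrite tnth_mktuple (@tnth_snoc_lt _ _ x y (widen_ord (leqnSn p) i) (ltn_ord i)).
  by congr (tnth x _); exact: val_inj.
have ws w : subtuple (widen_ord (leqnSn p)) (sample p.+1 w) = sample p w.
  exact: (@subtuple_sample_at _ _ _ _ _ _ X _ _ _ (fun i => i)).
have If : Rintegrable P (fun w => f (sample p.+1 w)).
  apply: (@RintegrableMb _ _ _ _ 1) => //.
    have mS1 : measurable_fun setT (\1_S \o subtuple (widen_ord (leqnSn p)) : _ -> R).
      exact: measurableT_comp.
    exact: (measurableT_comp mS1 (measurable_funPT (sample p.+1))).
  by move=> w; rewrite indicE; case: (_ \in _); rewrite ?normr1 ?normr0.
have [_ II' Ii' E'] := Rpredictive polyaX alpha_gt0 mf If.
have F0 : \int[P]_w f (sample p.+1 w) = 0.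
  rewrite -(h0 mS) -[RHS]Rintegral_indic; last exact: mpre.
  by apply: eq_Rintegral => w _; rewrite /f ws.
rewrite F0 mulr0 in E'; rewrite [RHS]E' -Rintegral_sum; last by move=> i _; exact: Ii'.
rewrite -RintegralD//; last by apply: Rintegrable_sum => i _; exact: Ii'.
rewrite -Rintegral_indic; last exact: mpre.
apply: eq_Rintegral => w _; rewrite /q mulrDr; congr (_ + _).
  under [RHS]eq_Rintegral do rewrite fs.
  rewrite -[\1_(sample p @^-1` S) w]/(\1_S (sample p w)) indicE.
  case: (_ \in _) => /=; first by rewrite mul1r; apply: eq_Rintegral => y _; rewrite mul1r.
  rewrite mul0r (@eq_Rintegral _ _ _ _ _ (fun=> 0)); last by move=> y _; rewrite mul0r.
  by rewrite Rintegral_cst// mul0r.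
rewrite mulr_sumr; apply: eq_bigr => i _.
by rewrite sample_diag fs.
Qed.

(** [q] vanishes almost everywhere for the law of [sample p], and exchangeability carries null sets
    to any p distinct draws. The set [Q] of pasts at which [h] is not integrable against [alpha]
    joins the exceptional set. *)
Lemma degenerate_ae (v : 'I_p -> nat) : injective v ->
  {ae P, forall w, Rintegrable alpha (fun y => h (snoc (sample_at v w) y)) /\
    \int[alpha]_y h (snoc (sample_at v w) y) =
    - \sum_(i < p) h (snoc (sample_at v w) (X (v i) w))}.
Proof.
move=> injv.
have [Iae _ _ _] := Rpredictive polyaX alpha_gt0 mh Ih.
pose g (x : p.-tuple A) := (\int[alpha]_y `|h (snoc x y)|%:E)%E.
have mg : measurable_fun setT g.
  have mh3 : measurable_fun setT (fun z : p.-tuple A * A => `|h (snoc z.1 z.2)|%:E).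
    by apply/measurable_EFinP; exact: measurableT_comp.
  exact: (@measurable_fun_fubini_tonelli_F _ _ _ _ R alpha _ mh3).
have mhx (x : p.-tuple A) : measurable_fun setT (fun y => h (snoc x y)).
  rewrite -[X in measurable_fun _ X]/((fun z : p.-tuple A * A => h (snoc z.1 z.2)) \o pair x).
  by apply: measurableT_comp => //; exact: measurable_pair1.
pose Q := g @^-1` [set +oo%E].
have mQ : measurable Q by rewrite -[X in measurable X]setTI; exact: mg.
have [N1 [mN1 N10 sN1]] := q_sample.
have PQ : P (sample p @^-1` Q) = 0%E.
  have [N2 [mN2 N20 sN2]] := Iae.
  apply/eqP; rewrite -measure_le0 -[leRHS]N20 le_measure ?inE//; first exact: mpre.
  move=> w Qw; apply: sN2 => /(RintegrableE _ (mhx _)).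
  by rewrite -/(g (sample p w)) Qw.
exists (sample_at v @^-1` (N1 `|` Q)); split.
- by apply: mpre => //; exact: measurableU.
- rewrite (exchangeable polyaX limD injv); last exact: measurableU.
  apply/eqP; rewrite -measure_le0 preimage_setU.
  rewrite (le_trans (measureU2 _ _ _))//; try exact: mpre.
  by rewrite -[X in (X + _ <= _)%E]/(distribution P (sample p) N1) N10 add0e -[X in (_ <= X)%E]PQ.
move=> w /= Hw; apply: contrapT => /not_orP[H1 H2]; apply: Hw; split.
  apply/(RintegrableE _ (mhx _)); rewrite ltey; apply/eqP => gw; exact: H2.
have q0 : q (sample_at v w) = 0 by apply: contrapT => q0; apply: H1; exact: sN1.
apply/eqP; rewrite -addr_eq0 -[X in _ == X]q0 /q; apply/eqP; congr (_ + _).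
by apply: eq_bigr => i _; rewrite tnth_mktuple.
Qed.

(* The new draw is a fresh colour, one of the arguments [v], or another observed
   index; degeneracy kills the first two contributions together, because they make
   up the conditional law of the last argument of [h] given the arguments [v]. *)
Lemma cancellation N (v : 'I_p -> 'I_N) (Th : N.-tuple A -> R) M : injective v ->
  measurable_fun setT Th -> (forall x, `|Th x| <= M) ->
  (a + N%:R) * \int[P]_w (Th (sample N w) * h (snoc (sample_at (fun l => v l) w) (X N w))) =
  \sum_(i < N | i \notin codom v)
    \int[P]_w (Th (sample N w) * h (snoc (sample_at (fun l => v l) w) (X i w))).
Proof.
move=> injv mTh ThM.
pose wd := widen_ord (leqnSn N).
pose f (z : N.+1.-tuple A) : R :=
  Th (subtuple wd z) * h (snoc (subtuple v (subtuple wd z)) (tnth z ord_max)).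
have mwd := @measurable_subtuple _ A _ _ wd.
have mTw : measurable_fun setT (fun z => Th (subtuple wd z)) by exact: measurableT_comp.
have mhw : measurable_fun setT (fun z : N.+1.-tuple A =>
    h (snoc (subtuple v (subtuple wd z)) (tnth z ord_max))).
  rewrite -[X in measurable_fun _ X]/((fun z : p.-tuple A * A => h (snoc z.1 z.2)) \o
    (fun z : N.+1.-tuple A => (subtuple v (subtuple wd z), tnth z ord_max))).
  apply: measurableT_comp => //; apply: measurable_fun_pair => //.
    by apply: measurableT_comp => //; exact: measurable_subtuple.
  exact: measurable_tnth.
have mf : measurable_fun setT f by exact: measurable_funM.
have vinj : injective (fun l => v l : nat) by move=> x y /val_inj/injv.
have subv w : subtuple v (sample N w) = sample_at (fun l => v l) w.
  exact: (@subtuple_sample_at _ _ _ _ _ _ X _ _ _ (fun i => i)).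
have fs w y : f (snoc (sample N w) y) =
    Th (sample N w) * h (snoc (sample_at (fun l => v l) w) y).
  have -> : f (snoc (sample N w) y) = Th (sample N w) * h (snoc (subtuple v (sample N w)) y).
    have E : subtuple wd (snoc (sample N w) y) = sample N w.
      apply: eq_from_tnth => i.
      rewrite tnth_mktuple (@tnth_snoc_lt _ _ (sample N w) y (wd i) (ltn_ord i)).
      by congr (tnth (sample N w) _); exact: val_inj.
    by rewrite /f E tnth_snoc_max.
  by rewrite subv.
have fsi w i : f (sample_rcons X N i w) =
    Th (sample N w) * h (snoc (sample_at (fun l => v l) w) (X i w)).
  exact: fs.
have sN w : sample N.+1 w = sample_rcons X N N w.
  rewrite sample_rconsE; congr (sample_at _ w); apply/funext => l.
  by case: ltnP => // Nl; apply/eqP; rewrite eqn_leq Nl -ltnS ltn_ord.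
have If : Rintegrable P (fun w => f (sample N.+1 w)).
  under [X in Rintegrable _ X]eq_fun do rewrite sN fsi.
  apply: (@RintegrableMb _ _ _ _ M) => //.
    exact: (measurableT_comp mTh (measurable_funPT (sample N))).
  under [X in Rintegrable _ X]eq_fun do rewrite snoc_sample_at.
  (* The new index N lies outside the range of [v], so the p + 1 indices remain distinct. *)
  apply: (exchangeable_Rintegrable polyaX limD) => // l l'.
  case: insubP => [x _ xl|]; case: insubP => [y _ yl|] //.
  - by move=> /vinj xy; apply: val_inj; rewrite -xl -yl xy.
  - by move=> _ Nv; have := ltn_ord (v x); rewrite Nv ltnn.
  - by move=> _ vN; have := ltn_ord (v y); rewrite -vN ltnn.
  by rewrite -!leqNgt => pl pl' _; apply/val_inj/eqP; rewrite eqn_leq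
    (leq_trans _ pl) 1?(leq_trans _ pl')// -ltnS ltn_ord.
have [_ II Ii E] := Rpredictive polyaX alpha_gt0 mf If.
have LE : \int[P]_w (Th (sample N w) * h (snoc (sample_at (fun l => v l) w) (X N w))) =
    \int[P]_w f (sample N.+1 w).
  by apply: eq_Rintegral => w _; rewrite sN fsi.
rewrite LE E (bigID (fun i => i \in codom v)) /=.
have uc : uniq (codom v) by rewrite map_inj_uniq ?enum_uniq.
rewrite -[X in _ + (X + _)]big_uniq//= big_image /=.
have -> : \int[P]_w \int[alpha]_y f (snoc (sample N w) y) =
    - \sum_(l < p) \int[P]_w f (sample_rcons X N (v l) w).
  rewrite -Rintegral_sum; last by move=> l _; exact: Ii.
  have IS : Rintegrable P (fun w => \sum_(l < p) f (sample_rcons X N (v l) w)).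
    by apply: Rintegrable_sum => l _; exact: Ii.
  rewrite -mulN1r -RintegralZl//.
  apply: ae_eq_Rintegral; first exact: Rintegrable_measurable II.
    exact: Rintegrable_measurable (RintegrableZ _ IS).
  apply: filterS (degenerate_ae vinj) => w [Iw Ew].
  under eq_Rintegral do rewrite fs.
  rewrite RintegralZl// Ew mulN1r mulrN; congr (- _).
  by rewrite mulr_sumr; apply: eq_bigr => l _; rewrite fsi.
rewrite addrA addNr add0r; apply: eq_bigr => i _.
by apply: eq_Rintegral => w _; rewrite fsi.
Qed.

End degenerate.

(** * The constant relating disjoint and shared arguments *)

Section key_identity.
Context d dA (Omega : measurableType d) (A : measurableType dA) (R : realType).
Variables (P : probability Omega R) (X : nat -> {RV P >-> A}).
Variable alpha : {finite_measure set A -> \bar R}.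
Hypothesis polyaX : polya_sequence X alpha.
Variable D : {RV P >-> pprobability A R}.
Hypothesis limD : empirical_limit D X.
Hypothesis alpha_gt0 : (0 < alpha setT)%E.

Local Notation a := (fine (alpha setT)).
Local Notation sample := (sample X).
Local Notation sample_at := (sample_at X).
Local Notation tail m n := (sample_at (@tail_index m n)).
Local Notation snoc x y := [tuple of rcons x y].

Variables (p : nat) (h : p.+1.-tuple A -> R).
Local Notation n := p.+1.
Hypotheses (mh : measurable_fun setT h) (symh : symmetric_fun h)
  (Ih : Rintegrable P (fun w => h (sample n w)))
  (h0 : forall S, measurable S -> \int[P]_(w in sample p @^-1` S) h (sample p.+1 w) = 0).

(* The first [k] arguments of [h] are shared with those of [phi], the others are
   fresh observations. *)
Definition mixed_index k (i : nat) : nat := if (i < k)%N then i else (n + (i - k))%N.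

Lemma mixed_index_inj k : (k <= n)%N -> {in gtn n &, injective (mixed_index k)}.
Proof.
move=> kn i j; rewrite !inE /mixed_index => ip jp.
by case: ltnP => ik; case: ltnP => jk; lia.
Qed.

Definition mixed_sample k w : n.-tuple A := sample_at (fun i : 'I_n => mixed_index k i) w.

Variables (phi : n.-tuple A -> R) (M : R).
Hypotheses (mphi : measurable_fun setT phi) (symphi : symmetric_fun phi)
  (phiM : forall x, `|phi x| <= M).

Let Ek k := \int[P]_w (phi (sample n w) * h (mixed_sample k w)).

(** Exchange draws k and i. Both are arguments of the symmetric [phi], and neither is among the
    other arguments of [h], which lie below k or from n on; hence the only effect is to turn [X i]
    into [X k]. *)
Lemma mixed_sample_swap k (i : nat) : (k <= i < n)%N ->
  \int[P]_w (phi (sample n w) *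
    h (sample_at (fun l : 'I_n => if l == k :> nat then i else mixed_index k.+1 l) w)) =
  Ek k.+1.
Proof.
move=> /andP[ki ip]; have kp : (k < n)%N := leq_ltn_trans ki ip.
pose N := (n + n)%N.
have nN : (n <= N)%N by rewrite leq_addr.
have eN (l : 'I_n) : (mixed_index k.+1 l < N)%N.
  by rewrite /mixed_index /N; have ln := ltn_ord l; case: ifP => ?; lia.
pose e l := Ordinal (eN l).
pose wd := widen_ord nN.
pose psi (z : N.-tuple A) : R := phi (subtuple wd z) * h (subtuple e z).
have psi_at (j : 'I_N -> nat) w : psi (sample_at j w) =
    phi (sample_at (fun l => j (wd l)) w) * h (sample_at (fun l => j (e l)) w).
  by rewrite /psi !subtuple_sample_at.
pose kk := wd (Ordinal kp); pose ii := wd (Ordinal ip).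
pose tau (x : 'I_N) : nat := tperm kk ii x.
have injtau : injective tau by move=> x y /val_inj/perm_inj.
have mpsi : measurable_fun setT psi.
  by apply: measurable_funM; apply: measurableT_comp => //; exact: measurable_subtuple.
have Ipsi : Rintegrable P (fun w => psi (sample N w)).
  rewrite /psi; apply: (@RintegrableMb _ _ _ _ M) => //.
    apply: (measurableT_comp (f := phi \o subtuple wd)) => //.
    by apply: measurableT_comp => //; exact: measurable_subtuple.
  under [X in Rintegrable _ X]eq_fun do
    rewrite (@subtuple_sample_at _ _ _ _ _ _ X _ _ e (fun i => i)).
  apply: (exchangeable_Rintegrable polyaX limD) => // x y /= xy.
  by apply/val_inj/(mixed_index_inj kp) => //; rewrite inE; exact: ltn_ord.
have := exchangeable_Rintegral polyaX limD injtau mpsi Ipsi.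
have -> : \int[P]_w psi (sample N w) = Ek k.+1.
  apply: eq_Rintegral => w _; exact: (psi_at (fun i => i)).
move=> <-; apply: eq_Rintegral => w _; rewrite psi_at; congr (_ * _).
  rewrite -[LHS](symphi (tperm (Ordinal kp) (Ordinal ip))); congr phi.
  apply: eq_from_tnth => l; rewrite !tnth_mktuple; congr (X _ w).
  rewrite /tau; case: tpermP => [E|E|lk li].
  - by rewrite (_ : l = Ordinal kp) ?tpermL//; apply: val_inj; exact: (congr1 val E).
  - by rewrite (_ : l = Ordinal ip) ?tpermR//; apply: val_inj; exact: (congr1 val E).
  rewrite tpermD//; apply/eqP => E; [apply: lk|apply: li]; rewrite -E; exact: val_inj.
congr h; apply: eq_from_tnth => l; rewrite !tnth_mktuple; congr (X _ w).
rewrite /tau; case: eqP => [lk|lk].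
  have -> : e l = kk by apply: val_inj; rewrite /= /mixed_index lk ltnSn.
  by rewrite tpermL.
have ln := ltn_ord l.
rewrite tpermD//; apply/eqP => /(congr1 val) /=; rewrite /mixed_index; case: ltnP; lia.
Qed.

(** N is the index of the last argument of [mixed_sample k]. The other arguments occupy all indices
    below N except k, ..., n - 1, so the cancellation leaves n - k repeats, all equal by the
    swap. *)
Lemma mixed_sample_step k : (k <= p)%N ->
  (a + (n + (p - k))%:R) * Ek k = (n - k)%:R * Ek k.+1.
Proof.
move=> kp; set N := (n + (p - k))%N.
have kn : (k < n)%N by [].
have vN (i : 'I_p) : (mixed_index k i < N)%N.
  by rewrite /mixed_index /N; have ln := ltn_ord i; case: ifP => ?; lia.
pose v i := Ordinal (vN i).
have injv : injective v.
  move=> x y /(congr1 val) /= xy; apply/val_inj/(mixed_index_inj (ltnW kn)) => //;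
    by rewrite inE ltnS ltnW// ltn_ord.
have nN : (n <= N)%N by rewrite leq_addr.
pose wd := widen_ord nN.
have mTh : measurable_fun setT (phi \o subtuple wd).
  by apply: measurableT_comp => //; exact: measurable_subtuple.
have := cancellation polyaX limD alpha_gt0 mh Ih h0 injv mTh (fun x => phiM _).
have Th w : (phi \o subtuple wd) (sample N w) = phi (sample n w).
  by rewrite /= (@subtuple_sample_at _ _ _ _ _ _ X _ _ wd (fun i => i)).
have -> : \int[P]_w ((phi \o subtuple wd) (sample N w) *
    h (snoc (sample_at (fun l => v l) w) (X N w))) = Ek k.
  apply: eq_Rintegral => w _; rewrite Th; congr (_ * h _).
  rewrite snoc_sample_at; congr (sample_at _ w); apply/funext => l.
  case: insubP => [l' _ /= ->//|]; rewrite -leqNgt => pl.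
  have lp : l = p :> nat by apply/eqP; rewrite eqn_leq pl -ltnS ltn_ord.
  by rewrite /mixed_index lp ltnNge kp.
move=> ->.
have cv (i : 'I_N) : (i \notin codom v) = (k <= i < n)%N.
  apply/idP/idP => [iv|/andP[ki ip]]; last first.
    apply/codomP => -[l /(congr1 val) /=]; rewrite /mixed_index.
    by case: ltnP; lia.
  apply: contraNT iv => iv.
  have [ik|ki] := ltnP i k.
    have ip : (i < p)%N by exact: leq_trans ik kp.
    by apply/codomP; exists (Ordinal ip); apply: val_inj; rewrite /= /mixed_index ik.
  have ni : (n <= i)%N by move: iv; rewrite ki /= -leqNgt.
  have iN : (i < n + (p - k))%N := ltn_ord i.
  have ip : (i - n + k < p)%N by lia.
  apply/codomP; exists (Ordinal ip); apply: val_inj => /=; rewrite /mixed_index.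
  case: ltnP; lia.
rewrite (eq_bigl (fun i : 'I_N => (k <= i < n)%N)); last by move=> i; rewrite cv.
rewrite (eq_bigr (fun=> Ek k.+1)); last first.
  move=> i kin; rewrite -(mixed_sample_swap kin).
  apply: eq_Rintegral => w _; rewrite Th; congr (_ * _).
  pose kk : 'I_n := Ordinal kn.
  (* The cancellation acts on the last argument of [h], the swap on argument number k; symmetry of
     [h] moves one to the other and keeps the order of the rest. *)
  rewrite -[LHS](symh (lift_perm kk ord_max 1)); congr h.
  apply: eq_from_tnth => l; rewrite !tnth_mktuple.
  case: (unliftP kk l) => [l' ->|->]; last first.
    by rewrite lift_perm_id tnth_snoc_max//= eqxx.
  rewrite lift_perm_lift perm1.
  have lp : (lift ord_max l' < p)%N by rewrite lift_max; exact: ltn_ord.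
  rewrite (tnth_snoc_lt _ _ lp) tnth_mktuple; congr (X _ w) => /=.
  rewrite /bump (leqNgt p l') ltn_ord /= add0n.
  rewrite [X in _ == X](_ : k = kk)// /mixed_index /bump.
  have [kl|lk] := leqP k l'.
    have E1 : (l'.+1 == k) = false by apply/eqP; lia.
    have E2 : (l'.+1 < k.+1)%N = false by apply/negbTE; rewrite -leqNgt; lia.
    by rewrite add1n E1 E2 subSS.
  have E2 : (l' < k.+1)%N by lia.
  by rewrite add0n E2 (ltn_eqF lk).
rewrite sumr_const -[Ek _ *+ _]mulr_natl; congr (_%:R * _).
(* Counts the n - k surviving indices by cutting the range at n and at k. *)
rewrite -sum1_card -(big_mkord (fun i => k <= i < n)%N (fun=> 1%N)).
rewrite (big_cat_nat (n := n))//=.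
rewrite [X in (_ + X)%N]big_nat_cond [X in (_ + X)%N]big1 ?addn0; last first.
  by move=> i; lia.
rewrite (big_cat_nat (n := k))//=; last exact: ltnW.
rewrite [X in (X + _)%N]big_nat_cond [X in (X + _)%N]big1 ?add0n; last by move=> i; lia.
rewrite big_nat_cond (eq_bigl (fun i => k <= i < n)%N); last by move=> i; lia.
by rewrite -big_nat sum_nat_const_nat muln1.
Qed.

Definition chaos_const : R := \prod_(k < n) ((n - k)%:R / (a + (n + (p - k))%:R)).

Lemma chaos_const_neq0 : chaos_const != 0.
Proof.
apply/prodf_neq0 => k _; rewrite mulf_neq0//.
  by rewrite pnatr_eq0 -lt0n subn_gt0.
by rewrite invr_eq0 gt_eqF// polya_den_gt0.
Qed.

(* Going down from [k = n] to [k = 0] shared arguments, each step multiplies the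
   expectation by one factor of [chaos_const]. *)
Lemma key_identity_sym :
  \int[P]_w (phi (sample n w) * h (tail n n w)) =
  chaos_const * \int[P]_w (phi (sample n w) * h (sample n w)).
Proof.
have -> : \int[P]_w (phi (sample n w) * h (tail n n w)) = Ek 0.
  apply: eq_Rintegral => w _; congr (_ * h (sample_at _ w)); apply/funext => i.
  by rewrite /mixed_index subn0.
have -> : \int[P]_w (phi (sample n w) * h (sample n w)) = Ek n.
  apply: eq_Rintegral => w _; congr (_ * h (sample_at _ w)); apply/funext => i.
  by rewrite /mixed_index ltn_ord.
suff H k : (k <= n)%N ->
    Ek 0 = \prod_(i < k) ((n - i)%:R / (a + (n + (p - i))%:R)) * Ek k by exact: H.
elim: k => [_|k IH kn]; first by rewrite big_ord0 mul1r.
rewrite IH ?(ltnW kn)// big_ord_recr /= -mulrA; congr (_ * _).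
apply: (@mulfI _ (a + (n + (p - k))%:R)).
  by rewrite gt_eqF// polya_den_gt0.
rewrite mixed_sample_step// mulrA [X in _ = X * _]mulrC divfK//.
by rewrite gt_eqF// polya_den_gt0.
Qed.

End key_identity.

(** * Square-integrable functions and conditional expectation given a random variable *)

Section square_integrable.
Context d (O : measurableType d) (R : realType) (P : probability O R).
Implicit Types f g : O -> R.

Definition L2 f := measurable_fun setT f /\ Rintegrable P (fun w => f w ^+ 2).

Lemma Rintegrable_bounded M f : measurable_fun setT f -> (forall w, `|f w| <= M) ->
  Rintegrable P f.
Proof.
move=> mf fM; apply: (@le_Rintegrable _ _ _ _ _ (fun=> M)) => //.
  by move=> w; rewrite (le_trans (fM w))// ler_norm.
exact: finite_measure_integrable_cst.
Qed.

Lemma L2_bounded M f : measurable_fun setT f -> (forall w, `|f w| <= M) -> L2 f.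
Proof.
move=> mf fM; split => //; apply: (@Rintegrable_bounded (M ^+ 2)).
  exact: measurable_funX.
by move=> w; rewrite normrX ler_pXn2r// nnegrE (le_trans _ (fM w)).
Qed.

Lemma L2_Rintegrable f : L2 f -> Rintegrable P f.
Proof.
move=> [mf If]; apply: (@le_Rintegrable _ _ _ _ _ (fun x => f x ^+ 2 + 1)) => //.
  move=> x; rewrite [leRHS]ger0_norm; last by rewrite addr_ge0 ?sqr_ge0.
  rewrite -[X in _ <= X + _]real_normK ?num_real//; nra.
by apply: RintegrableD => //; exact: finite_measure_integrable_cst.
Qed.

Lemma L2_mul f g : L2 f -> L2 g -> Rintegrable P (fun w => f w * g w).
Proof.
move=> [mf If] [mg Ig].
apply: (@le_Rintegrable _ _ _ _ _ (fun x => f x ^+ 2 + g x ^+ 2)).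
- exact: measurable_funM.
- move=> x; rewrite [leRHS]ger0_norm; last by rewrite addr_ge0 ?sqr_ge0.
  rewrite normrM -(real_normK (num_real (f x))) -(real_normK (num_real (g x))).
  have := sqr_ge0 (`|f x| - `|g x|); have := normr_ge0 (f x); have := normr_ge0 (g x).
  nra.
exact: RintegrableD.
Qed.

Lemma L2Z r f : L2 f -> L2 (fun w => r * f w).
Proof.
move=> [mf If]; split; first exact: measurable_funM.
under [X in Rintegrable _ X]eq_fun do rewrite exprMn.
exact: RintegrableZ.
Qed.

Lemma L2D f g : L2 f -> L2 g -> L2 (fun w => f w + g w).
Proof.
move=> Lf Lg; have [mf If] := Lf; have [mg Ig] := Lg; split; first exact: measurable_funD.
under [X in Rintegrable _ X]eq_fun do rewrite sqrrD.
apply: RintegrableD => //; apply: RintegrableD => //.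
under [X in Rintegrable _ X]eq_fun do rewrite -mulr_natl.
by apply: RintegrableZ; exact: L2_mul.
Qed.

Lemma L2B f g : L2 f -> L2 g -> L2 (fun w => f w - g w).
Proof.
move=> Lf Lg; have := L2D Lf (L2Z (-1) Lg); congr L2.
by apply/funext => w; rewrite mulN1r.
Qed.

Lemma L2_cst c : L2 (fun=> c).
Proof. by split => //; exact: finite_measure_integrable_cst. Qed.

Lemma L2_sum I (s : seq I) (F : I -> O -> R) :
  (forall i, L2 (F i)) -> L2 (fun w => \sum_(i <- s) F i w).
Proof.
move=> LF; elim: s => [|i s IH].
  by under eq_fun do rewrite big_nil; exact: L2_cst.
by under eq_fun do rewrite big_cons; exact: L2D.
Qed.

Lemma L2_Lfun f : L2 f <-> f \in Lfun P 2%:E.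
Proof.
split => [[mf If]|Lf]; last first.
  split; last exact: Lfun2_integrable_sqr.
  by move: Lf; rewrite inE => /andP[+ _]; rewrite inE.
rewrite inE; apply/andP; split; rewrite inE//= /finite_norm unlock.
apply: poweR_lty; under eq_integral do rewrite poweR_EFin powR_mulrn// -normrX ger0_norm ?sqr_ge0//.
exact: integrable_lty.
Qed.

Lemma LnormE f : L2 f -> 'N[P]_2%:E[EFin \o f]%E = (Num.sqrt (\int[P]_w f w ^+ 2))%:E.
Proof.
move=> [mf If]; rewrite unlock.
under eq_integral do rewrite poweR_EFin powR_mulrn// -normrX ger0_norm ?sqr_ge0//.
rewrite EFin_Rintegral// poweR_EFin powR12_sqrt//.
by apply: Rintegral_ge0 => w _; exact: sqr_ge0.
Qed.

(** Young's inequality with a free weight, without the sharp factor one half. The weight lets one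
    term be absorbed on the left, or made small, and replaces the Cauchy-Schwarz inequality. *)
Lemma Rintegral_mul_le (t : R) f g : 0 < t -> L2 f -> L2 g ->
  `|\int[P]_w (f w * g w)| <= t * \int[P]_w f w ^+ 2 + t^-1 * \int[P]_w g w ^+ 2.
Proof.
move=> t0 Lf Lg; have [mf If] := Lf; have [mg Ig] := Lg.
apply: le_trans (le_normr_Rintegral measurableT (L2_mul Lf Lg)) _.
rewrite -!RintegralZl// -RintegralD//; try exact: RintegrableZ.
apply: le_Rintegral => //.
- exact: (integrable_norm (L2_mul Lf Lg)).
- by apply: RintegrableD; exact: RintegrableZ.
move=> w _; rewrite normrM.
rewrite -(real_normK (num_real (f w))) -(real_normK (num_real (g w))).
have H := sqr_ge0 (t * `|f w| - `|g w|).
have x0 := normr_ge0 (f w); have y0 := normr_ge0 (g w).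
move: H x0 y0; set x := `|f w|; set y := `|g w| => H x0 y0.
rewrite -(ler_pM2l t0) mulrDr !mulrA divff ?gt_eqF// mul1r.
have := mulr_ge0 (ltW t0) (mulr_ge0 x0 y0); nra.
Qed.

(** [g] is the Radon-Nikodym derivative, with respect to the law of [Y], of the image under [Y] of
    the charge with density [Z]. This gives integrability only; square integrability is gained by
    truncation. *)
Lemma cond_exp d' (T : measurableType d') (Y : {mfun O >-> T}) (Z : O -> R) : L2 Z ->
  exists g : T -> R, [/\ measurable_fun setT g, L2 (fun w => g (Y w)) &
    forall S, measurable S -> \int[P]_(w in Y @^-1` S) Z w = \int[P]_(w in Y @^-1` S) g (Y w)].
Proof.
move=> LZ; have IZ := L2_Rintegrable LZ; have [mZ IZ2] := LZ.
have mpre S : measurable S -> measurable (Y @^-1` S).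
  by move=> mS; rewrite -[X in measurable X]setTI; exact: measurable_funPT.
have mY : measurable_fun setT Y by [].
pose nu0 : {charge set O -> \bar R} := induced_charge IZ.
pose nu1 : {charge set T -> \bar R} := pushforward nu0 Y.
pose nu := nu1 mY.
have dom : nu `<< distribution P Y.
  apply/null_content_dominatesP => S mS PS0.
  rewrite -[LHS]/(\int[P]_(w in Y @^-1` S) (Z w)%:E)%E.
  apply: null_set_integral => //; first exact: mpre.
  by apply: measurable_funTS; exact/measurable_EFinP.
pose f := Radon_Nikodym nu (distribution P Y).
have If := Radon_Nikodym_integrable dom.
have ffin x := Radon_Nikodym_fin_num x dom.
have mfe : measurable_fun setT f by case/integrableP : If.
pose g x := fine (f x).
have mg : measurable_fun setT g by exact: measurableT_comp.
have fg x : f x = (g x)%:E by rewrite /g fineK.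
have IgY : Rintegrable P (fun w => g (Y w)).
  apply/RintegrableE; first exact: measurableT_comp.
  case/integrableP : If => _.
  rewrite ge0_integral_distribution//; last exact: measurableT_comp.
  congr (_ < _)%E; apply: eq_integral => w _ /=.
  by rewrite -/f fg.
have Eg S : measurable S ->
    \int[P]_(w in Y @^-1` S) Z w = \int[P]_(w in Y @^-1` S) g (Y w).
  move=> mS; have := Radon_Nikodym_integral dom mS.
  rewrite -[LHS]/(\int[P]_(w in Y @^-1` S) (Z w)%:E)%E => E.
  rewrite /Rintegral E; congr fine.
  rewrite /distribution integral_pushforward//.
  - by apply: eq_integral => w _ /=; rewrite -/f fg.
  - apply: (@eq_integrable _ _ _ P _ _ (EFin \o (fun w => g (Y w)))); first exact: mpre.
      by move=> w _ /=; rewrite -/f fg.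
    by apply: Rintegrable_on => //; exact: mpre.
exists g; split => //; split; first exact: measurableT_comp.
(* Truncations are bounded, so E(gK^2) = E(Z gK) <= 2 E(Z^2) + E(gK^2) / 2, that is E(gK^2) <= 4
   E(Z^2) uniformly in n; monotone convergence concludes. *)
pose gK (n : nat) x := if `|g x| <= n%:R then g x else 0.
have mgK n : measurable_fun setT (gK n).
  apply: measurable_fun_ifT => //.
  apply: (measurable_fun_ler (f := fun x => `|g x|) (g := fun=> n%:R)) => //.
  exact: measurableT_comp.
have gKn n x : `|gK n x| <= n%:R by rewrite /gK; case: ifP => // _; rewrite normr0.
have LgK n : L2 (fun w => gK n (Y w)).
  split; first exact: measurableT_comp.
  under [X in Rintegrable _ X]eq_fun do rewrite expr2.
  apply: (@RintegrableMb _ _ _ _ n%:R) => //; first exact: measurableT_comp.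
  by apply: (@Rintegrable_bounded n%:R) => //; exact: measurableT_comp.
have bound n : (\int[P]_w ((gK n (Y w)) ^+ 2)%:E <= (4 * \int[P]_w Z w ^+ 2)%:E)%E.
  rewrite EFin_Rintegral ?lee_fin//; last by case: (LgK n).
  have E1 : \int[P]_w gK n (Y w) ^+ 2 = \int[P]_w (Z w * gK n (Y w)).
    transitivity (\int[P]_w (g (Y w) * gK n (Y w))).
      apply: eq_Rintegral => w _; rewrite /gK expr2.
      by case: ifP => // _; rewrite !mulr0.
    apply: (@Rintegral_test _ _ _ _ _ P Y mY) => //.
    - under [X in Rintegrable _ X]eq_fun do rewrite mulrC.
      by apply: (@RintegrableMb _ _ _ _ n%:R) => //; exact: measurableT_comp.
    - exact: L2_mul.
    - by move=> B mB; rewrite Eg.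
  have := Rintegral_mul_le (t := 2) (ltr0Sn _ _) LZ (LgK n).
  rewrite -E1 ger0_norm; last by apply: Rintegral_ge0 => w _; exact: sqr_ge0.
  lra.
have cvgg : (\int[P]_w ((gK n (Y w)) ^+ 2)%:E)%E @[n --> \oo] -->
    (\int[P]_w ((g (Y w)) ^+ 2)%:E)%E.
  apply: monotone_cvg => //.
  - move=> n; apply/measurable_EFinP; apply: measurable_funX; exact: measurableT_comp.
  - by move=> n w _; rewrite lee_fin sqr_ge0.
  - move=> w _ n m nm; rewrite lee_fin /gK; case: ifPn => gn.
      by rewrite (le_trans gn) ?ler_nat.
    by rewrite expr0n sqr_ge0.
  - move=> w _; apply: cvg_near_cst; near=> n; rewrite /gK ifT//.
    near: n; exact: nbhs_infty_ger.
apply/RintegrableE.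
  by apply: measurable_funX; exact: measurableT_comp.
under eq_integral do rewrite ger0_norm ?sqr_ge0//.
apply: (@le_lt_trans _ _ (4 * \int[P]_w Z w ^+ 2)%:E); last exact: ltry.
rewrite -(cvg_lim _ cvgg)//; apply: lime_le.
  by apply/cvg_ex; eexists; exact: cvgg.
exact: nearW.
Unshelve. all: by end_near.
Qed.

End square_integrable.

(** * Symmetrization of test functions and of conditional expectations *)

Section symmetrization.
Context d dA (Omega : measurableType d) (A : measurableType dA) (R : realType).
Variables (P : probability Omega R) (X : nat -> {RV P >-> A}).
Variable alpha : {finite_measure set A -> \bar R}.
Hypothesis polyaX : polya_sequence X alpha.
Variable D : {RV P >-> pprobability A R}.
Hypothesis limD : empirical_limit D X.
Hypothesis alpha_gt0 : (0 < alpha setT)%E.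

Local Notation sample := (sample X).
Local Notation sample_at := (sample_at X).
Local Notation tail m n := (sample_at (@tail_index m n)).
Local Notation OD := (sigma_D_type D).

Let mpre d' (T' : measurableType d') (F : Omega -> T') B :
  measurable_fun setT F -> measurable B -> measurable (F @^-1` B).
Proof. by move=> mF mB; rewrite -[X in measurable X]setTI; exact: mF. Qed.

(** Not normalized: for test functions the factor n! cancels from both sides, and for conditional
    expectations it is divided out explicitly. *)
Definition sym_sum n (f : n.-tuple A -> R) (x : n.-tuple A) : R :=
  \sum_(s : {perm 'I_n}) f (subtuple s x).

Lemma sym_sum_symmetric n (f : n.-tuple A -> R) : symmetric_fun (sym_sum f).
Proof.
move=> t x; rewrite /sym_sum [RHS](reindex_inj (mulIg t)) /=.
apply: eq_bigr => s _; congr f; apply: eq_from_tnth => i.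
by rewrite !tnth_mktuple permM.
Qed.

Lemma measurable_sym_sum n (f : n.-tuple A -> R) : measurable_fun setT f ->
  measurable_fun setT (sym_sum f).
Proof.
move=> mf; apply: measurable_sum => s.
by apply: measurableT_comp => //; exact: measurable_subtuple.
Qed.

Lemma subtuple_sample n m (f : 'I_n -> 'I_m) w :
  subtuple f (sample m w) = sample_at (fun i => f i) w.
Proof. exact: (@subtuple_sample_at _ _ _ _ _ _ X _ _ f (fun i => i)). Qed.

Lemma fact_neq0 n : (n`!)%:R != 0 :> R.
Proof. by rewrite pnatr_eq0 -lt0n fact_gt0. Qed.

(** [key_identity_sym] asks for a symmetric test function, so the indicator of [S] is summed over
    permutations. All n! terms are equal: against fresh draws because the first n draws can be
    permuted alone, against the same draws because [h] is symmetric. *)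
Lemma key_identity p (h : p.+1.-tuple A -> R) : measurable_fun setT h ->
  symmetric_fun h -> Rintegrable P (fun w => h (sample p.+1 w)) ->
  (forall S, measurable S -> \int[P]_(w in sample p @^-1` S) h (sample p.+1 w) = 0) ->
  forall S, measurable S ->
  \int[P]_(w in sample p.+1 @^-1` S) D_integral D h w =
  chaos_const alpha p * \int[P]_(w in sample p.+1 @^-1` S) h (sample p.+1 w).
Proof.
move=> mh symh Ih h0 S mS; pose n := p.+1.
have mS1 : measurable_fun setT (\1_S : n.-tuple A -> R) by [].
have norm1 (x : n.-tuple A) : `|\1_S x| <= 1 :> R.
  by rewrite indicE; case: (_ \in _); rewrite ?normr1 ?normr0.
have phiM x : `|sym_sum (\1_S : n.-tuple A -> R) x| <= (n`!)%:R.
  apply: (le_trans (ler_norm_sum _ _ _)).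
  apply: (@le_trans _ _ (\sum_(s : {perm 'I_n}) 1)); first by apply: ler_sum => s _.
  by rewrite sumr_const card_Sn.
have := key_identity_sym polyaX limD alpha_gt0 mh symh Ih h0
  (measurable_sym_sum mS1) (sym_sum_symmetric _) phiM.
have tail_inj : injective (@tail_index n n).
  by move=> x y /eqP; rewrite eqn_add2l => /eqP; exact: val_inj.
have It : Rintegrable P (fun w => h (tail n n w)).
  exact: (exchangeable_Rintegrable polyaX limD).
have mSs (s : {perm 'I_n}) : measurable_fun setT (fun w => \1_S (subtuple s (sample n w)) : R).
  have m1 : measurable_fun setT (\1_S \o subtuple s : n.-tuple A -> R).
    by apply: measurableT_comp => //; exact: measurable_subtuple.
  exact: (measurableT_comp m1 (measurable_funPT (sample n))).
have -> : \int[P]_w (sym_sum \1_S (sample n w) * h (tail n n w)) =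
    (n`!)%:R * \int[P]_(w in sample n @^-1` S) h (tail n n w).
  under eq_Rintegral do rewrite mulr_suml.
  rewrite Rintegral_sum; last by move=> s _; apply: RintegrableMb.
  rewrite (eq_bigr (fun=> \int[P]_(w in sample n @^-1` S) h (tail n n w))).
    by rewrite sumr_const card_Sn mulr_natl.
  move=> s _; rewrite -[RHS]Rintegral_indic; last exact: mpre.
  pose psi (z : (n + n).-tuple A) : R :=
    \1_S (subtuple (@lshift n n) z) * h (subtuple (@rshift n n) z).
  (* Permutes the first block by [s] and leaves the tail block in place. *)
  pose j (i : 'I_(n + n)) : nat := match fintype.split i with inl l => s l | inr l => (n + l)%N end.
  have psi_at (i : 'I_(n + n) -> nat) w : psi (sample_at i w) =
      \1_S (sample_at (fun l => i (lshift n l)) w) * h (sample_at (fun l => i (rshift n l)) w).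
    by rewrite /psi !subtuple_sample_at.
  have psi_id w : psi (sample (n + n) w) = \1_S (sample n w) * h (tail n n w).
    exact: (psi_at (fun i => i)).
  have mpsi : measurable_fun setT psi.
    by apply: measurable_funM; apply: measurableT_comp => //; exact: measurable_subtuple.
  have injj : injective j.
    move=> x y; rewrite /j -{2}(splitK x) -{2}(splitK y).
    case: (fintype.split x) => u; case: (fintype.split y) => v /=.
    - by move=> /val_inj/perm_inj ->.
    - by have := ltn_ord (s u); lia.
    - by have := ltn_ord (s v); lia.
    - by move=> /eqP; rewrite eqn_add2l => /eqP/val_inj ->.
  have Ipsi : Rintegrable P (fun w => psi (sample (n + n) w)).
    under [X in Rintegrable _ X]eq_fun do rewrite psi_id.
    apply: (@RintegrableMb _ _ _ _ 1) => //.
    exact: (measurableT_comp mS1 (measurable_funPT (sample n))).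
  have := exchangeable_Rintegral polyaX limD injj mpsi Ipsi.
  under [X in _ = X -> _]eq_Rintegral do rewrite psi_id.
  move=> H; rewrite -[RHS]H; apply: eq_Rintegral => w _.
  rewrite psi_at subtuple_sample; congr (\1_S (sample_at _ w) * h (sample_at _ w)).
    by apply/funext => l; rewrite /j (unsplitK (inl l)).
  by apply/funext => l; rewrite /j (unsplitK (inr l)).
have -> : \int[P]_w (sym_sum \1_S (sample n w) * h (sample n w)) =
    (n`!)%:R * \int[P]_(w in sample n @^-1` S) h (sample n w).
  under eq_Rintegral do rewrite mulr_suml.
  rewrite Rintegral_sum; last by move=> s _; apply: RintegrableMb.
  rewrite (eq_bigr (fun=> \int[P]_(w in sample n @^-1` S) h (sample n w))).
    by rewrite sumr_const card_Sn mulr_natl.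
  move=> s _; rewrite -[RHS]Rintegral_indic; last exact: mpre.
  pose psi (z : n.-tuple A) : R := \1_S z * h z.
  have injs : injective (fun i => s i : nat) by move=> x y /val_inj/perm_inj.
  have Ipsi : Rintegrable P (fun w => psi (sample n w)).
    apply: (@RintegrableMb _ _ _ _ 1) => //.
    exact: (measurableT_comp mS1 (measurable_funPT (sample n))).
  have mpsi : measurable_fun setT psi by exact: measurable_funM.
  have := exchangeable_Rintegral polyaX limD injs mpsi Ipsi.
  move=> H; rewrite -[RHS]H; apply: eq_Rintegral => w _.
  rewrite /psi -subtuple_sample; congr (_ * _).
  by rewrite -[LHS](symh s).
rewrite mulrCA => /(mulfI (fact_neq0 _)) <-.
by rewrite -(D_integral_tail polyaX limD).
Qed.

(** Averaging a version over permutations gives another version, because [G] is a function of [D]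
    and permuting the draws preserves their joint law with sigma(D). *)
Lemma sym_cond_exp n (G : Omega -> R) : L2 P G -> measurable_fun (setT : set OD) G ->
  exists g : n.-tuple A -> R, [/\ measurable_fun setT g, symmetric_fun g,
    L2 P (fun w => g (sample n w)) &
    forall S, measurable S ->
      \int[P]_(w in sample n @^-1` S) G w = \int[P]_(w in sample n @^-1` S) g (sample n w)].
Proof.
move=> LG mG; have [g [mg Lg Hg]] := cond_exp (sample n) LG.
have IG := L2_Rintegrable LG.
have injs (s : {perm 'I_n}) : injective (fun i => s i : nat).
  by move=> x y /val_inj/perm_inj.
have Ls (s : {perm 'I_n}) : L2 P (fun w => g (subtuple s (sample n w))).
  have ms : measurable_fun setT (g \o subtuple s).
    by apply: measurableT_comp => //; exact: measurable_subtuple.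
  split; first exact: (measurableT_comp ms (measurable_funPT (sample n))).
  under [X in Rintegrable _ X]eq_fun do rewrite subtuple_sample.
  apply: (exchangeable_Rintegrable polyaX limD (f := fun x => g x ^+ 2)) => //.
    exact: measurable_funX.
  by case: Lg.
exists (fun x => (n`!)%:R^-1 * sym_sum g x); split.
- by apply: measurable_funM => //; exact: measurable_sym_sum.
- by move=> t x; rewrite sym_sum_symmetric.
- by apply: L2Z; exact: L2_sum.
move=> S mS; have mSp := mpre (measurable_funPT (sample n)) mS.
have mS1 : measurable_fun setT (\1_S : n.-tuple A -> R) by [].
have norm1 (x : n.-tuple A) : `|\1_S x| <= 1 :> R.
  by rewrite indicE; case: (_ \in _); rewrite ?normr1 ?normr0.
rewrite -[RHS]Rintegral_indic//.
under [RHS]eq_Rintegral do rewrite mulrCA mulr_sumr.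
have Ii (s : {perm 'I_n}) : Rintegrable P
    (fun w => \1_(sample n @^-1` S) w * g (subtuple s (sample n w))).
  by apply: Rintegrable_indic => //; exact: L2_Rintegrable.
rewrite RintegralZl//; last exact: Rintegrable_sum.
rewrite Rintegral_sum//.
rewrite (eq_bigr (fun=> \int[P]_(w in sample n @^-1` S) G w)).
  by rewrite sumr_const card_Sn -[X in _ * X]mulr_natl mulrA mulVf ?fact_neq0// mul1r.
move=> s _.
(* Permuting the draws moves the permutation from [g] to the event, where [g] can be replaced by
   [G]. *)
pose S' := subtuple (s^-1)%g @^-1` S.
have mS' : measurable S' by exact: measurable_subtuple_preimage.
have sK (x : n.-tuple A) : subtuple (s^-1)%g (subtuple s x) = x.
  by apply: eq_from_tnth => i; rewrite !tnth_mktuple permKV.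
pose psi (z : n.-tuple A) : R := \1_S' z * g z.
have mpsi : measurable_fun setT psi by exact: measurable_funM.
have Ipsi : Rintegrable P (fun w => psi (sample n w)).
  apply: (@Rintegrable_indic _ _ _ P (sample n @^-1` S')); first exact: mpre.
  exact: L2_Rintegrable.
transitivity (\int[P]_w psi (subtuple s (sample n w))).
  apply: eq_Rintegral => w _; rewrite /psi; congr (_ * _).
  by rewrite -[LHS]/(\1_S (sample n w)) -[RHS]/(\1_S (subtuple (s^-1)%g _)) sK.
under eq_Rintegral do rewrite subtuple_sample.
rewrite (exchangeable_Rintegral polyaX limD (injs s) mpsi Ipsi).
transitivity (\int[P]_w (\1_(sample n @^-1` S') w * G w)).
  have mS'p := mpre (measurable_funPT (sample n)) mS'.
  by rewrite [RHS](Rintegral_indic _ _ mS'p) Hg// -[RHS](Rintegral_indic _ _ mS'p).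
rewrite -[RHS]Rintegral_indic//.
apply/eqP; rewrite -subr_eq0 -RintegralB//; try by apply: Rintegrable_indic => //; exact: mpre.
(* This difference has integral zero over every event of sigma(D), by exchangeability given
   sigma(D), and is therefore orthogonal to [G]. *)
pose N w : R := \1_(sample n @^-1` S') w - \1_(sample n @^-1` S) w.
have mN : measurable_fun setT N.
  by apply: measurable_funB; apply: measurable_indic => //; exact: mpre.
have NM w : `|N w| <= 2.
  rewrite (le_trans (ler_normB _ _))// [X in _ <= X](_ : 2 = 1 + 1)//.
  by rewrite lerD// ?norm1// indicE; case: (_ \in _); rewrite ?normr1 ?normr0.
have -> : \int[P]_w (\1_(sample n @^-1` S') w * G w - \1_(sample n @^-1` S) w * G w) =
    \int[P]_w (N w * G w).
  by apply: eq_Rintegral => w _; rewrite mulrBl.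
apply/eqP; apply: (@Rintegral_test0 _ _ Omega OD R P (fun w => w)
  (@measurable_to_sigma_D _ _ _ _ _ _ D)) => //.
- exact: Rintegrable_bounded NM.
- exact: RintegrableMb NM IG.
move=> B mB; have mB' : measurable (B : set Omega) by exact: (sigma_D_measurable (D := D)).
have mB1 Q : measurable Q -> measurable ((B : set Omega) `&` sample n @^-1` Q).
  by move=> mQ; apply: measurableI => //; exact: mpre.
have E Q : measurable Q -> \int[P]_(w in (B : set Omega)) \1_(sample n @^-1` Q) w =
    fine (P ((B : set Omega) `&` sample n @^-1` Q)).
  move=> mQ; rewrite /Rintegral; congr fine.
  by rewrite integral_indic//; [rewrite setIC|exact: mpre].
have I1 Q : measurable Q -> P.-integrable (B : set Omega) (EFin \o \1_(sample n @^-1` Q)).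
  move=> mQ; apply: Rintegrable_on => //; apply: (@Rintegrable_bounded _ _ _ _ 1).
    by apply: measurable_indic; exact: mpre.
  by move=> w; rewrite indicE; case: (_ \in _); rewrite ?normr1 ?normr0.
rewrite -[X in \int[_]_(w in X) _]/(B : set Omega).
rewrite RintegralB//; try exact: I1.
rewrite !E//; apply/eqP; rewrite subr_eq0; apply/eqP; congr fine.
rewrite -(exchangeable_sigma_D polyaX limD mB (injs (s^-1)%g) mS).
congr (P (_ `&` _)); apply/seteqP; split => w /=.
  by rewrite /S' /= subtuple_sample.
by rewrite /S' /= subtuple_sample.
Qed.

End symmetrization.

(** * Construction, convergence and uniqueness of the expansion *)

Section chaos.
Context d dA (Omega : measurableType d) (A : measurableType dA) (R : realType).
Variables (P : probability Omega R) (X : nat -> {RV P >-> A}).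
Variable alpha : {finite_measure set A -> \bar R}.
Hypothesis polyaX : polya_sequence X alpha.
Variable D : {RV P >-> pprobability A R}.
Hypothesis limD : empirical_limit D X.
Hypothesis alpha_gt0 : (0 < alpha setT)%E.

Local Notation sample := (sample X).
Local Notation sample_at := (sample_at X).
Local Notation tail m n := (sample_at (@tail_index m n)).
Local Notation OD := (sigma_D_type D).
Local Notation L2 := (L2 P).
Local Notation c := (chaos_const alpha).

Let mpre n (S : set (n.-tuple A)) : measurable S -> measurable (sample n @^-1` S).
Proof.
by move=> mS; rewrite -[X in measurable X]setTI; exact: (measurable_funPT (sample n)).
Qed.

Lemma sample_widen m n (mn : (m <= n)%N) (S : set (m.-tuple A)) :
  sample m @^-1` S = sample n @^-1` (subtuple (widen_ord mn) @^-1` S).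
Proof. by apply/seteqP; split => w /=; rewrite subtuple_sample. Qed.

(* [level_null n G] states that [E(G | X_1, ..., X_n) = 0]. *)
Definition level_null n (G : Omega -> R) :=
  forall S, measurable S -> \int[P]_(w in sample n @^-1` S) G w = 0.

Lemma level_null_le m n G : (m <= n)%N -> level_null n G -> level_null m G.
Proof.
move=> mn Gn S mS; rewrite (sample_widen mn); apply: Gn.
exact: measurable_subtuple_preimage.
Qed.

(** [Xi] restated with real integrals. The arity [p.+1] makes the preceding sample [sample p]. *)
Record chaos_fun p (h : p.+1.-tuple A -> R) := ChaosFun {
  chaos_measurable : measurable_fun setT h;
  chaos_symmetric : symmetric_fun h;
  chaos_L2 : L2 (fun w => h (sample p.+1 w));
  chaos_null : level_null p (fun w => h (sample p.+1 w)) }.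

Lemma Xi_chaos_fun p (h : p.+1.-tuple A -> R) : Xi X h <-> chaos_fun h.
Proof.
split => [[sh mh h2 [_ _ _ H]]|[mh sh Lh h0]].
  have mhs : measurable_fun setT (fun w => h (sample p.+1 w)).
    exact: (measurableT_comp mh (measurable_funPT (sample p.+1))).
  have Lh : L2 (fun w => h (sample p.+1 w)).
    split => //; apply/RintegrableE; first exact: measurable_funX.
    by under eq_integral do rewrite ger0_norm ?sqr_ge0//; move: h2; rewrite unlock.
  split => // S mS; rewrite /Rintegral.
  have := H (sample p @^-1` S); rewrite integral0 => ->//.
  by exists S => //; rewrite setTI.
split => //.
  rewrite unlock; have [_ /integrable_lty] := Lh; exact.
have Ih := L2_Rintegrable Lh.
split => //.
- exact: integrable0.
- move=> B mB; have [B0|B0] := pselect (B 0).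
    rewrite (_ : _ @^-1` _ = setT); last by apply/seteqP; split.
    by exists setT => //; rewrite setTI preimage_setT.
  rewrite (_ : _ @^-1` _ = set0); last by apply/seteqP; split => // w /B0.
  by exists set0 => //; rewrite setTI preimage_set0.
- move=> _ [S mS <-]; rewrite setTI integral0.
  by rewrite EFin_Rintegral ?h0//; exact: mpre.
Qed.

Lemma L2_D_integral n (h : n.-tuple A -> R) : measurable_fun setT h ->
  L2 (fun w => h (sample n w)) -> L2 (D_integral D h).
Proof.
move=> mh Lh; have mI := measurable_D_integral (D := D) mh.
have mI' : measurable_fun setT (D_integral D h : Omega -> R).
  exact: (measurableT_comp mI (@measurable_to_sigma_D _ _ _ _ _ _ D)).
split => //; apply/RintegrableE; first exact: measurable_funX.
under eq_integral do rewrite ger0_norm ?sqr_ge0//.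
apply: le_lt_trans (sqr_D_integral polyaX limD mh) _.
have [_ /integrable_lty] := Lh; exact.
Qed.

Lemma chaos_key p (h : p.+1.-tuple A -> R) S : chaos_fun h -> measurable S ->
  \int[P]_(w in sample p.+1 @^-1` S) D_integral D h w =
  c p * \int[P]_(w in sample p.+1 @^-1` S) h (sample p.+1 w).
Proof.
move=> [mh sh Lh h0] mS; apply: (key_identity polyaX limD alpha_gt0) => //.
exact: L2_Rintegrable.
Qed.

(** An event of p draws is also one of p + 1 draws, where the key identity reduces the claim to
    degeneracy. In the uniqueness proof this removes all kernels of higher order. *)
Lemma D_integral_level_null p (h : p.+1.-tuple A -> R) : chaos_fun h ->
  level_null p (D_integral D h).
Proof.
move=> Ch S mS; rewrite (sample_widen (leqnSn p)) chaos_key//; last first.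
  exact: measurable_subtuple_preimage.
by rewrite -sample_widen chaos_null// mulr0.
Qed.

(** Since [G] is a function of [D], the random integral may be replaced by [h] at the first p + 1
    draws, and to these [G] is orthogonal by assumption. *)
Lemma orthogonality p (h : p.+1.-tuple A -> R) (G : Omega -> R) : chaos_fun h ->
  L2 G -> measurable_fun (setT : set OD) G -> level_null p.+1 G ->
  \int[P]_w (G w * D_integral D h w) = 0.
Proof.
move=> Ch LG mG G0; have [mh sh Lh h0] := Ch.
have Ih := L2_Rintegrable Lh.
have LI := L2_D_integral mh Lh.
have [II Hs] := D_integral_sigma_D polyaX limD mh Ih.
under eq_Rintegral do rewrite mulrC.
rewrite -(@Rintegral_test _ _ Omega OD R P (fun w => w) (@measurable_to_sigma_D _ _ _ _ _ _ D)
  (fun w => h (sample p.+1 w)) (D_integral D h) G)//.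
- under eq_Rintegral do rewrite mulrC.
  apply: (@Rintegral_test0 _ _ _ _ _ P (sample p.+1)) => //; first exact: L2_Rintegrable.
  exact: L2_mul.
- exact: L2_mul.
- exact: L2_mul.
Qed.

Section decomposition.
Variable F : Omega -> R.
Hypothesis L2F : L2_D D F.

(** Total, with value 0 outside the intended domain: the residuals can then be defined by recursion
    first and shown to stay in the domain afterwards. *)
Definition projection n (G : Omega -> R) : n.-tuple A -> R :=
  match pselect (L2 G) with
  | left LG =>
    match pselect (measurable_fun (setT : set OD) G) with
    | left mG => sval (cid (sym_cond_exp polyaX limD n LG mG))
    | right _ => fun=> 0
    end
  | right _ => fun=> 0
  end.

Lemma projectionP n G : L2 G -> measurable_fun (setT : set OD) G ->
  [/\ measurable_fun setT (@projection n G), symmetric_fun (@projection n G),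
    L2 (fun w => projection G (sample n w)) &
    forall S, measurable S -> \int[P]_(w in sample n @^-1` S) G w =
      \int[P]_(w in sample n @^-1` S) projection G (sample n w)].
Proof.
move=> LG mG; rewrite /projection; case: pselect => // LG'; case: pselect => // mG'.
by case: cid.
Qed.

Definition next_kernel p (G : Omega -> R) (x : p.+1.-tuple A) : R :=
  (c p)^-1 * projection G x.
Arguments next_kernel : clear implicits.

Fixpoint residual N : Omega -> R :=
  match N with
  | 0 => fun w => F w - fine 'E_P[F]
  | p.+1 => fun w => residual p w - D_integral D (next_kernel p (residual p)) w
  end.

(** The value at order 0 is a placeholder, since the expansion starts at n = 1. *)
Definition chaos_kernel n : n.-tuple A -> R :=
  match n with
  | 0 => fun=> 0
  | p.+1 => next_kernel p (residual p)
  end.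

Lemma residualE N w : residual N w =
  F w - (fine 'E_P[F] + \sum_(1 <= n < N.+1) D_integral D (@chaos_kernel n) w).
Proof.
elim: N => [|N IH] /=; first by rewrite big_geq// addr0.
by rewrite IH [in RHS]big_nat_recr//=; ring.
Qed.

(** Division by [c p] makes the key identity reproduce exactly the conditional expectation of [G]
    given p + 1 draws, so the difference is null at the next level. Nullity of [G] at level p is
    what makes the new kernel degenerate. *)
Let step p G : L2 G -> measurable_fun (setT : set OD) G -> level_null p G ->
  [/\ chaos_fun (next_kernel p G),
      L2 (fun w => G w - D_integral D (next_kernel p G) w),
      measurable_fun (setT : set OD) (fun w => G w - D_integral D (next_kernel p G) w) &
      level_null p.+1 (fun w => G w - D_integral D (next_kernel p G) w)].
Proof.
move=> LG mG G0; have [mg sg Lg Hg] := projectionP p.+1 LG mG.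
have Ig := L2_Rintegrable Lg.
have Ch : chaos_fun (next_kernel p G).
  split.
  - exact: measurable_funM.
  - by move=> s x; rewrite /next_kernel sg.
  - exact: L2Z.
  - move=> S mS; rewrite (sample_widen (leqnSn p)).
    set S' := _ @^-1` S; have mS' : measurable S' by exact: measurable_subtuple_preimage.
    rewrite RintegralZl; [|exact: mpre|by apply: Rintegrable_on => //; exact: mpre].
    by rewrite -Hg// -sample_widen G0// mulr0.
have [mh sh Lh h0] := Ch.
have LI := L2_D_integral mh Lh.
have mI := measurable_D_integral (D := D) mh.
split => //.
- exact: L2B.
- exact: (measurable_funB mG mI).
move=> S mS; have mSp := mpre mS.
rewrite RintegralB//; try by apply: Rintegrable_on => //; exact: L2_Rintegrable.
rewrite chaos_key// RintegralZl//; last exact: Rintegrable_on.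
by rewrite mulrA divff ?chaos_const_neq0// mul1r Hg// subrr.
Qed.

Let mF : measurable_fun (setT : set OD) F.
Proof. by move=> _ B mB; rewrite setTI; case: L2F => H _; exact: H. Qed.

Let LF : L2 F.
Proof. by apply/L2_Lfun; case: L2F. Qed.

Let EF : fine 'E_P[F] = \int[P]_w F w.
Proof. by rewrite unlock. Qed.

Lemma residualP N : [/\ L2 (residual N), measurable_fun (setT : set OD) (residual N) &
  level_null N (residual N)].
Proof.
elim: N => [|N [LG mG G0]]; last by have [] := step LG mG G0.
split.
- by apply: L2B => //; exact: L2_cst.
- by apply: (measurable_funB mF); exact: measurable_cst.
(* The empty sample takes one value only, so nullity at level 0 just says that the residual is
   centred. *)
move=> S mS; have [S0|S0] := pselect (S [tuple]).
  rewrite (_ : _ @^-1` _ = setT); last first.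
    by apply/seteqP; split => // w _ /=; rewrite (tuple0 (sample 0 w)).
  rewrite RintegralB//; last 2 first.
  - exact: L2_Rintegrable.
  - exact: (L2_Rintegrable (L2_cst P _)).
  have P1 : fine (P setT) = 1 by rewrite probability_setT.
  by rewrite Rintegral_cst// -[X in _ * X]/(fine (P setT)) P1 mulr1 EF subrr.
rewrite (_ : _ @^-1` _ = set0) ?Rintegral_set0//.
by apply/seteqP; split => // w /=; rewrite (tuple0 (sample 0 w)).
Qed.

Lemma chaos_kernelP p : chaos_fun (@chaos_kernel p.+1).
Proof. by have [LG mG G0] := residualP p; have [] := step LG mG G0. Qed.

Local Notation F0 := (residual 0).

(** The residual is a function of [D] and null at level N, hence orthogonal to the first N
    integrals, whose sum is its difference from [F0]. Norm convergence becomes weak convergence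
    against [F0]. *)
Lemma residual_sqr N :
  \int[P]_w (residual N w) ^+ 2 = \int[P]_w (residual N w * F0 w).
Proof.
have [LG mG G0] := residualP N.
have [LF0 mF0 F00] := residualP 0.
have LI p : L2 (D_integral D (@chaos_kernel p.+1)).
  by have [mh _ Lh _] := chaos_kernelP p; exact: L2_D_integral.
have E w : residual N w ^+ 2 = residual N w * F0 w -
    \sum_(p < N) (residual N w * D_integral D (@chaos_kernel p.+1) w).
  rewrite expr2 -mulr_sumr -mulrBr; congr (_ * _).
  by rewrite residualE big_add1 big_mkord /= opprD addrA.
under eq_Rintegral do rewrite E.
rewrite RintegralB//; last 2 first.
- exact: L2_mul.
- by apply: Rintegrable_sum => p _; exact: L2_mul.
rewrite Rintegral_sum; last by move=> p _; exact: L2_mul.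
rewrite big1 ?subr0// => p _; apply: orthogonality => //.
  exact: chaos_kernelP.
exact: level_null_le G0.
Qed.

(** Young's inequality with weight 1/2 in [residual_sqr] gives E(r^2) <= E(r^2) / 2 + 2 E(F0^2),
    whence the factor 4. Any bound uniform in N would do. *)
Let K := 4 * \int[P]_w (F0 w) ^+ 2.

Let K_ge0 : 0 <= K.
Proof. by rewrite mulr_ge0//; apply: Rintegral_ge0 => w _; exact: sqr_ge0. Qed.

Lemma residual_bounded N : \int[P]_w (residual N w) ^+ 2 <= K.
Proof.
have [LG _ _] := residualP N; have [LF0 _ _] := residualP 0.
have h2 : 0 < 2^-1 :> R by rewrite invr_gt0.
have := Rintegral_mul_le h2 LG LF0.
rewrite invrK -residual_sqr ger0_norm; last by apply: Rintegral_ge0 => w _; exact: sqr_ge0.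
rewrite /K; lra.
Qed.

Definition weakly_null (psi : Omega -> R) := L2 psi /\
  (fun N => \int[P]_w (residual N w * psi w)) @ \oo --> (0 : R).

Lemma weakly_null_close psi : L2 psi ->
  (forall e, 0 < e -> exists2 psi', weakly_null psi' &
     \int[P]_w (psi w - psi' w) ^+ 2 <= e) -> weakly_null psi.
Proof.
move=> Lpsi H; split => //; apply/cvgrPdist_le => e e0.
(* The error splits into thirds: [t] times the bound [K], [t^-1] times the squared distance
   [t * (e / 3)], and the pairing with the approximant. [K + 1] keeps the denominator positive. *)
pose t := e / (3 * (K + 1)).
have K1 : 0 < K + 1 by rewrite ltr_wpDl.
have t0 : 0 < t by rewrite divr_gt0// mulr_gt0.
have [psi' [Lpsi' Wpsi'] psiE] := H (t * (e / 3)) (mulr_gt0 t0 (divr_gt0 e0 (ltr0Sn _ _))).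
have e3 : 0 < e / 3 by rewrite divr_gt0.
move/cvgrPdist_le : Wpsi' => /(_ _ e3).
apply: filterS => N; rewrite !sub0r !normrN => HN.
have [LG _ _] := residualP N.
have -> : \int[P]_w (residual N w * psi w) = \int[P]_w (residual N w * psi' w) +
    \int[P]_w (residual N w * (psi w - psi' w)).
  rewrite -RintegralD//; try by apply: L2_mul => //; exact: L2B.
  by apply: eq_Rintegral => w _; ring.
apply: (le_trans (ler_normD _ _)).
have := Rintegral_mul_le t0 LG (L2B Lpsi Lpsi').
have H1 : t * \int[P]_w (residual N w) ^+ 2 <= e / 3.
  apply: (@le_trans _ _ (t * (K + 1))).
    by rewrite ler_pM2l// (le_trans (residual_bounded N))// lerDl.
  rewrite /t invfM mulrA mulfVK// gt_eqF//.
have H2 : t^-1 * \int[P]_w (psi w - psi' w) ^+ 2 <= e / 3.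
  by rewrite ler_pdivrMl.
move: HN H1 H2; lra.
Qed.

Lemma weakly_nullD f g : weakly_null f -> weakly_null g ->
  weakly_null (fun w => f w + g w).
Proof.
move=> [Lf Wf] [Lg Wg]; split; first exact: L2D.
have E N : \int[P]_w (residual N w * (f w + g w)) =
    \int[P]_w (residual N w * f w) + \int[P]_w (residual N w * g w).
  have [LG _ _] := residualP N.
  rewrite -RintegralD//; try exact: L2_mul.
  by apply: eq_Rintegral => w _; rewrite mulrDr.
under eq_fun do rewrite E.
by have := cvgD Wf Wg; rewrite addr0; exact.
Qed.

Lemma weakly_nullZ r f : weakly_null f -> weakly_null (fun w => r * f w).
Proof.
move=> [Lf Wf]; split; first exact: L2Z.
have E N : \int[P]_w (residual N w * (r * f w)) = r * \int[P]_w (residual N w * f w).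
  have [LG _ _] := residualP N.
  rewrite -RintegralZl//; last exact: L2_mul.
  by apply: eq_Rintegral => w _; rewrite mulrCA.
under eq_fun do rewrite E.
by have := cvgM (cvg_cst r) Wf; rewrite mulr0; exact.
Qed.

(** The pairing is exactly 0 as soon as N >= n. *)
Lemma weakly_null_sample n S : measurable S -> weakly_null (\1_(sample n @^-1` S)).
Proof.
move=> mS; have mSp := mpre mS; split.
  apply: (@L2_bounded _ _ _ _ 1) => //.
  by move=> w; rewrite indicE; case: (_ \in _); rewrite ?normr1 ?normr0.
apply: cvg_near_cst; exists n => // N /= nN.
have [LG _ G0] := residualP N.
under eq_Rintegral do rewrite mulrC.
by rewrite Rintegral_indic// (level_null_le nN G0).
Qed.

Lemma weakly_null_indic B : sigma_D D B -> weakly_null (\1_B).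
Proof.
move=> sB; have mB := sigma_D_measurable sB.
apply: weakly_null_close.
  apply: (@L2_bounded _ _ _ _ 1) => //.
  by move=> w; rewrite indicE; case: (_ \in _); rewrite ?normr1 ?normr0.
move=> e e0; have [_ /(_ _ e0)[_ [m [S [mS ->]]] BE]] := sigma_D_approximable limD 0 sB.
(* A tail event from index 0 on is an event of a finite sample. The squared distance of two
   indicators is the probability of the symmetric difference. *)
rewrite -[X in symdiff B X]/(sample m @^-1` S) in BE.
exists (\1_(sample m @^-1` S)); first exact: weakly_null_sample.
have mSp := mpre mS.
apply: le_trans (_ : fine (P (symdiff B (sample m @^-1` S))) <= _); last first.
  by rewrite -lee_fin fineK ?fin_num_measure//; exact: measurable_symdiff.
rewrite -[X in X <= _]/(fine _) (_ : (fun w => _) =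
    (fun w => (\1_(symdiff B (sample m @^-1` S)) w)%:E)).
  by rewrite integral_indic ?setIT//; exact: measurable_symdiff.
apply/funext => w; rewrite !indicE /symdiff in_setU !in_setD.
by case: (w \in B); case: (w \in _); rewrite /= ?subrr ?subr0 ?sub0r ?sqrrN ?expr0n ?expr1n.
Qed.

Lemma weakly_null_nnsfun (s : {nnsfun OD >-> R}) : weakly_null (fun w : Omega => s w).
Proof.
have -> : (fun w : Omega => s w) = (fun w : Omega => \sum_(r <- fset_set (range s))
    (r * \1_(s @^-1` [set r] : set Omega) w)).
  by apply/funext => w; rewrite [in LHS](fimfunE s w) fsbig_finite.
elim: (fset_set _ : seq R) => [|r rs IH].
  under eq_fun do rewrite big_nil.
  split; first exact: L2_cst.
  apply: cvg_near_cst; apply: nearW => N.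
  by under eq_Rintegral do rewrite mulr0; rewrite Rintegral_cst// mul0r.
under eq_fun do rewrite big_cons.
apply: weakly_nullD => //; apply: weakly_nullZ; apply: weakly_null_indic.
have mr : measurable (s @^-1` [set r]) by [].
exact: mr.
Qed.

(** Simple functions increasing to [f] converge in square mean, with [f ^+ 2] as dominating
    function. *)
Lemma weakly_null_ge0 f : L2 f -> measurable_fun (setT : set OD) f ->
  (forall w, 0 <= f w) -> weakly_null f.
Proof.
move=> Lf mf f0; apply: weakly_null_close => // e e0.
have mf' : measurable_fun (setT : set OD) (EFin \o f) by exact/measurable_EFinP.
pose s := nnsfun_approx measurableT mf'.
have cs w : s n w @[n --> \oo] --> f w.
  have f0' (x : OD) : [set: OD] x -> (0 <= (EFin \o f) x)%E by rewrite lee_fin.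
  by have /fine_cvgP[] := cvg_nnsfun_approx measurableT mf' f0' (I : [set: OD] w).
have ns w : nondecreasing_seq (fun n => s n w).
  by move=> m n mn; exact: (lefP _ _ (nd_nnsfun_approx measurableT mf' mn)).
have sf n w : s n w <= f w.
  by rewrite -(cvg_lim _ (cs w))//; apply: nondecreasing_cvgn_le => //; apply/cvg_ex; exists (f w).
have ms n : measurable_fun setT (fun w : Omega => s n w).
  have := measurable_funPT (s n).
  by move=> H; exact: (measurableT_comp H (@measurable_to_sigma_D _ _ _ _ _ _ D)).
have [mf1 If] := Lf.
have : \int[P]_w (f w - s n w) ^+ 2 @[n --> \oo] --> \int[P]_w (0 : R).
  apply: (Rintegral_dominated measurableT _ _ _ If) => //.
  - by move=> n; apply: measurable_funX; exact: measurable_funB.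
  - apply: aeW => w.
    have : (f w - s n w) ^+ 2 @[n --> \oo] --> (f w - f w) ^+ 2.
      under eq_fun do rewrite expr2; rewrite expr2.
      by apply: cvgM; apply: cvgB => //; exact: cvg_cst.
    by rewrite subrr expr0n.
  - move=> n w; rewrite ger0_norm ?sqr_ge0// ler_pXn2r ?nnegrE ?subr_ge0//.
    by rewrite gerBl.
rewrite Rintegral_cst// mul0r => /cvgrPdist_le/(_ _ e0)[n _ Hn].
exists (fun w : Omega => s n w); first exact: weakly_null_nnsfun.
have := Hn n (leqnn n); rewrite sub0r normrN; apply: le_trans; exact: ler_norm.
Qed.

Lemma residual_cvg0 : \int[P]_w (residual N w) ^+ 2 @[N --> \oo] --> (0 : R).
Proof.
have [LF0 mF0 _] := residualP 0.
have mp : measurable_fun (setT : set OD) F0^\+ by exact: measurable_funrpos.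
have mn : measurable_fun (setT : set OD) F0^\- by exact: measurable_funrneg.
have mp' := measurableT_comp mp (@measurable_to_sigma_D _ _ _ _ _ _ D).
have mn' := measurableT_comp mn (@measurable_to_sigma_D _ _ _ _ _ _ D).
have Lle (f : Omega -> R) : measurable_fun setT f -> (forall w, `|f w| <= `|F0 w|) -> L2 f.
  move=> mf fF; split => //; case: LF0 => _; apply: le_Rintegrable.
    exact: measurable_funX.
  by move=> w; rewrite !normrX ler_pXn2r ?nnegrE.
have Wp : weakly_null F0^\+.
  apply: weakly_null_ge0 => //.
  apply: Lle => // w; by rewrite [leRHS]normr_funrposneg ger0_norm ?funrpos_ge0// lerDl funrneg_ge0.
have Wn : weakly_null F0^\-.
  apply: weakly_null_ge0 => //.
  apply: Lle => // w; by rewrite [leRHS]normr_funrposneg ger0_norm ?funrneg_ge0// lerDr funrpos_ge0.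
have [_ W] := weakly_nullD Wp (weakly_nullZ (-1) Wn).
under eq_fun do rewrite residual_sqr.
move: W; apply: cvg_trans; apply: near_eq_cvg; apply: nearW => N.
by apply: eq_Rintegral => w _; rewrite mulN1r -funrposnegE.
Qed.

Lemma chaos_exists : chaos_representation D X F chaos_kernel.
Proof.
split; first by case=> [//|p] _; apply/Xi_chaos_fun; exact: chaos_kernelP.
have E N : ('N[P]_2%:E[(fun w => (F w - (fine 'E_P[F] +
     \sum_(1 <= n < N.+1) D_integral D (@chaos_kernel n) w)%R)%:E)] =
   (Num.sqrt (\int[P]_w (residual N w) ^+ 2)%R)%:E)%E.
  have [LG _ _] := residualP N.
  by rewrite -(LnormE LG); apply: eq_Lnorm => w; rewrite /= residualE.
under eq_fun do rewrite E.
apply: cvg_EFin; first exact: nearW.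
rewrite -[X in _ --> X](@sqrtr0 R).
exact: (cvg_comp _ _ residual_cvg0 (@sqrt_continuous R 0)).
Qed.

Section uniqueness.
Variable h : forall n, n.-tuple A -> R.
Hypothesis reph : chaos_representation D X F h.

Let hP p : chaos_fun (@h p.+1).
Proof. by apply/Xi_chaos_fun; case: reph => H _; exact: H. Qed.

(** Over an event of m draws, the integral of the remainder is the same for all N >= m because the
    further integrals are null there; it also tends to 0, so it vanishes already at N = m. *)
Lemma chaos_projection m S : measurable S ->
  \sum_(1 <= n < m.+1) \int[P]_(w in sample m @^-1` S) D_integral D (@h n) w =
  \int[P]_(w in sample m @^-1` S) F0 w.
Proof.
move=> mS; have mSp := mpre mS.
pose r N w := F w - (fine 'E_P[F] + \sum_(1 <= n < N.+1) D_integral D (@h n) w).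
have LI p : L2 (D_integral D (@h p.+1)).
  by have [mh _ Lh _] := hP p; exact: L2_D_integral.
have rE N w : r N w = F0 w - \sum_(p < N) D_integral D (@h p.+1) w.
  by rewrite /r opprD addrA big_add1 big_mkord.
have [LF0 _ _] := residualP 0.
have Lr N : L2 (r N).
  rewrite (_ : r N = fun w => F0 w - \sum_(p < N) D_integral D (@h p.+1) w).
    by apply: L2B => //; exact: L2_sum.
  by apply/funext => w; rewrite rE.
have r0 : \int[P]_w (r N w) ^+ 2 @[N --> \oo] --> (0 : R).
  case: reph => _.
  have E N : ('N[P]_2%:E[(fun w => (r N w)%:E)] =
     (Num.sqrt (\int[P]_w (r N w) ^+ 2)%R)%:E)%E by rewrite -(LnormE (Lr N)).
  under eq_fun do rewrite E.
  move=> /fine_cvgP[_ /=]; rewrite /comp /= => H.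
  have E2 N : \int[P]_w (r N w) ^+ 2 =
      Num.sqrt (\int[P]_w (r N w) ^+ 2) * Num.sqrt (\int[P]_w (r N w) ^+ 2).
    by rewrite -expr2 sqr_sqrtr//; apply: Rintegral_ge0 => w _; exact: sqr_ge0.
  under eq_fun do rewrite E2.
  by have := cvgM H H; rewrite mulr0; exact.
have L1 : L2 (\1_(sample m @^-1` S)).
  apply: (@L2_bounded _ _ _ _ 1) => //.
  by move=> w; rewrite indicE; case: (_ \in _); rewrite ?normr1 ?normr0.
have rm : \int[P]_(w in sample m @^-1` S) r m w = 0.
  apply/eqP; rewrite -normr_le0; apply/ler_addgt0Pr => e e0; rewrite add0r.
  have const N : (m <= N)%N -> \int[P]_(w in sample m @^-1` S) r m w =
      \int[P]_w (r N w * \1_(sample m @^-1` S) w).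
    move=> /subnKC <-; elim: (N - m)%N => [|q IH].
      by rewrite addn0 -Rintegral_indic//; apply: eq_Rintegral => w _; rewrite mulrC.
    rewrite IH addnS; set M := (m + q)%N; have mM : (m <= M)%N by exact: leq_addr.
    have E w : r M.+1 w * \1_(sample m @^-1` S) w =
       r M w * \1_(sample m @^-1` S) w - \1_(sample m @^-1` S) w * D_integral D (@h M.+1) w.
      by rewrite !rE big_ord_recr /=; ring.
    under [RHS]eq_Rintegral do rewrite E.
    rewrite RintegralB//; [|exact: L2_mul|exact: L2_mul].
    rewrite [X in _ - X]Rintegral_indic//.
    by rewrite (level_null_le mM (D_integral_level_null (hP M)))// subr0.
  (* Weight 2/e and tolerance e^2/4 make the first term of Young's inequality at most e/2; the
     indicator, with inverse weight e/2, contributes at most e/2. *)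
  have t0 : 0 < 2 / e by rewrite divr_gt0.
  have e2 : 0 < e ^+ 2 / 4 by rewrite divr_gt0// exprn_gt0.
  move/cvgrPdist_le : r0 => /(_ _ e2)[N _ HN].
  have := HN (maxn N m) (leq_maxl _ _); rewrite sub0r normrN => H1.
  rewrite (const _ (leq_maxr N m)).
  have := Rintegral_mul_le t0 (Lr (maxn N m)) L1; set q := maxn N m in H1 *.
  have H2 : \int[P]_w (\1_(sample m @^-1` S) w ^+ 2 : R) <= 1.
    apply: (@le_trans _ _ (\int[P]_w (1 : R))).
      apply: le_Rintegral => //.
        by case: L1.
      exact: finite_measure_integrable_cst.
    rewrite Rintegral_cst// mul1r -lee_fin fineK ?fin_num_measure//.
    exact: probability_le1.
  have H3 : 2 / e * \int[P]_w r q w ^+ 2 <= e / 2.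
    rewrite mulrC mulrA ler_pdivrMr//.
    have := le_trans (ler_norm _) H1; rewrite (expr2 e); lra.
  rewrite invf_div => H4; apply: (le_trans H4).
  have H5 : e / 2 * \int[P]_w (\1_(sample m @^-1` S) w ^+ 2 : R) <= e / 2.
    by rewrite -[leRHS]mulr1 ler_pM2l// divr_gt0.
  move: H3 H5; lra.
move: rm; under eq_Rintegral do rewrite rE.
have Ir p : P.-integrable (sample m @^-1` S) (EFin \o D_integral D (@h p.+1)).
  by apply: Rintegrable_on => //; exact: L2_Rintegrable.
rewrite RintegralB//; last 2 first.
- by apply: Rintegrable_on => //; exact: L2_Rintegrable.
- apply: Rintegrable_on => //; apply: Rintegrable_sum => p _; exact: L2_Rintegrable.
move=> /eqP; rewrite subr_eq0 => /eqP ->.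
rewrite -Rintegral_indic//; under eq_Rintegral do rewrite mulr_sumr.
rewrite Rintegral_sum; last first.
  by move=> p _; apply: Rintegrable_indic => //; exact: L2_Rintegrable.
rewrite big_add1 big_mkord /=; apply: eq_bigr => p _.
by rewrite Rintegral_indic.
Qed.

End uniqueness.

(** Both representations have the same projection on p + 1 draws. Induction removes the terms of
    lower order, and the key identity turns the last one into a nonzero multiple of the kernel
    integrated over an arbitrary event of the sample. *)
Lemma chaos_unique (h h' : forall n, n.-tuple A -> R) :
  chaos_representation D X F h -> chaos_representation D X F h' ->
  forall n, (0 < n)%N ->
    {ae distribution P (sample n), forall x, h' n x = h n x}.
Proof.
move=> reph reph'; elim/ltn_ind => -[//|p] IH _.
have hP q : chaos_fun (h q.+1).
  by apply/Xi_chaos_fun; case: reph => H _; exact: H.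
have h'P q : chaos_fun (h' q.+1).
  by apply/Xi_chaos_fun; case: reph' => H _; exact: H.
have [mh _ Lh _] := hP p; have [mh' _ Lh' _] := h'P p.
have eqI q S : (q < p)%N -> measurable S ->
    \int[P]_(w in sample p.+1 @^-1` S) D_integral D (h q.+1) w =
    \int[P]_(w in sample p.+1 @^-1` S) D_integral D (h' q.+1) w.
  move=> qp mS; have [mq _ Lq _] := hP q; have [mq' _ Lq' _] := h'P q.
  (* With the random integrals replaced by fresh draws, equality of the kernels almost everywhere
     for the law of the sample suffices, and powers of [D] need not be compared. *)
  rewrite -!(D_integral_tail polyaX limD)//; try exact: L2_Rintegrable.
  have mt : measurable_fun setT (tail p.+1 q.+1) by exact: measurable_sample_at.
  have mSp := mpre mS; rewrite -[LHS](Rintegral_indic _ _ mSp) -[RHS](Rintegral_indic _ _ mSp).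
  apply: ae_eq_Rintegral.
  - apply: measurable_funM; first by apply: measurable_indic; exact: mpre.
    exact: measurableT_comp.
  - apply: measurable_funM; first by apply: measurable_indic; exact: mpre.
    exact: measurableT_comp.
  have [N [mN N0 sN]] := IH q.+1 qp isT.
  exists (tail p.+1 q.+1 @^-1` N); split.
  - by rewrite -[X in measurable X]setTI; exact: mt.
  - have inj : injective (@tail_index p.+1 q.+1).
      by move=> x y /eqP; rewrite eqn_add2l => /eqP; exact: val_inj.
    exact: etrans (exchangeable polyaX limD inj mN) N0.
  by move=> w /= Hw; apply: sN => /= H; apply: Hw; rewrite H.
suff : {ae distribution P (sample p.+1), forall x, (h' p.+1 x - h p.+1 x) = 0}.
  by apply: filterS => x /eqP; rewrite subr_eq0 => /eqP.
apply: ae_distribution_eq0.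
- exact: measurable_funB.
- by apply: RintegrableB; exact: L2_Rintegrable.
move=> S mS; have mSp := mpre mS.
rewrite RintegralB//; try by apply: Rintegrable_on => //; exact: L2_Rintegrable.
apply/eqP; rewrite subr_eq0; apply/eqP.
apply: (mulfI (chaos_const_neq0 alpha_gt0 p)).
rewrite -(chaos_key (h'P p) mS) -(chaos_key (hP p) mS).
have := chaos_projection reph mS; rewrite -(chaos_projection reph' mS).
rewrite !big_add1 !big_mkord /= !big_ord_recr /=.
rewrite (eq_bigr (fun q : 'I_p => \int[P]_(w in sample p.+1 @^-1` S) D_integral D (h' q.+1) w)).
  by move=> /addrI ->.
by move=> q _; apply: eqI.
Qed.

End decomposition.
End chaos.

Theorem theorem1 (R : realType) (A : ptopologicalType) (polishA : polish R A)
    (alpha : {finite_measure set (borel A) -> \bar R})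
    (alpha_gt0 : (0 < alpha setT)%E)
    (d : measure_display) (Omega : measurableType d) (P : probability Omega R)
    (X : nat -> {RV P >-> borel A}) (polyaX : polya_sequence X alpha)
    (D : {RV P >-> pprobability (borel A) R})
    (DF : dirichlet_ferguson D alpha) (limD : empirical_limit D X)
    (F : Omega -> R) (L2F : L2_D D F) :
  exists h : forall n, n.-tuple (borel A) -> R,
    chaos_representation D X F h /\
    forall h' : forall n, n.-tuple (borel A) -> R,
      chaos_representation D X F h' ->
      forall n, (0 < n)%N ->
        {ae distribution P (sample X n), forall x, h' n x = h n x}.
Proof.
exists (chaos_kernel polyaX limD F); split; first exact: chaos_exists.
by move=> h' reph' n n0; exact: (chaos_unique polyaX limD alpha_gt0 L2F
  (chaos_exists polyaX limD alpha_gt0 L2F) reph' n0).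
Qed.
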